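(* Let $X$ be a curve over $\mathbb{Q}$ and let $t\in\mathbb{Q}(X)$ be a non-constant rational function such that $\mathbb{Q}(X)\neq\mathbb{Q}(t)$. Assume that all finite critical values of $t$ belong to $\mathbb{Q}$ and that the field extension $\bar{\mathbb{Q}}(X)/\bar{\mathbb{Q}}(t)$ is abelian. For every $n\in\mathbb{Z}$ pick $P_n\in X(\bar{\mathbb{Q}})$ such that $t(P_n)=n$. Then there exists a real number $c>0$ such that for every sufficiently large integer $N$, among the number fields $\mathbb{Q}(P_1),\ldots,\mathbb{Q}(P_N)$ there are at least $cN$ distinct ones.
   Context: ''Curve'' means smooth geometrically irreducible projective algebraic curve. An algebraic closure $\bar{\mathbb{Q}}$ of $\mathbb{Q}$ is fixed, and all number fields are subfields of this $\bar{\mathbb{Q}}$; ''distinct'' means distinct as subfields of $\bar{\mathbb{Q}}$. For $P\in X(\bar{\mathbb{Q}})$, $\mathbb{Q}(P)$ denotes the field of definition of $P$ over $\mathbb{Q}$ (the subfield of $\bar{\mathbb{Q}}$ generated by the coordinates of $P$). An element $\alpha\in\bar{\mathbb{Q}}\cup\{\infty\}$ is called a critical value (or branch point) of $t\in\bar{\mathbb{Q}}(X)$ if the rational function $t-\alpha$ has at least one multiple zero in $X(\bar{\mathbb{Q}})$, with the convention $t-\infty=t^{-1}$. A critical value is finite if it is not $\infty$. An abelian field extension is a Galois extension with abelian Galois group. *)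

(* Defs.v *)
From HB Require Import structures.
From mathcomp Require Import all_boot all_order all_algebra all_field.
From mathcomp Require Import boolp classical_sets reals.
From mathcomp Require Import mpoly.

Set Implicit Arguments.
Unset Strict Implicit.
Unset Printing Implicit Defensive.

Import GRing.Theory Num.Theory.

Local Open Scope ring_scope.
Local Open Scope classical_set_scope.
Local Open Scope quotient_scope.

(* The fixed algebraic closure of the rational numbers is algC.               *)

Section Subfields.
Variable L : fieldType.

Definition subfield_gen (S : set L) : set L :=
  smallest [set K : set L | divring_closed [pred x in K]] S.

Variable K : set L.

Definition poly_over (p : {poly L}) : Prop := forall i, K p`_i.

(* For p, q over the field K, divisibility of p by q in L[X] and in K[X]      *)
(* are the same.                                                              *)
Definition irreducible_over (p : {poly L}) : Prop :=
  [/\ poly_over p, (1 < size p)%N &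
      forall q, poly_over q -> size q != 1%N -> q %| p -> q %= p].

Definition algebraic_extension : Prop :=
  forall x : L, exists p, [/\ poly_over p, p != 0 & root p x].

Definition normal_extension : Prop :=
  forall p x, irreducible_over p -> root p x ->
  exists rs : seq L, p %= \prod_(r <- rs) ('X - r%:P).

Definition separable_extension : Prop :=
  forall p x, irreducible_over p -> root p x -> separable_poly p.

Definition galois_extension : Prop :=
  [/\ algebraic_extension, normal_extension & separable_extension].

Definition galois_group : set {rmorphism L -> L} :=
  [set g : {rmorphism L -> L} | bijective g /\ forall a, K a -> g a = a].

Definition abelian_extension : Prop :=
  galois_extension /\
  forall g h, galois_group g -> galois_group h -> g \o h =1 h \o g.

End Subfields.

Section SubfieldType.
Variables (L : fieldType) (K : divringClosed L).

Record subfield_carrier : Type := SubfieldCarrier { elt : L; _ : elt \in K }.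

HB.instance Definition _ := [isSub for elt].
HB.instance Definition _ := [Choice of subfield_carrier by <:].
HB.instance Definition _ :=
  [SubChoice_isSubComUnitRing of subfield_carrier by <:].
HB.instance Definition _ :=
  [SubComUnitRing_isSubIntegralDomain of subfield_carrier by <:].
HB.instance Definition _ :=
  [SubIntegralDomain_isSubField of subfield_carrier by <:].

End SubfieldType.

(* A point of the n-dimensional projective space is given by a nonzero vector *)
(* of homogeneous coordinates; subsets are given by the cones above them.     *)
Definition coordinates (n : nat) : Type := 'I_n.+1 -> algC.

Section Projective.
Variable n : nat.
Implicit Types (Z : set (coordinates n)) (S : set {mpoly algC[n.+1]}).

Definition homogeneous (A : nzRingType) (F : {mpoly A[n.+1]}) : Prop :=
  exists d : nat, F \is d.-homog.

Definition zero_locus S : set (coordinates n) :=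
  [set x | (exists i, x i != 0) /\ forall F, S F -> F.@[x] = 0].

Definition zariski_closed Z : Prop :=
  exists2 S, (forall F, S F -> homogeneous F) & Z = zero_locus S.

Definition irreducible Z : Prop :=
  Z !=set0 /\
  forall A B, zariski_closed A -> zariski_closed B ->
    Z `<=` A `|` B -> Z `<=` A \/ Z `<=` B.

Definition has_chain Z (d : nat) : Prop :=
  exists C : nat -> set (coordinates n),
    (forall i, (i <= d)%N ->
       [/\ zariski_closed (C i), irreducible (C i) & C i `<=` Z]) /\
    (forall i, (i < d)%N -> C i `<` C i.+1).

Definition krull_dim Z (d : nat) : Prop := has_chain Z d /\ ~ has_chain Z d.+1.

(* The subfield of algC generated by the affine coordinates of the point.     *)
Definition field_of_definition (x : coordinates n) : set algC :=
  subfield_gen [set a | exists i j, x j != 0 /\ a = x i / x j].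

End Projective.

Definition to_algC n (F : {mpoly rat[n.+1]}) : {mpoly algC[n.+1]} :=
  map_mpoly (ratr : rat -> algC) F.

Definition alg_points n (fs : seq {mpoly rat[n.+1]}) : set (coordinates n) :=
  zero_locus [set F | exists2 f, f \in fs & F = to_algC f].

Definition jacobian n (fs : seq {mpoly rat[n.+1]}) (x : coordinates n) :
    'M[algC]_(size fs, n.+1) :=
  \matrix_(i, j) ((to_algC fs`_i)^`M(j)).@[x].

(* The subscheme of projective n-space over the rationals cut out by fs; by   *)
(* the Jacobian criterion, being of dimension 1 it is smooth if and only if   *)
(* the Jacobian matrix has rank n - 1 at all its geometric points. Being      *)
(* smooth it is reduced, and it is geometrically irreducible if and only if   *)
(* its set of algC-points is irreducible.                                     *)
Record curve : Type := Curve {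
  ambient_dim : nat;
  equations : seq {mpoly rat[ambient_dim.+1]};
  equations_homogeneous : forall f, f \in equations -> homogeneous f;
  curve_irreducible : irreducible (alg_points equations);
  curve_dim : krull_dim (alg_points equations) 1;
  curve_smooth : forall x, alg_points equations x ->
        (\rank (jacobian equations x)).+1 = ambient_dim
}.

Definition curve_points (X : curve) : set (coordinates (ambient_dim X)) :=
  alg_points (equations X).
Arguments curve_points X _ : clear implicits.

Lemma subf_div (F : fieldType) (a b c d : F) :
  b != 0 -> d != 0 -> a / b - c / d = (a * d - c * b) / (b * d).
Proof. by move=> b0 d0; rewrite -mulNr addf_div // mulNr. Qed.

Lemma fraction_numden (A : idomainType) (a : {fraction A}) :
  a = FracField.tofrac (\n_(repr a)) / FracField.tofrac (\d_(repr a)).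
Proof.
set x := repr a.
have d0 : FracField.tofrac (\d_x) != 0 by rewrite tofrac_eq0 denom_ratioP.
apply: (mulIf d0); rewrite divfK // -[a]reprK -/x; unlock FracField.tofrac.
rewrite -[LHS]FracField.pi_mul; apply/eqmodP => /=.
rewrite /FracField.mulf /equivf !numden_Ratio ?mulr1 ?denom_ratioP ?oner_neq0 //.
by rewrite mulrC.
Qed.

Section CoordinateRing.
Variable X : curve.
Local Notation n := (ambient_dim X).

Definition vanishing_ideal : {pred {mpoly algC[n.+1]}} :=
  fun F => `[< forall x, curve_points X x -> F.@[x] = 0 >].

Lemma vanishing_idealP F :
  reflect (forall x, curve_points X x -> F.@[x] = 0) (F \in vanishing_ideal).
Proof. exact: asboolP. Qed.

Lemma vanishing_ideal_idealr : idealr_closed vanishing_ideal.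
Proof.
split.
- by apply/vanishing_idealP => x _; rewrite meval0.
- apply/negP => /vanishing_idealP h.
  have [[x /h]] := curve_irreducible X.
  by rewrite meval1 => /eqP; rewrite oner_eq0.
- move=> F G H /vanishing_idealP hG /vanishing_idealP hH.
  by apply/vanishing_idealP => x Xx; rewrite mevalD mevalM hG ?hH // mulr0 addr0.
Qed.

HB.instance Definition _ :=
  isIdealr.Build {mpoly algC[n.+1]} vanishing_ideal vanishing_ideal_idealr.

(* The restriction of F to the line spanned by x.                             *)
Definition on_line (F : {mpoly algC[n.+1]}) (x : coordinates n) : {poly algC} :=
  \sum_(d < msize F) (pihomog mdeg d F).@[x] *: 'X^d.

Lemma meval_scale d (F : {mpoly algC[n.+1]}) (x : coordinates n) a :
  F \is d.-homog -> F.@[fun i => a * x i] = a ^+ d * F.@[x].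
Proof.
move=> /dhomogP hF; rewrite !mevalE mulr_sumr; apply: eq_big_seq => m mF.
rewrite mulrCA; congr (_ * _).
under eq_bigr do rewrite exprMn.
by rewrite big_split /= prodrXr -mdegE (hF _ mF).
Qed.

Lemma on_lineE F x a : (on_line F x).[a] = F.@[fun i => a * x i].
Proof.
rewrite {2}[F](pihomog_partitionE (mf := mdeg) (k := msize F)); last first.
  exact: leqnn.
rewrite rmorph_sum /= horner_sum; apply: eq_bigr => d _.
by rewrite hornerZ hornerXn mulrC (meval_scale _ _ (pihomogP _ _ _)).
Qed.

Lemma on_line_closed F :
  zariski_closed [set x | (exists i, x i != 0) /\ on_line F x = 0].
Proof.
exists [set G | exists d, G = pihomog mdeg d F].
  by move=> _ [d ->]; exists d; exact: pihomogP.
apply/seteqP; split=> x [x0 hx]; split=> //.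
  move=> _ [d ->]; have [dF|Fd] := ltnP d (msize F).
    have := congr1 (fun p : {poly algC} => p`_d) hx.
    rewrite coef0 /on_line coef_sum (bigD1 (Ordinal dF)) //= coefZ coefXn eqxx.
    rewrite mulr1 big1 ?addr0 // => i ne; rewrite coefZ coefXn.
    by case: eqP => [e|]; rewrite ?mulr0 //; case/eqP: ne; apply: val_inj.
  rewrite pihomogE big_seq_cond big_pred0 ?meval0 // => m.
  apply/negP => /andP[/msize_mdeg_lt lt /eqP e].
  by move: lt; rewrite e ltnNge Fd.
by rewrite /on_line big1 // => d _; rewrite hx ?scale0r //; exists d.
Qed.

Lemma points_scale x a : a != 0 -> curve_points X x -> curve_points X (fun i => a * x i).
Proof.
move=> a0 [[i xi] hx]; split; first by exists i; rewrite mulf_neq0.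
move=> F SF; have [f ff eF] := SF.
have [d hd] : homogeneous F.
  have [d hd] := equations_homogeneous ff; exists d; rewrite eF.
  apply/dhomogP => u; rewrite (perm_mem (msupp_map_mpoly f (fmorph_inj _))).
  exact: (dhomogP _ _ _ hd).
by rewrite (meval_scale _ _ hd) hx ?mulr0.
Qed.

Lemma vanishing_ideal_prime : prime_idealr_closed vanishing_ideal.
Proof.
move=> F G /vanishing_idealP FG.
have [_ irr] := curve_irreducible X.
have onl H x : curve_points X x -> on_line H x = 0 -> H.@[x] = 0.
  move=> _ /(congr1 (horner^~ 1)); rewrite on_lineE horner0 => <-.
  by apply: meval_eq => i; rewrite mul1r.
have [] := irr _ _ (on_line_closed F) (on_line_closed G).
- move=> x Xx; have [x0 _] := Xx.
  suff : on_line F x * on_line G x = 0.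
    by move/eqP; rewrite mulf_eq0 => /orP[] /eqP; [left|right].
  set p := _ * _.
  apply: (@roots_geq_poly_eq0 _ _ [seq i.+1%:R | i <- iota 0 (size p)]).
  + apply/allP => _ /mapP[i _ ->]; apply/rootP.
    rewrite hornerM !on_lineE -mevalM; apply: FG; apply: points_scale Xx.
    by rewrite pnatr_eq0.
  + rewrite map_inj_uniq ?iota_uniq // => i j /eqP.
    by rewrite eqr_nat => /eqP[].
  + by rewrite size_map size_iota.
- move=> XF; apply/orP; left; apply/vanishing_idealP => x Xx.
  by apply: onl => //; have [] := XF _ Xx.
- move=> XG; apply/orP; right; apply/vanishing_idealP => x Xx.
  by apply: onl => //; have [] := XG _ Xx.
Qed.

HB.instance Definition _ :=
  isPrimeIdealrClosed.Build {mpoly algC[n.+1]} vanishing_ideal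
    vanishing_ideal_prime.

Definition coordinate_ring : Type := {ideal_quot vanishing_ideal}.

HB.instance Definition _ := GRing.ComNzRing.on coordinate_ring.

Definition quotient_unit : pred coordinate_ring :=
  fun a => `[< exists b, b * a = 1 >].

Definition quotient_inv (a : coordinate_ring) : coordinate_ring :=
  if pselect (exists b, b * a = 1) is left e then projT1 (cid e) else a.

Lemma quotient_mulVx :
  {in quotient_unit, left_inverse 1 quotient_inv *%R}.
Proof.
move=> a /asboolP ua; rewrite /quotient_inv.
by case: pselect => // e; case: cid.
Qed.

Lemma quotient_unitPl (a b : coordinate_ring) :
  b * a = 1 -> quotient_unit a.
Proof. by move=> ba; apply/asboolP; exists b. Qed.

Lemma quotient_inv_out :
  {in [predC quotient_unit], quotient_inv =1 id}.
Proof.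
by move=> a /asboolP ua; rewrite /quotient_inv; case: pselect.
Qed.

HB.instance Definition _ := GRing.ComNzRing_hasMulInverse.Build coordinate_ring
  quotient_mulVx quotient_unitPl quotient_inv_out.

HB.instance Definition _ := GRing.ComUnitRing_isIntegral.Build coordinate_ring
  (@Quotient.rquot_IdomainAxiom _ vanishing_ideal).

Definition coordinate_class (F : {mpoly algC[n.+1]}) : coordinate_ring :=
  \pi_{ideal_quot vanishing_ideal} F.

Lemma coordinate_class_zmod_morphism : zmod_morphism coordinate_class.
Proof. exact: (rmorphB \pi_{ideal_quot vanishing_ideal}). Qed.

Lemma coordinate_class_monoid_morphism : monoid_morphism coordinate_class.
Proof.
split; first exact: (rmorph1 \pi_{ideal_quot vanishing_ideal}).
exact: (rmorphM \pi_{ideal_quot vanishing_ideal}).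
Qed.

HB.instance Definition _ := GRing.isZmodMorphism.Build
  {mpoly algC[n.+1]} coordinate_ring coordinate_class coordinate_class_zmod_morphism.
HB.instance Definition _ := GRing.isMonoidMorphism.Build
  {mpoly algC[n.+1]} coordinate_ring coordinate_class coordinate_class_monoid_morphism.

(* The field of fractions of the homogeneous coordinate ring, as a field with *)
(* a map from polynomials; these data are determined up to isomorphism, and   *)
(* an opaque witness keeps unification from unfolding a concrete quotient.    *)
Record coordinate_fractions : Type := CoordinateFractions {
  fractions_field : fieldType;
  fractions_map : {rmorphism {mpoly algC[n.+1]} -> fractions_field};
  _ : forall F, (fractions_map F == 0) = (F \in vanishing_ideal);
  _ : forall a, exists F G,
        fractions_map G != 0 /\ a = fractions_map F / fractions_map G
}.

Lemma coordinate_fractions_witness : coordinate_fractions.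
Proof.
pose f : {rmorphism {mpoly algC[n.+1]} -> {fraction coordinate_ring}} :=
  @FracField.tofrac coordinate_ring \o coordinate_class.
apply: (@CoordinateFractions {fraction coordinate_ring} f) => [F|a].
  rewrite /f /= tofrac_eq0 -(rmorph0 coordinate_class) /= /coordinate_class.
  by rewrite -[_ == _]Quotient.idealrBE subr0.
exists (repr (\n_(repr a))), (repr (\d_(repr a))).
rewrite /f /= /coordinate_class !reprK tofrac_eq0 denom_ratioP; split=> //.
exact: fraction_numden.
Qed.

Definition cone_field : fieldType :=
  fractions_field coordinate_fractions_witness.

Definition restr : {rmorphism {mpoly algC[n.+1]} -> cone_field} :=
  fractions_map coordinate_fractions_witness.

Lemma restr_eq0 F : (restr F == 0) = (F \in vanishing_ideal).
Proof. by rewrite /restr /cone_field; case: coordinate_fractions_witness. Qed.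

Lemma cone_field_ratio (a : cone_field) :
  exists F G, restr G != 0 /\ a = restr F / restr G.
Proof.
by move: a; rewrite /restr /cone_field; case: coordinate_fractions_witness.
Qed.

(* By totality of division, this is 0 when G vanishes on X. *)
Definition fraction_of (F G : {mpoly algC[n.+1]}) : cone_field :=
  restr F / restr G.

Definition degree_zero : {pred cone_field} :=
  fun f => `[< exists d F G, [/\ F \is d.-homog, G \is d.-homog &
                               f = fraction_of F G] >].

Lemma degree_zero_divring : divring_closed degree_zero.
Proof.
split.
- apply/asboolP; exists 0%N, 1, 1; split; rewrite ?dhomog1 //.
  by rewrite /fraction_of rmorph1 divr1.
- move=> _ _ /asboolP[d [F [G [hF hG ->]]]] /asboolP[e [H [K [hH hK ->]]]].
  apply/asboolP; rewrite /fraction_of.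
  have [G0|G0] := eqVneq (restr G) 0.
    exists e, (- H), K; split; rewrite ?dhomogN //.
    by rewrite G0 invr0 mulr0 sub0r rmorphN mulNr.
  have [K0|K0] := eqVneq (restr K) 0.
    by exists d, F, G; split => //; rewrite K0 invr0 mulr0 subr0.
  exists (d + e)%N, (F * K - H * G), (G * K); split.
  + by apply: rpredB; [|rewrite addnC]; apply: dhomogM.
  + exact: dhomogM.
  + by rewrite rmorphB !rmorphM /= subf_div.
- move=> _ _ /asboolP[d [F [G [hF hG ->]]]] /asboolP[e [H [K [hH hK ->]]]].
  apply/asboolP; rewrite /fraction_of; exists (d + e)%N, (F * K), (G * H).
  split; [exact: dhomogM | exact: dhomogM |].
  by rewrite invf_div mulf_div !rmorphM.
Qed.

HB.instance Definition _ := GRing.isDivringClosed.Build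
  cone_field degree_zero degree_zero_divring.

(* The function field of X over algC, made of the quotients of homogeneous    *)
(* elements of the same degree, again up to isomorphism and used opaquely.    *)
Record function_field_model : Type := FunctionFieldModel {
  model_field : fieldType;
  model_embed : {rmorphism model_field -> cone_field};
  model_sub : forall a : cone_field, a \in degree_zero -> model_field;
  _ : forall a (a0 : a \in degree_zero), model_embed (model_sub a0) = a;
  _ : forall f, model_embed f \in degree_zero
}.

Lemma function_field_witness : function_field_model.
Proof.
pose f : {rmorphism subfield_carrier degree_zero -> cone_field} := val.
by apply: (@FunctionFieldModel _ f (@SubfieldCarrier _ degree_zero)) => // x;
  apply: valP.
Qed.

Definition function_field : fieldType := model_field function_field_witness.

Definition rfun : {rmorphism function_field -> cone_field} :=
  model_embed function_field_witness.

Definition rfun_sub (a : cone_field) (a0 : a \in degree_zero) : function_field :=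
  model_sub function_field_witness a0.

Lemma rfun_subK a (a0 : a \in degree_zero) : rfun (rfun_sub a0) = a.
Proof.
by move: a a0; rewrite /rfun /rfun_sub /function_field; case: function_field_witness.
Qed.

Lemma rfun_degree_zero f : rfun f \in degree_zero.
Proof.
by move: f; rewrite /rfun /function_field; case: function_field_witness.
Qed.

Lemma degree_zero_const a : fraction_of a%:MP 1 \in degree_zero.
Proof.
by apply/asboolP; exists 0%N, a%:MP, 1; rewrite dhomog1 -alg_mpolyC rpredZ ?dhomog1.
Qed.

Definition constant_function (a : algC) : function_field := rfun_sub (degree_zero_const a).

(* The function field of X over the rationals, as a subfield of               *)
(* function_field X.                                                          *)
Definition rational_function_field : set function_field :=
  [set f | exists d (F G : {mpoly rat[n.+1]}),
     [/\ F \is d.-homog, G \is d.-homog &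
         rfun f = fraction_of (to_algC F) (to_algC G)]].

(* f is regular at the point x and takes the value a there. *)
Definition has_value (f : function_field) (x : coordinates n) (a : algC) : Prop :=
  exists d (F G : {mpoly algC[n.+1]}),
    [/\ F \is d.-homog, G \is d.-homog, G.@[x] != 0,
        rfun f = fraction_of F G & a = F.@[x] / G.@[x]].

(* f lies in the square of the maximal ideal of the local ring at x, that is, *)
(* f vanishes at x to order at least 2.                                       *)
Definition multiple_zero (f : function_field) (x : coordinates n) : Prop :=
  exists s : seq (function_field * function_field),
    (forall uv, uv \in s -> has_value uv.1 x 0 /\ has_value uv.2 x 0) /\
    f = \sum_(uv <- s) uv.1 * uv.2.

(* None stands for the point at infinity.                                     *)
Definition critical_value (t : function_field) (alpha : option algC) : Prop :=
  exists2 x, curve_points X x &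
    multiple_zero (if alpha is Some a then t - constant_function a else t^-1) x.

End CoordinateRing.

Arguments vanishing_ideal X _ : clear implicits.
Arguments restr X : clear implicits.
Arguments fraction_of X _ _ : clear implicits.
Arguments degree_zero X _ : clear implicits.
Arguments constant_function X _ : clear implicits.
Arguments rational_function_field X _ : clear implicits.

(* Main.v *)
Require Import Defs.
From HB Require Import structures.
From mathcomp Require Import all_boot all_order all_algebra all_field.
From mathcomp Require Import boolp classical_sets reals.
From mathcomp Require Import mpoly ring zify.

Set Implicit Arguments.
Unset Strict Implicit.
Unset Printing Implicit Defensive.

Import GRing.Theory Num.Theory.

Local Open Scope ring_scope.
Local Open Scope classical_set_scope.

(** Write k for algC, the algebraic closure of the rational numbers, and K for
    the function field of X over k.

    Kummer theory.  A linear relation with coefficients in k between functions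
    defined over Q yields one with rational coefficients [rational_relation], so
    that Q(X) <> Q(t) gives K <> k(t) [nonratfun_exists].  Since K / k(t) is
    abelian and k contains all roots of unity, the Galois group has a common
    eigenvector outside k(t), and this produces an element y of K outside k(t)
    with y ^ p = g(t), where p is prime and g is a monic polynomial whose roots
    all have multiplicity less than p [abelian_prime_root, kummer_polynomial].

    Ramification.  Let a be a root of g, of multiplicity m, and let v be a
    normalised valuation of K with v(t - a) > 0.  Then p v(y) = m v(t - a), so
    that p divides v(t - a), and t - a has a multiple zero at the centre of v.
    Hence a is a critical value [root_critical_value], and is rational.  Such a
    place exists by Zorn's lemma [valuation_ring_exists], it has a centre on X
    because X is projective [center_exists], and its valuation is that of the
    local ring at the centre because X is smooth there [coordinate_multiples,
    residue_value].

    Specialization.  At P_n the function y takes a value v_n with v_n ^ p = g(n),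
    which lies in the field generated by Q(P_n) and finitely many constants; the
    degree of this field over Q is bounded independently of n [specialization].
    In a number field of degree at most D, an element whose p-th power is
    rational is determined, up to a rational factor, by the p-th roots of unity
    by which the embeddings of the field multiply it; so such elements form at
    most p ^ D classes [rational_ratio].  Hence, if more than p ^ D of the fields
    Q(P_n) coincide, then g(n) / g(n') is the p-th power of a rational number for
    two of the indices.

    Sieve.  Up to a constant factor g(n) is a product of integers b n - u.  For a
    positive proportion of the integers n in a suitable progression the product
    of the distinct factors b n - u is squarefree away from the small primes,
    while the small primes divide it to constant powers.  As the multiplicities
    lie strictly between 0 and p, the class of g(n) modulo p-th powers then
    determines this product, and so determines n [sieve].  Therefore each of the
    fields occurs boundedly often along a set of integers of positive density
    [bounded_fibers]. *)


(** * Values of rational functions *)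

Lemma dhomog_var (R : nzRingType) m (i : 'I_m) : ('X_i : {mpoly R[m]}) \is 1.-homog.
Proof. by rewrite dhomogX; apply/eqP/mdeg1. Qed.

Section Values.
Variable X : curve.
Local Notation n := (ambient_dim X).
Local Notation K := (function_field X).
Local Notation cst := (constant_function X).
Implicit Types (f g : K) (x : coordinates n) (a b : algC).

Lemma restr_value (F : {mpoly algC[n.+1]}) x :
  curve_points X x -> restr X F = 0 -> F.@[x] = 0.
Proof.
move=> Xx /eqP; rewrite restr_eq0 => /vanishing_idealP; exact.
Qed.

Lemma restr_neq0 (F : {mpoly algC[n.+1]}) x :
  curve_points X x -> F.@[x] != 0 -> restr X F != 0.
Proof. by move=> Xx; apply: contra_neq; apply: restr_value. Qed.

(** Two representations of f by quotients of forms agree on X after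
    cross-multiplication, and neither denominator vanishes at x. *)
Lemma has_value_uniq f x a b :
  curve_points X x -> has_value f x a -> has_value f x b -> a = b.
Proof.
move=> Xx [d [F [G [_ _ G0 ef ->]]]] [e [H [L [_ _ L0 eg ->]]]].
have rG := restr_neq0 Xx G0; have rL := restr_neq0 Xx L0.
apply/eqP; rewrite eqr_div //; apply/eqP/subr0_eq.
rewrite -!mevalM -mevalB; apply: (restr_value Xx).
move: eg; rewrite ef /fraction_of => /eqP; rewrite eqr_div // => /eqP e1.
by rewrite rmorphB !rmorphM e1 subrr.
Qed.

Lemma rfun_inj : injective (rfun X). Proof. exact: fmorph_inj. Qed.

Lemma rfun_constant a : rfun X (cst a) = restr X a%:MP.
Proof. by rewrite rfun_subK /fraction_of rmorph1 divr1. Qed.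

Lemma constant_function_zmod_morphism : zmod_morphism cst.
Proof.
move=> a b; apply: rfun_inj.
by rewrite rmorphB !rfun_constant -rmorphB -mpolyCB.
Qed.

Lemma constant_function_monoid_morphism : monoid_morphism cst.
Proof.
split; first by apply: rfun_inj; rewrite rfun_constant !rmorph1.
by move=> a b; apply: rfun_inj; rewrite rmorphM !rfun_constant -rmorphM -mpolyCM.
Qed.

HB.instance Definition _ := GRing.isZmodMorphism.Build
  algC K cst constant_function_zmod_morphism.
HB.instance Definition _ := GRing.isMonoidMorphism.Build
  algC K cst constant_function_monoid_morphism.

Lemma has_value_constant x a : has_value (cst a) x a.
Proof.
exists 0%N, a%:MP, 1; split.
- by rewrite -alg_mpolyC rpredZ ?dhomog1.
- exact: dhomog1.
- by rewrite rmorph1 oner_eq0.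
- by rewrite rfun_subK.
- by rewrite mevalC rmorph1 divr1.
Qed.

Lemma has_valueD f g x a b : curve_points X x ->
  has_value f x a -> has_value g x b -> has_value (f + g) x (a + b).
Proof.
move=> Xx [d [F [G [hF hG G0 ef ->]]]] [e [H [L [hH hL L0 eg ->]]]].
have rG := restr_neq0 Xx G0; have rL := restr_neq0 Xx L0.
exists (d + e)%N, (F * L + H * G), (G * L); split.
- by apply: rpredD; [|rewrite addnC]; apply: dhomogM.
- exact: dhomogM.
- by rewrite mevalM mulf_neq0.
- by rewrite rmorphD ef eg /fraction_of rmorphD !rmorphM addf_div.
- by rewrite mevalD !mevalM addf_div.
Qed.

Lemma has_valueM f g x a b :
  has_value f x a -> has_value g x b -> has_value (f * g) x (a * b).
Proof.
move=> [d [F [G [hF hG G0 ef ->]]]] [e [H [L [hH hL L0 eg ->]]]].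
exists (d + e)%N, (F * H), (G * L); split; try exact: dhomogM.
- by rewrite mevalM mulf_neq0.
- by rewrite rmorphM ef eg /fraction_of !rmorphM mulf_div.
- by rewrite !mevalM mulf_div.
Qed.

Lemma has_valueV f x a : a != 0 -> has_value f x a -> has_value f^-1 x a^-1.
Proof.
move=> a0 [d [F [G [hF hG G0 ef ea]]]].
exists d, G, F; split=> //; last by rewrite ea invf_div.
- by apply: contra_neq a0 => F0; rewrite ea F0 mul0r.
- by rewrite fmorphV ef /fraction_of invf_div.
Qed.

Lemma has_valueN f x a : has_value f x a -> has_value (- f) x (- a).
Proof.
move=> h; rewrite -mulN1r -[- a]mulN1r; apply: has_valueM h.
by have := has_value_constant x (- 1); rewrite rmorphN1.
Qed.

Lemma has_valueB f g x a b : curve_points X x ->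
  has_value f x a -> has_value g x b -> has_value (f - g) x (a - b).
Proof. by move=> Xx hf hg; apply: has_valueD => //; apply: has_valueN. Qed.

Lemma has_value_div f g x a b : b != 0 ->
  has_value f x a -> has_value g x b -> has_value (f / g) x (a / b).
Proof. by move=> b0 hf hg; apply: has_valueM => //; apply: has_valueV. Qed.

Lemma has_valueX f x a m : has_value f x a -> has_value (f ^+ m) x (a ^+ m).
Proof.
move=> h; elim: m => [|m IH]; last by rewrite !exprS; apply: has_valueM.
by have := has_value_constant x 1; rewrite rmorph1 !expr0.
Qed.

Lemma has_value_sum (I : Type) (r : seq I) (u : I -> K) (v : I -> algC) x :
  curve_points X x -> (forall i, has_value (u i) x (v i)) ->
  has_value (\sum_(i <- r) u i) x (\sum_(i <- r) v i).
Proof.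
move=> Xx h; elim: r => [|i r IH].
  by rewrite !big_nil; have := has_value_constant x 0; rewrite rmorph0.
by rewrite !big_cons; apply: has_valueD.
Qed.

Lemma has_value_prod (I : Type) (r : seq I) (u : I -> K) (v : I -> algC) x :
  (forall i, has_value (u i) x (v i)) ->
  has_value (\prod_(i <- r) u i) x (\prod_(i <- r) v i).
Proof.
move=> h; elim: r => [|i r IH].
  by rewrite !big_nil; have := has_value_constant x 1; rewrite rmorph1.
by rewrite !big_cons; apply: has_valueM.
Qed.

Lemma has_value_horner (p : {poly algC}) f x a : curve_points X x ->
  has_value f x a -> has_value (map_poly cst p).[f] x p.[a].
Proof.
move=> Xx h; rewrite horner_coef size_map_poly horner_coef.
apply: has_value_sum => // i; rewrite coef_map.
by apply: has_valueM (has_value_constant _ _) (has_valueX _ h).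
Qed.

Lemma degree_zero_coord (j i : 'I_n.+1) :
  fraction_of X 'X_i 'X_j \in degree_zero X.
Proof. by apply/asboolP; exists 1%N, 'X_i, 'X_j; split=> //; apply: dhomog_var. Qed.

Definition coord_fun (j i : 'I_n.+1) : K := rfun_sub (degree_zero_coord j i).

Lemma has_value_coord (j i : 'I_n.+1) x :
  x j != 0 -> has_value (coord_fun j i) x (x i / x j).
Proof.
move=> xj; exists 1%N, 'X_i, 'X_j.
by split; rewrite ?mevalXU ?rfun_subK // dhomog_var.
Qed.

(** The polynomial read in the affine chart X_j <> 0; a form F of degree d becomes
    F / X_j ^ d, see [rfun_dehom]. *)
Definition dehom (j : 'I_n.+1) : {mpoly algC[n.+1]} -> K :=
  mmap cst (coord_fun j).

Lemma rfun_dehom j F d : F \is d.-homog -> restr X 'X_j != 0 ->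
  rfun X (dehom j F) = restr X F / restr X 'X_j ^+ d.
Proof.
move=> hF j0; rewrite /dehom /mmap rmorph_sum /= [in RHS](mpolyE F) rmorph_sum.
rewrite mulr_suml; apply: eq_big_seq => m mF /=.
rewrite rmorphM rfun_constant -mul_mpolyC rmorphM -mulrA; congr (_ * _).
have -> : 'X_[m] = \prod_(i < n.+1) 'X_i ^+ m i :> {mpoly algC[n.+1]} by rewrite mpolyXE_id.
have -> : d = mdeg m by rewrite -(dhomogP _ _ _ hF _ mF).
rewrite mdegE -prodrXr /mmap1 !rmorph_prod -prodfV -big_split /=.
apply: eq_bigr => i _; rewrite !rmorphXn rfun_subK /fraction_of /=.
by rewrite expr_div_n.
Qed.

Lemma has_value_dehom j F x : curve_points X x -> x j != 0 ->
  has_value (dehom j F) x F.@[fun i => x i / x j].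
Proof.
move=> Xx xj; rewrite /dehom /mmap mevalE; apply: has_value_sum => // m.
apply: has_valueM (has_value_constant _ _) _.
by apply: has_value_prod => i; apply/has_valueX/has_value_coord.
Qed.

Lemma dehom_fraction j f F G d : F \is d.-homog -> G \is d.-homog ->
  restr X 'X_j != 0 -> rfun X f = fraction_of X F G -> f = dehom j F / dehom j G.
Proof.
move=> hF hG j0 ef; apply: rfun_inj.
rewrite ef fmorph_div (rfun_dehom hF j0) (rfun_dehom hG j0) /fraction_of.
have jd : restr X 'X_j ^+ d != 0 by rewrite expf_neq0.
by rewrite -mulf_div divff ?invr_neq0 ?mulr1 // invrK.
Qed.

(** Once X_j does not vanish identically on the curve, the whole function field
    is generated by the affine coordinates of the j-th chart. *)
Lemma dehom_ratio j f : restr X 'X_j != 0 ->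
  exists A B, [/\ dehom j B != 0 & f = dehom j A / dehom j B].
Proof.
move=> j0; have [d [F [G [hF hG ef]]]] := asboolP _ (rfun_degree_zero f).
have [G0|G0] := eqVneq (restr X G) 0.
  exists 0, 1; rewrite /dehom !rmorph1 rmorph0 oner_eq0; split=> //.
  by rewrite mul0r; apply: rfun_inj; rewrite ef /fraction_of G0 invr0 mulr0 rmorph0.
exists F, G; split; last exact: dehom_fraction hF hG j0 ef.
by rewrite -(fmorph_eq0 (rfun X)) (rfun_dehom hG j0) mulf_neq0 ?invr_neq0 ?expf_neq0.
Qed.

End Values.

(** * Simple algebraic extensions *)

Lemma divring_set (L : fieldType) (M : set L) :
  M 1 -> (forall x y, M x -> M y -> M (x - y)) ->
  (forall x y, M x -> M y -> M (x / y)) -> divring_closed [pred x in M].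
Proof.
move=> M1 MB Mdiv; split; first exact: mem_set M1.
- move=> x y /(set_mem (A := M)) Mx /(set_mem (A := M)) My.
  exact: mem_set (MB _ _ Mx My).
- move=> x y /(set_mem (A := M)) Mx /(set_mem (A := M)) My.
  exact: mem_set (Mdiv _ _ Mx My).
Qed.

Lemma divring_setP (L : fieldType) (M : set L) :
  divring_closed [pred x in M] ->
  [/\ M 1, (forall x y, M x -> M y -> M (x - y)) &
      (forall x y, M x -> M y -> M (x / y))].
Proof.
move=> [M1 MB Mdiv]; split; first exact: set_mem M1.
- by move=> x y /mem_set Mx /mem_set My; apply: set_mem (MB _ _ Mx My).
- by move=> x y /mem_set Mx /mem_set My; apply: set_mem (Mdiv _ _ Mx My).
Qed.

Lemma divring_sum (L : fieldType) (E : set L) (I : Type) (l : seq I) (u : I -> L) :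
  divring_closed [pred x in E] -> (forall i, E (u i)) -> E (\sum_(i <- l) u i).
Proof.
move=> /divring_setP[E1 EB _] uE; have E0 : E 0 by rewrite -(subrr 1); apply: (EB).
elim: l => [|i l IH]; rewrite ?big_nil ?big_cons //.
by rewrite -[\sum_(j <- l) _]opprK; apply: (EB) => //; rewrite -sub0r; apply: (EB).
Qed.

Lemma divringM (L : fieldType) (E : set L) x y :
  divring_closed [pred x in E] -> E x -> E y -> E (x * y).
Proof.
move=> /divring_setP[E1 _ Ediv] Ex Ey.
by rewrite -[y]invrK; apply: (Ediv) => //; rewrite -div1r; apply: (Ediv).
Qed.

Lemma subfield_gen_divring (L : fieldType) (S : set L) :
  divring_closed [pred x in subfield_gen S].
Proof.
apply: divring_set.
- by move=> M [/divring_setP[]].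
- move=> x y Sx Sy M [dM SM]; have [_ h _] := divring_setP dM.
  by apply: h; [apply: Sx|apply: Sy].
- move=> x y Sx Sy M [dM SM]; have [_ _ h] := divring_setP dM.
  by apply: h; [apply: Sx|apply: Sy].
Qed.

Lemma sub_subfield_gen (L : fieldType) (S : set L) : S `<=` subfield_gen S.
Proof. by move=> x Sx M [_]; apply. Qed.

Lemma subfield_gen_min (L : fieldType) (S M : set L) :
  divring_closed [pred x in M] -> S `<=` M -> subfield_gen S `<=` M.
Proof. by move=> dM SM x; apply. Qed.

Section MinimalPolynomial.
Variables (K L : fieldType) (iota : {rmorphism K -> L}).
Local Notation "p ^i" := (map_poly iota p) (at level 2, format "p ^i").

Lemma minimal_poly_exists (x : L) (q : {poly K}) : q != 0 -> root q^i x ->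
  exists p : {poly K}, [/\ irreducible_poly p, root p^i x &
    forall r : {poly K}, root r^i x -> p %| r].
Proof.
move=> q0 qx.
have ex : exists m, `[< exists p : {poly K}, [/\ p != 0, root p^i x & size p = m] >].
  by exists (size q); apply/asboolP; exists q.
case: (ex_minnP ex) => m /asboolP[p [p0 px sp]] min.
have dv r : root r^i x -> p %| r.
  move=> rx; rewrite /dvdp; apply: contraT => r0.
  have : (m <= size (r %% p)%R)%N.
    apply: min; apply/asboolP; exists (r %% p); split=> //.
    move: rx; rewrite {1}(divp_eq r p) rmorphD rmorphM /root hornerD hornerM /=.
    by rewrite (rootP px) mulr0 add0r.
  by rewrite leqNgt -sp ltn_modp p0.
exists p; split=> //; split.
  rewrite ltnNge; apply: contra p0 => /size1_polyC e.
  by move: px; rewrite e map_polyC /root hornerC fmorph_eq0 => /eqP->; rewrite polyC0.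
move=> r r1 /dvdpP[s es].
have s0 : s != 0 by apply: contra_neq p0 => s0; rewrite es s0 mul0r.
have r0 : r != 0 by apply: contra_neq p0 => r0; rewrite es r0 mulr0.
move: px; rewrite {1}es rmorphM rootM => /orP[sx|rx]; last first.
  by rewrite /eqp dv // es dvdp_mull.
have /(dvdp_leq s0) := dv _ sx.
have gt1 : (1 < size r)%N by rewrite ltn_neqAle eq_sym r1 size_poly_gt0.
by rewrite es size_mul // leqNgt -subn1 ltn_subRL addnC ltn_add2l gt1.
Qed.

(** For z algebraic this is membership in the simple extension K(z), which is
    then closed under division by [generated_by_divring]. *)
Definition generated_by (z w : L) : Prop := exists q : {poly K}, (q^i).[z] = w.

Lemma generated_by_divring (z : L) (q : {poly K}) : q != 0 -> root q^i z ->
  divring_closed [pred w in [set w | generated_by z w]].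
Proof.
move=> q0 qz; have [p [irr pz dv]] := minimal_poly_exists q0 qz.
apply: divring_set.
- by exists 1; rewrite rmorph1 hornerC.
- move=> _ _ [a <-] [b <-]; exists (a - b).
  by rewrite rmorphB hornerD hornerN.
- move=> _ _ [a <-] [b <-].
  have [b0|b0] := boolP (root b^i z).
    by exists 0; rewrite (rootP b0) invr0 mulr0 rmorph0 horner0.
  have cop : coprimep b p.
    rewrite coprimep_sym irreducible_poly_coprime //.
    apply: contra b0 => /dvdpP[c ->].
    by rewrite rmorphM rootM pz orbT.
  have [[u v] /= uv] := Bezout_eq1_coprimepP _ _ cop.
  exists (a * u); rewrite rmorphM hornerM; congr (_ * _).
  have /(congr1 (fun r : {poly K} => (r^i).[z])) := uv.
  rewrite rmorphD !rmorphM rmorph1 hornerD !hornerM (rootP pz) mulr0 addr0.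
  by rewrite hornerC => e; rewrite -[RHS]mul1r -e mulfK.
Qed.

(** The primitive element theorem, in the form of a closure property: finitely
    many algebraic elements are polynomials in a single one. *)
Lemma primitive_element (s : seq L) : [pchar K] =i pred0 ->
  (forall x : L, exists2 q : {poly K}, q != 0 & root q^i x) ->
  exists z, forall x, x \in s -> generated_by z x.
Proof.
move=> ch alg; elim: s => [|x s [z hz]]; first by exists 0.
have [p p0 px] := alg x; have [q q0 qz] := alg z.
have [m [[a ea] [b eb]]] := pchar0_PET p0 px q0 qz ch.
exists (z *+ m - x) => y; rewrite inE => /orP[/eqP->|/hz[c <-]].
  by exists a.
exists (c \Po b); rewrite map_comp_poly horner_comp.
by congr (_.[_]).
Qed.

End MinimalPolynomial.

(** * Kummer generators of abelian extensions *)

Lemma sum_unity_root (L : fieldType) (m : nat) (w : L) :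
  w ^+ m = 1 -> w != 1 -> \sum_(j < m) w ^+ j = 0.
Proof.
move=> wm w1; have /eqP := subrX1 w m.
by rewrite wm subrr eq_sym mulf_eq0 subr_eq0 (negPf w1) => /eqP.
Qed.

Section Conjugates.
Variables (K L : fieldType) (iota : {rmorphism K -> L}).
Local Notation "p ^i" := (map_poly iota p) (at level 2, format "p ^i").
Local Notation E := (range iota).

Lemma poly_over_range (q : {poly L}) : poly_over E q -> exists q0, q = q0^i.
Proof.
move=> qE; have /choice[c hc] : forall i, exists a, iota a = q`_i.
  by move=> i; have [a _ e] := qE i; exists a.
exists (\poly_(i < size q) c i); apply/polyP => i; rewrite coef_map coef_poly.
by case: ltnP => [_|h]; [exact: esym (hc i) | rewrite nth_default // raddf0].
Qed.

Lemma irreducible_over_range (p : {poly K}) :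
  irreducible_poly p -> irreducible_over E p^i.
Proof.
move=> [p1 irr]; split; first by move=> i; rewrite coef_map; exists p`_i.
  by rewrite size_map_poly.
move=> q /poly_over_range[q0 ->]; rewrite size_map_poly dvdp_map eqp_map.
exact: irr.
Qed.

Lemma iter_rmorph_horner (s : {rmorphism L -> L}) m (q : {poly K}) x :
  (forall a, s (iota a) = iota a) ->
  iter m s (q^i).[x] = (q^i).[iter m s x].
Proof.
move=> sE; elim: m => //= m ->; rewrite -horner_map; congr (_.[_]).
by rewrite -map_poly_comp; apply: eq_map_poly => a /=; rewrite sE.
Qed.

Variables (z : L) (p : {poly K}) (rs : seq L).
Hypothesis full : forall x, generated_by iota z x.
Hypothesis irr : irreducible_poly p.
Hypothesis pz : root p^i z.
Hypothesis dv : forall r : {poly K}, root r^i z -> p %| r.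
Hypothesis split_p : p^i %= \prod_(r <- rs) ('X - r%:P).
Hypothesis rs_uniq : uniq rs.

Lemma mem_rs r : (r \in rs) = root p^i r.
Proof. by rewrite (eqp_root split_p) root_prod_XsubC. Qed.

Lemma size_rs : (size rs).+1 = size p.
Proof. by rewrite -(size_map_poly iota) (eqp_size split_p) size_prod_XsubC. Qed.

(** An element is a polynomial in the generator z; evaluating that polynomial at
    another root r of the minimal polynomial is well defined. *)
Lemma conjugation_exists (r : L) : r \in rs ->
  exists s : {rmorphism L -> L}, forall q : {poly K}, s (q^i).[z] = (q^i).[r].
Proof.
rewrite mem_rs => pr; have [c hc] := choice full.
have well (q q' : {poly K}) : (q^i).[z] = (q'^i).[z] -> (q^i).[r] = (q'^i).[r].
  move=> e; apply/subr0_eq; rewrite -hornerN -hornerD -rmorphB.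
  have /dvdpP[h ->] : p %| q - q'.
    by apply: dv; rewrite rmorphB /root hornerD hornerN e subrr.
  by rewrite rmorphM hornerM (rootP pr) mulr0.
pose s x := ((c x)^i).[r].
have sE (q : {poly K}) : s (q^i).[z] = (q^i).[r] by apply: well; rewrite hc.
have sB : zmod_morphism s.
  move=> x y; rewrite -(hc x) -(hc y) -hornerN -hornerD -rmorphB !sE.
  by rewrite rmorphB hornerD hornerN.
have sM : monoid_morphism s.
  split=> [|x y].
    by have := sE 1; rewrite rmorph1 !hornerC.
  by rewrite -(hc x) -(hc y) -hornerM -rmorphM !sE rmorphM hornerM.
pose sA := GRing.isZmodMorphism.Build _ _ s sB.
pose sMm := GRing.isMonoidMorphism.Build _ _ s sM.
pose t : {rmorphism L -> L} := HB.pack s sA sMm.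
by exists t.
Qed.

Section OneConjugation.
Variables (r : L) (s : {rmorphism L -> L}).
Hypothesis sP : forall q : {poly K}, s (q^i).[z] = (q^i).[r].

Lemma conj_fix a : s (iota a) = iota a.
Proof. by have := sP a%:P; rewrite map_polyC !hornerC. Qed.

Lemma conj_root x : x \in rs -> s x \in rs.
Proof.
rewrite !mem_rs /root => /eqP px.
have := iter_rmorph_horner 1 p x conj_fix.
by rewrite /= px rmorph0 => <-.
Qed.

(** The conjugates of z under the iterates of s are roots of p, so two of them
    coincide; s is injective, whence some iterate fixes z. *)
Lemma conj_order : exists2 m, (0 < m)%N & forall x, iter m s x = x.
Proof.
have it m : iter m s z \in rs.
  by elim: m => [|m IH]; [rewrite /= mem_rs | rewrite /=; apply: conj_root].
have : ~~ uniq [seq iter m s z | m <- seq.iota 0 (size rs).+1].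
  apply/negP => /uniq_leq_size h.
  have /h : {subset [seq iter m s z | m <- seq.iota 0 (size rs).+1] <= rs}.
    by move=> _ /mapP[m _ ->].
  by rewrite size_map size_iota ltnn.
have inj m : injective (iter m s).
  by elim: m => [|m IH] // x y /= /fmorph_inj/IH.
move=> nu; have [m [d [d0 e]]] : exists m d, (0 < d)%N /\ iter (d + m) s z = iter m s z.
  apply: contrapT => h; case/negP: nu; rewrite map_inj_in_uniq ?iota_uniq //.
  move=> a b _ _ e; case: (ltngtP a b) => // ab; case: h.
  - by exists a, (b - a)%N; rewrite subn_gt0 ab subnK // ltnW.
  - by exists b, (a - b)%N; rewrite subn_gt0 ab subnK // ltnW.
exists d => // x; have [q <-] := full x.
rewrite iter_rmorph_horner; last exact: conj_fix.
by congr (_.[_]); apply: (inj m); rewrite -iterD addnC.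
Qed.

Lemma conj_bijective : bijective s.
Proof.
have [[|m] // _ h] := conj_order.
exists (iter m s) => x; last exact: h.
by rewrite -iterSr h.
Qed.

Lemma conj_galois : galois_group E s.
Proof.
by split; [exact: conj_bijective | move=> _ [a _ <-]; exact: conj_fix].
Qed.

End OneConjugation.

(** Write x = q(z) with deg q < deg p: if x is fixed, then q - x vanishes at the
    deg p distinct roots of p, so q is constant. *)
Lemma conj_fixed_field x :
  (forall r (s : {rmorphism L -> L}), r \in rs ->
     (forall q : {poly K}, s (q^i).[z] = (q^i).[r]) -> s x = x) -> E x.
Proof.
move=> fx; have [q0 e0] := full x; pose q := (q0 %% p)%R.
have p0 : p != 0 by case: irr => h _; rewrite -size_poly_gt0 ltnW.
have qz : (q^i).[z] = x.
  by rewrite -e0 [in RHS](divp_eq q0 p) rmorphD rmorphM hornerD hornerM (rootP pz) mulr0 add0r.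
have qr r : r \in rs -> (q^i).[r] = x.
  move=> rrs; have [s sP] := conjugation_exists rrs.
  by rewrite -sP qz; apply: (fx r).
have e : q^i - x%:P = 0.
  apply: (@roots_geq_poly_eq0 _ _ rs) => //.
    by apply/allP => r /qr h; rewrite /root hornerD hornerN hornerC h subrr.
  have := ltn_modp q0 p; rewrite p0 -size_rs ltnS -/q => sq.
  rewrite (leq_trans (size_polyD _ _)) // size_polyN geq_max size_map_poly sq.
  rewrite (leq_trans (size_polyC_leq1 _)) //.
  by case: irr => h _; rewrite -ltnS size_rs.
exists q`_0 => //; rewrite -coef_map.
by move/subr0_eq: e => ->; rewrite coefC.
Qed.

End Conjugates.

Section Eigenvectors.
Variables (L : fieldType) (cst : {rmorphism algC -> L}) (E : set L).
Hypothesis E_divring : divring_closed [pred x in E].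
Hypothesis cstE : forall a, E (cst a).

(** Averaging against a root of unity splits f into eigenvectors of s; as their
    sum is a multiple of f, one of them lies outside E. *)
Lemma eigenvector_step (s : {rmorphism L -> L}) m f :
  (0 < m)%N -> (forall x, iter m s x = x) -> (forall a, s (cst a) = cst a) ->
  ~ E f ->
  exists (u : nat -> algC) (c : algC),
    let g := \sum_(i < m) cst (u i) * iter i s f in
    [/\ ~ E g, c ^+ m = 1 & s g = cst c * g].
Proof.
move=> m0 sm sc fE; have [w prim_w] := C_prim_root_exists m0.
have wm := prim_expr_order prim_w.
have w0 : w != 0 by apply: contra_eq_neq wm => ->; rewrite expr0n gtn_eqF // eq_sym oner_eq0.
pose g j := \sum_(i < m) cst (w ^- (i * j)) * iter i s f.
have [j gE] : exists j, ~ E (g j).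
  apply: contrapT => h; apply: fE.
  have -> : f = cst m%:R^-1 * \sum_(0 <= j < m) g j.
    rewrite big_mkord exchange_big /=.
    rewrite (bigD1 (Ordinal m0)) //= [X in _ + X]big1 => [|i i0].
      under eq_bigr do rewrite mul0n expr0 invr1 rmorph1 mul1r.
      rewrite sumr_const card_ord addr0 -[f *+ m]mulr_natl mulrA.
      by rewrite -(rmorph_nat cst) -rmorphM mulVf ?rmorph1 ?mul1r // pnatr_eq0 -lt0n.
    rewrite -mulr_suml -rmorph_sum.
    under eq_bigr do rewrite exprM -exprVn.
    rewrite sum_unity_root ?rmorph0 ?mul0r //.
      by rewrite exprVn -exprM mulnC exprM wm expr1n invr1.
    apply: contra i0 => /eqP/(congr1 GRing.inv); rewrite invrK invr1 => wi.
    have /dvdn_leq : (m %| i)%N by rewrite (prim_order_dvd prim_w) wi.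
    by case: (posnP i) => [e _|_ /(_ isT)]; [apply/eqP/val_inj | rewrite leqNgt ltn_ord].
  apply: (divringM E_divring) => //; apply: (divring_sum _ E_divring) => j; apply: contrapT => gj.
  by apply: h; exists j.
exists (fun i => w ^- (i * j)), (w ^+ j); split=> //.
  by rewrite -exprM mulnC exprM wm expr1n.
pose a i := cst (w ^- (i * j)) * iter i s f.
have am : a m = a 0%N by rewrite /a sm exprM wm expr1n mul0n expr0.
have shift : \sum_(i < m) a i.+1 = \sum_(i < m) a i.
  apply: (addrI (a 0%N)); transitivity (\sum_(i < m.+1) a i); first by rewrite big_ord_recl.
  by rewrite big_ord_recr /= am addrC.
rewrite -[in RHS]shift rmorph_sum mulr_sumr; apply: eq_bigr => i _.
rewrite rmorphM sc mulrA -rmorphM; congr (cst _ * _).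
by rewrite mulSn exprD invfM mulrA divff ?expf_neq0 // mul1r.
Qed.

(** The eigenvectors produced by one automorphism are linear combinations of its
    iterates, so they remain eigenvectors of the automorphisms commuting with
    it. *)
Lemma common_eigenvector (I : eqType) (l : seq I) (s : I -> {rmorphism L -> L}) m f :
  (0 < m)%N -> (forall i, i \in l -> forall x, iter m (s i) x = x) ->
  (forall i, i \in l -> forall a, s i (cst a) = cst a) ->
  (forall i j, i \in l -> j \in l -> s i \o s j =1 s j \o s i) -> ~ E f ->
  exists2 g, ~ E g & forall i, i \in l ->
    exists2 c : algC, c ^+ m = 1 & s i g = cst c * g.
Proof.
move=> m0; elim: l => [|i l IH] sm sc com fE; first by exists f.
have sub j : j \in l -> j \in i :: l by rewrite inE orbC => ->.
have [||||g gE hg] := IH; try by move=> *; auto.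
have il : i \in i :: l by rewrite inE eqxx.
have [u [c [hE cm hi]]] := eigenvector_step m0 (sm _ il) (sc _ il) gE.
set h := \sum_(_ < m) _ in hE hi.
exists h => // j; rewrite inE => /orP[/eqP->|jl]; first by exists c.
have [d dm hj] := hg _ jl; exists d => //.
rewrite rmorph_sum mulr_sumr; apply: eq_bigr => k _.
rewrite rmorphM sc ?sub // mulrCA; congr (_ * _).
have comk x : s j (iter k (s i) x) = iter k (s i) (s j x).
  by elim: (nat_of_ord k) => //= q <-; exact: (com j i (sub _ jl) il _).
rewrite comk hj; elim: (nat_of_ord k) => //= q ->.
by rewrite rmorphM sc.
Qed.

(** With q the least positive exponent such that f ^ q is in E, a prime divisor p
    of q and y = f ^ (q / p) are as required. *)
Lemma prime_root_outside m f : (0 < m)%N -> ~ E f -> E (f ^+ m) ->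
  exists p y, [/\ prime p, ~ E y & E (y ^+ p)].
Proof.
move=> m0 fE fm; have ex : exists q, `[< (0 < q)%N /\ E (f ^+ q) >].
  by exists m; apply/asboolP.
case: (ex_minnP ex) => q /asboolP[q0 fq] min.
have q1 : q != 1%N by apply/eqP => e; apply: fE; rewrite -[f]expr1 -e.
have q2 : (1 < q)%N by rewrite ltn_neqAle eq_sym q1.
have pr := pdiv_prime q2; have e := divnK (pdiv_dvd q).
exists (pdiv q), (f ^+ (q %/ pdiv q)); split=> //; last by rewrite -exprM e.
move=> h; have : (q <= q %/ pdiv q)%N.
  apply/min/asboolP; split=> //.
  by rewrite divn_gt0 ?prime_gt0 // dvdn_leq // pdiv_dvd.
by rewrite leqNgt ltn_Pdiv // prime_gt1.
Qed.

End Eigenvectors.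

(** The Galois group is finite, abelian and acts linearly over the roots of
    unity, so its elements have a common eigenvector outside the base field;
    some power of it is fixed by the group. *)
Theorem abelian_prime_root (K L : fieldType) (iota : {rmorphism K -> L})
    (cst : {rmorphism algC -> L}) (gens : seq L) :
  abelian_extension (range iota) ->
  (forall a, range iota (cst a)) ->
  subfield_gen (range iota `|` [set x | x \in gens]) = setT ->
  (exists f, ~ range iota f) ->
  exists p y, [/\ prime p, ~ range iota y & range iota (y ^+ p)].
Proof.
move=> [[alg normal sep] abel] cstE gen [f fE].
have algK (x : L) : exists2 q : {poly K}, q != 0 & root (map_poly iota q) x.
  have [q [/poly_over_range[q0 ->] qn qx]] := alg x; exists q0 => //.
  by move: qn; rewrite map_poly_eq0.
have chK : [pchar K] =i pred0.
  move=> p; rewrite -(fmorph_pchar iota) (fmorph_pchar cst); exact: pchar_num.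
have [z hz] := primitive_element gens chK algK.
have [q q0 qz] := algK z.
have full x : generated_by iota z x.
  have : [set: L] x by []; rewrite -gen; apply: subfield_gen_min.
    exact: generated_by_divring q0 qz.
  by move=> y [[a _ <-]|/hz//]; exists a%:P; rewrite map_polyC hornerC.
have [p [irr pz dv]] := minimal_poly_exists q0 qz.
have irrE := irreducible_over_range iota irr.
have [rs split_p] := normal _ _ irrE pz.
have rs_uniq : uniq rs.
  by rewrite -separable_prod_XsubC -(eqp_separable split_p); apply: sep pz.
have E_div : divring_closed [pred x in range iota].
  apply: divring_set; first by exists 1; rewrite // rmorph1.
  - by move=> _ _ [a _ <-] [b _ <-]; exists (a - b); rewrite // rmorphB.
  - by move=> _ _ [a _ <-] [b _ <-]; exists (a / b); rewrite // fmorph_div.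
have /choice[s hs] : forall r, exists s : {rmorphism L -> L}, r \in rs ->
    forall q : {poly K}, s (map_poly iota q).[z] = (map_poly iota q).[r].
  move=> r; have [rrs|_] := boolP (r \in rs); last by exists idfun.
  by have [s sP] := conjugation_exists full dv split_p rrs; exists s.
have sfix r a : r \in rs -> s r (cst a) = cst a.
  by move=> rrs; have [b _ <-] := cstE a; apply: conj_fix (hs _ rrs) _.
have [m m0 hm] : exists2 m, (0 < m)%N &
    forall r, r \in rs -> forall x, iter m (s r) x = x.
  have : {subset rs <= rs} by [].
  elim: {-2}rs => [|r l IH] sub; first by exists 1%N.
  have rrs : r \in rs by apply: sub; rewrite inE eqxx.
  have [|m m0 hm] := IH; first by move=> y yl; apply: sub; rewrite inE yl orbT.
  have [d d0 hd] := conj_order full pz split_p (hs _ rrs).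
  have itM (h : L -> L) u v : (forall x, iter u h x = x) -> forall x, iter (v * u) h x = x.
    by move=> hu x; elim: v => // v IHv; rewrite mulSn iterD IHv.
  exists (m * d)%N; first by rewrite muln_gt0 m0.
  move=> y; rewrite inE => /orP[/eqP->|yl]; first exact: itM.
  by rewrite mulnC; apply/itM/hm.
have com : forall r r', r \in rs -> r' \in rs -> s r \o s r' =1 s r' \o s r.
  have gal r : r \in rs -> galois_group (range iota) (s r).
    by move=> hr; apply: (conj_galois full pz split_p (hs _ hr)).
  by move=> r r' hr hr'; apply: abel; apply: gal.
have [g gE hg] := common_eigenvector E_div cstE m0 hm
  (fun r rrs a => sfix r a rrs) com fE.
apply: (prime_root_outside m0 gE).
apply: (conj_fixed_field full irr pz dv split_p rs_uniq) => r t rrs tP.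
have ts : t =1 s r by move=> x; have [b <-] := full x; rewrite tP hs.
have [c cm e] := hg _ rrs.
by rewrite ts rmorphXn e exprMn -rmorphXn cm rmorph1 mul1r.
Qed.

(** * The field of rational functions in one transcendental element *)

Section PolyVal.
Variables (L : fieldType) (cst : {rmorphism algC -> L}) (t : L).

Definition poly_val (p : {poly algC}) : L := (map_poly cst p).[t].

Lemma poly_val_zmod_morphism : zmod_morphism poly_val.
Proof. by move=> p q; rewrite /poly_val rmorphB hornerD hornerN. Qed.

Lemma poly_val_monoid_morphism : monoid_morphism poly_val.
Proof.
by split=> [|p q]; rewrite /poly_val ?rmorph1 ?hornerC // rmorphM hornerM.
Qed.

HB.instance Definition _ := GRing.isZmodMorphism.Build
  {poly algC} L poly_val poly_val_zmod_morphism.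
HB.instance Definition _ := GRing.isMonoidMorphism.Build
  {poly algC} L poly_val poly_val_monoid_morphism.

Lemma poly_valX : poly_val 'X = t.
Proof. by rewrite /poly_val map_polyX hornerX. Qed.

Lemma poly_valC a : poly_val a%:P = cst a.
Proof. by rewrite /poly_val map_polyC hornerC. Qed.

Lemma poly_val_XsubC a : poly_val ('X - a%:P) = t - cst a.
Proof. by rewrite rmorphB /= poly_valX poly_valC. Qed.

End PolyVal.

(** Polynomials over a subfield need the subfield as a type of coefficients. *)
Lemma subfield_type (L : fieldType) (M : set L) :
  divring_closed [pred x in M] ->
  exists (K : fieldType) (iota : {rmorphism K -> L}), range iota = M.
Proof.
move=> dM; pose S : {pred L} := [pred x in M].
pose D : divringClosed L := HB.pack S (GRing.isDivringClosed.Build L S dM).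
pose iota : {rmorphism subfield_carrier D -> L} := val.
exists (subfield_carrier D), iota; apply/seteqP; split=> [_ [x _ <-]|x Mx].
  by apply: set_mem; apply: (valP x).
by exists (SubfieldCarrier (mem_set Mx : x \in D)).
Qed.

Section Transcendental.
Variables (L : fieldType) (cst : {rmorphism algC -> L}) (t : L).
Hypothesis t_nonconst : forall a, t <> cst a.
Local Notation ev := (poly_val cst t).

(** A nonconstant t is transcendental: over algC a nonzero polynomial is a
    product of linear factors, none of which vanishes at t. *)
Lemma poly_val_eq0 p : (ev p == 0) = (p == 0).
Proof.
have [->|p0] := eqVneq p 0; first by rewrite rmorph0 eqxx.
have [rs e] := closed_field_poly_normal p.
rewrite e -mul_polyC rmorphM mulf_eq0 /= poly_valC fmorph_eq0 lead_coef_eq0.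
rewrite (negPf p0) rmorph_prod prodf_seq_eq0 /=; apply/negbTE/hasPn => a _.
by rewrite poly_val_XsubC subr_eq0; apply/eqP/t_nonconst.
Qed.

Definition ratfuns : set L := [set f | exists a b, f = ev a / ev b].

Lemma ratfuns_divring : divring_closed [pred x in ratfuns].
Proof.
apply: divring_set; first by exists 1, 1; rewrite rmorph1 divr1.
- move=> _ _ [a [b ->]] [c [d ->]].
  have [b0|b0] := eqVneq (ev b) 0.
    by exists (- c), d; rewrite b0 invr0 mulr0 sub0r rmorphN mulNr.
  have [d0|d0] := eqVneq (ev d) 0.
    by exists a, b; rewrite d0 invr0 mulr0 subr0.
  by exists (a * d - c * b), (b * d); rewrite rmorphB !rmorphM subf_div.
- move=> _ _ [a [b ->]] [c [d ->]].
  by exists (a * d), (b * c); rewrite !rmorphM invf_div mulf_div.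
Qed.

Lemma subfield_gen_ratfuns : subfield_gen (range cst `|` [set t]) = ratfuns.
Proof.
apply/seteqP; split.
  apply: subfield_gen_min ratfuns_divring _.
  move=> _ [[a _ <-]|->]; first by exists a%:P, 1; rewrite rmorph1 divr1 poly_valC.
  by exists 'X, 1; rewrite rmorph1 divr1 poly_valX.
set M := subfield_gen _; have dM := subfield_gen_divring (range cst `|` [set t]).
have gen x : (range cst `|` [set t]) x -> M x by apply: sub_subfield_gen.
have evM p : M (ev p).
  rewrite /poly_val horner_coef; apply: (divring_sum _ dM) => i.
  apply: (divringM dM).
    by rewrite coef_map; apply: gen; left; exists (p`_i).
  elim: (nat_of_ord i) => [|j IH]; first by have [] := divring_setP dM.
  by rewrite exprS; apply: (divringM dM) => //; apply: gen; right.
by move=> _ [a [b ->]]; have [_ _ h] := divring_setP dM; apply: h; apply: evM.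
Qed.

(** Multiplying by denominators and extracting p-th powers of linear factors
    turns a p-th root of a rational function into a p-th root of a polynomial
    whose roots all have multiplicity below p. *)
Lemma kummer_polynomial p y : prime p -> ~ ratfuns y -> ratfuns (y ^+ p) ->
  exists (z : L) (g : {poly algC}),
    [/\ ~ ratfuns z, g \is monic, z ^+ p = ev g &
        forall a, ~~ (('X - a%:P) ^+ p %| g)].
Proof.
move=> pr yE [a [b eab]]; have p0 := prime_gt0 pr.
have [R1 RB Rdiv] := divring_setP ratfuns_divring.
have R0 : ratfuns 0 by rewrite -(subrr 1); apply: (RB).
have Rev c : ratfuns (ev c) by exists c, 1; rewrite rmorph1 divr1.
have quot x c : ev c != 0 -> ~ ratfuns x -> ~ ratfuns (x / ev c).
  by move=> c0 xE h; apply: xE; rewrite -(divfK c0 x); apply: (divringM ratfuns_divring).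
have neq0 x : ~ ratfuns x -> x != 0.
  by move=> xE; apply/eqP => x0; apply: xE; rewrite x0.
have b0 : ev b != 0.
  by apply: contra_neq (expf_neq0 p (neq0 _ yE)) => b0; rewrite eab b0 invr0 mulr0.
have [z [g [zE ezg]]] : exists (z : L) (g : {poly algC}), ~ ratfuns z /\ z ^+ p = ev g.
  exists (y * ev b), (a * b ^+ p.-1); split.
    move=> h; apply: yE; rewrite -(mulfK b0 y); exact: Rdiv.
  rewrite exprMn eab rmorphM rmorphXn -{1}(prednK p0) exprS.
  by rewrite mulrA divfK.
have g0 : g != 0.
  by apply: contra_neq (expf_neq0 p (neq0 _ zE)) => g0; rewrite ezg g0 rmorph0.
have [m] := ubnP (size g); elim: m => // m IH in z g zE ezg g0 *.
rewrite ltnS => sg; have [[c]|no] := pselect (exists c, ('X - c%:P) ^+ p %| g).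
  move=> /dvdpP[h eh]; have h0 : h != 0 by apply: contra_neq g0 => h0; rewrite eh h0 mul0r.
  have c0 : ev ('X - c%:P) != 0 by rewrite poly_val_eq0 polyXsubC_eq0.
  apply: (IH (z / ev ('X - c%:P)) h) => //; first exact: quot.
    rewrite expr_div_n ezg eh rmorphM rmorphXn mulfK // expf_neq0 //.
  apply: leq_trans sg; rewrite eh size_mul ?expf_neq0 ?polyXsubC_eq0 //.
  by rewrite size_exp_XsubC addnS /= -addn1 leq_add2l.
have l0 : lead_coef g != 0 by rewrite lead_coef_eq0.
have [r er] : exists r : algC, r ^+ p = lead_coef g.
  by exists (p.-root (lead_coef g)); rewrite rootCK.
have r0 : r != 0 by apply: contra_neq l0 => r0; rewrite -er r0 expr0n gtn_eqF.
exists (z / ev r%:P), ((lead_coef g)^-1 *: g); split.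
- by apply: quot; rewrite // poly_val_eq0 polyC_eq0.
- by rewrite monicE lead_coefZ mulVf.
- rewrite expr_div_n ezg -rmorphXn -polyC_exp er /= poly_valC -mul_polyC rmorphM /= poly_valC.
  by rewrite mulrC fmorphV.
- by move=> c; rewrite dvdpZr ?invr_eq0 //; apply/negP => h; apply: no; exists c.
Qed.

End Transcendental.

(** * Places of a function field *)

Section Places.
Variables (L : fieldType) (cst : {rmorphism algC -> L}) (t : L) (alpha : algC).
Hypothesis t_nonconst : forall a, t <> cst a.
Local Notation ev := (poly_val cst t).
Local Notation s := (t - cst alpha).

(** A maximal ring among those containing algC[t] but not 1 / (t - alpha) will be
    a valuation ring, with t - alpha in its maximal ideal. *)
Record admissible_ring (B : set L) : Prop := AdmissibleRing {
  adm_poly : forall p, B (ev p);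
  adm_sub : forall x y, B x -> B y -> B (x - y);
  adm_mul : forall x y, B x -> B y -> B (x * y);
  adm_pole : ~ B s^-1
}.

Lemma param_neq0 : s != 0.
Proof. by rewrite subr_eq0; apply/eqP. Qed.

Lemma poly_ring_admissible : admissible_ring (range ev).
Proof.
split; first by move=> p; exists p.
- by move=> _ _ [p _ <-] [q _ <-]; exists (p - q); rewrite // rmorphB.
- by move=> _ _ [p _ <-] [q _ <-]; exists (p * q); rewrite // rmorphM.
- move=> [p _ ep]; have : ev (('X - alpha%:P) * p - 1) = 0.
    by rewrite rmorphB rmorphM rmorph1 /= ep poly_val_XsubC mulfV ?subrr // param_neq0.
  move/eqP; rewrite poly_val_eq0 // => /eqP/(congr1 (horner^~ alpha)).
  rewrite hornerD hornerM hornerXsubC subrr mul0r add0r hornerN hornerC horner0.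
  by move/eqP; rewrite oppr_eq0 oner_eq0.
Qed.

(** The empty set is included because the union of the empty chain is empty. *)
Lemma adm_chain (F : set (set L)) :
  F `<=` [set B | B = set0 \/ admissible_ring B] -> total_on F subset ->
  (\bigcup_(B in F) B = set0) \/ admissible_ring (\bigcup_(B in F) B).
Proof.
move=> FP tot; have [[A0 [FB0 aB0]]|no] := pselect (exists B, F B /\ admissible_ring B).
  have adm B x : F B -> B x -> admissible_ring B.
    by move=> FB Bx; case: (FP _ FB) => // B0'; rewrite B0' in Bx.
  have two x y : (\bigcup_(B in F) B) x -> (\bigcup_(B in F) B) y ->
      exists B, [/\ F B, admissible_ring B, B x & B y].
    move=> [B FB Bx] [C FC Cy]; case: (tot _ _ FB FC) => sub.
      by exists C; split=> //; [apply: adm FC Cy | apply: sub].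
    by exists B; split=> //; [apply: adm FB Bx | apply: sub].
  right; split.
  - by move=> p; exists A0 => //; apply: adm_poly.
  - move=> x y /two h /h[B [FB aB Bx By]]; exists B => //; exact: adm_sub.
  - move=> x y /two h /h[B [FB aB Bx By]]; exists B => //; exact: adm_mul.
  - by move=> [B FB adm_param]; have [_ _ _] := adm _ _ FB adm_param; apply.
left; apply/seteqP; split=> // x [B FB Bx].
by case: (FP _ FB) => [A0|aB]; [rewrite A0 in Bx | case: no; exists B].
Qed.

Section MaximalRing.
Variable B : set L.
Hypothesis B_adm : admissible_ring B.
Hypothesis B_max : forall C, admissible_ring C -> B `<=` C -> C `<=` B.

Let Bp := adm_poly B_adm.
Let BB := adm_sub B_adm.
Let BM := adm_mul B_adm.

Lemma adm0 : B 0. Proof. by have := Bp 0; rewrite rmorph0. Qed.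
Lemma adm1 : B 1. Proof. by have := Bp 1; rewrite rmorph1. Qed.
Lemma admN x : B x -> B (- x).
Proof. by move=> Bx; rewrite -sub0r; apply: BB => //; apply: adm0. Qed.
Lemma admD x y : B x -> B y -> B (x + y).
Proof. by move=> Bx By; rewrite -[y]opprK; apply: BB => //; apply: admN. Qed.
Lemma admX x m : B x -> B (x ^+ m).
Proof.
by move=> Bx; elim: m => [|m IH]; [exact: adm1 | rewrite exprS; apply: BM].
Qed.
Lemma adm_sum (I : Type) (r : seq I) (u : I -> L) :
  (forall i, B (u i)) -> B (\sum_(i <- r) u i).
Proof.
by move=> Bu; elim: r => [|i r IH]; rewrite ?big_nil ?big_cons;
   [exact: adm0 | exact: admD].
Qed.
Lemma adm_param : B s. Proof. by rewrite -poly_val_XsubC. Qed.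
Lemma adm_horner (p : {poly L}) x : poly_over B p -> B x -> B p.[x].
Proof.
by move=> Bpol Bx; rewrite horner_coef; apply: adm_sum => i; apply: BM => //; apply: admX.
Qed.

(** Maximality: adjoining a new element z must create the forbidden pole. *)
Lemma adjoin_pole z : ~ B z ->
  exists2 p : {poly L}, poly_over B p & p.[z] = s^-1.
Proof.
move=> Bz; pose C := [set w | exists2 p : {poly L}, poly_over B p & p.[z] = w].
have BC : B `<=` C.
  move=> w Bw; exists w%:P; last by rewrite hornerC.
  by move=> i; rewrite coefC; case: ifP => _ //; exact: adm0.
apply: contrapT => no; apply: Bz; apply: (B_max (C := C)) => //; last first.
  exists 'X; last by rewrite hornerX.
  by move=> i; rewrite coefX; case: eqP => _; [exact: adm1|exact: adm0].
split => //; first by move=> p; apply: BC.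
- move=> _ _ [p hp <-] [q hq <-]; exists (p - q); last by rewrite hornerD hornerN.
  by move=> i; rewrite coefB; apply: BB.
- move=> _ _ [p hp <-] [q hq <-]; exists (p * q); last by rewrite hornerM.
  by move=> i; rewrite coefM; apply: adm_sum => j; apply: BM.
Qed.

(** The element t - alpha lies in the Jacobson radical: if u = 1 - (t - alpha) b
    had no inverse in B, the forbidden pole would be c / u ^ k for some c in B,
    and u ^ k is congruent to 1 modulo t - alpha, a contradiction. *)
Lemma unit_near_one b : B b -> B (1 - s * b)^-1.
Proof.
move=> Bb; set u := 1 - s * b;
have Bu : B u by apply: BB; [exact: adm1|apply: BM => //; exact: adm_param].
have u0 : u != 0.
  apply/eqP => u0; apply: (adm_pole B_adm).
  suff -> : s^-1 = b by [].
  have /eqP := u0; rewrite subr_eq0 => /eqP e.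
  by rewrite -[s^-1]mulr1 e mulKf // param_neq0.
apply: contrapT => /adjoin_pole[p hp ep].
have [k [c [Bc ec]]] : exists k c, B c /\ u ^+ k * s^-1 = c.
  exists (size p), (\sum_(i < size p) p`_i * u ^+ (size p - i)); split.
    by apply: adm_sum => i; apply: BM => //; apply: admX.
  rewrite -ep horner_coef mulr_sumr; apply: eq_bigr => i _.
  rewrite mulrCA; congr (_ * _); rewrite exprVn -{1}(subnK (ltnW (ltn_ord i))).
  by rewrite exprD mulfK // expf_neq0.
have [d [Bd ed]] : exists d, B d /\ u ^+ k = 1 - s * d.
  elim: (k) => [|m [d [Bd ed]]]; first by exists 0; split; [exact: adm0|rewrite mulr0 subr0].
  exists (b + u * d); split; first by apply: admD => //; apply: BM.
  rewrite exprS ed mulrBr mulr1 {1}/u mulrDr opprD addrA; congr (_ - _).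
  by rewrite mulrCA.
apply: (adm_pole B_adm); suff -> : s^-1 = c + d by apply: admD.
by rewrite -ec ed mulrBl mul1r mulrAC mulfV ?param_neq0 // mul1r subrK.
Qed.

(** If neither z nor its inverse were in B, two expressions of the pole as
    polynomials in z and in its inverse could be shortened against each other. *)
Lemma shorten_expression z (p q : {poly L}) k m : z != 0 ->
  poly_over B p -> poly_over B q -> p.[z] = s^-1 -> q.[z^-1] = s^-1 ->
  (size p <= k.+1)%N -> (size q <= m.+1)%N -> (m <= k)%N ->
  exists p', [/\ poly_over B p', p'.[z] = s^-1 & (size p' <= k)%N].
Proof.
move=> z0 hp hq ep eq sp sq mk.
pose u := (1 - s * q`_0)^-1; have Bu : B u by apply: unit_near_one.
have u0 : 1 - s * q`_0 != 0.
  apply/eqP => e; apply: (adm_pole B_adm); suff -> : s^-1 = q`_0 by [].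
  have /eqP := e; rewrite subr_eq0 => /eqP e'.
  by rewrite -[s^-1]mulr1 e' mulKf // param_neq0.
pose r := \sum_(j < m) (s * u * q`_j.+1) *: 'X^(k - j.+1).
have hr : poly_over B r.
  move=> i; rewrite coef_sum; apply: adm_sum => j; rewrite coefZ coefXn.
  by apply: BM; [apply: BM => //; apply: BM => //; exact: adm_param |
     case: eqP => _; [exact: adm1|exact: adm0]].
have sr : (size r <= k)%N.
  apply: (leq_trans (size_sum _ _ _)); apply/bigmax_leqP => j _.
  apply: (leq_trans (size_scale_leq _ _)); rewrite size_polyXn.
  by rewrite subnSK // ?leq_subr // (leq_trans (ltn_ord j)).
have er : r.[z] = z ^+ k.
  have e1 : 1 - s * q`_0 = s * \sum_(j < m) q`_j.+1 * z^-1 ^+ j.+1.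
    apply/eqP; rewrite subr_eq -mulrDr [X in _ * X]addrC; apply/eqP.
    have -> : 1 = s * q.[z^-1] by rewrite eq mulfV // param_neq0.
    by rewrite (horner_coef_wide _ sq) big_ord_recl expr0 mulr1.
  rewrite horner_sum.
  transitivity (z ^+ k * (u * (s * \sum_(j < m) q`_j.+1 * z^-1 ^+ j.+1))); last first.
    by rewrite -e1 mulVf // mulr1.
  rewrite !mulr_sumr; apply: eq_bigr => j _; rewrite hornerZ hornerXn.
  have jk : (j.+1 <= k)%N by rewrite (leq_trans (ltn_ord j)).
  rewrite -{2}(subnK jk) exprD exprVn.
  by field; rewrite expf_neq0.
exists (\poly_(i < k) p`_i + p`_k *: r); split.
- move=> i; rewrite coefD coefZ coef_poly; apply: admD; last exact: BM.
  by case: ifP => _ //; exact: adm0.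
- rewrite hornerD hornerZ er -ep (horner_coef_wide _ sp) big_ord_recr /=.
  by rewrite horner_poly.
- rewrite (leq_trans (size_polyD _ _)) // geq_max size_poly.
  exact: leq_trans (size_scale_leq _ _) sr.
Qed.

Lemma no_two_expressions k m z (p q : {poly L}) : z != 0 ->
  poly_over B p -> poly_over B q -> p.[z] = s^-1 -> q.[z^-1] = s^-1 ->
  (size p <= k)%N -> (size q <= m)%N -> False.
Proof.
have [d] := ubnP (k + m); elim: d => // d IH in k m z p q *.
rewrite ltnS => km z0 hp hq ep eq sp sq.
have pos (p0 : {poly L}) z1 i : p0.[z1] = s^-1 -> (size p0 <= i)%N -> (0 < i)%N.
  case: i => // e; rewrite leqn0 size_poly_eq0 => /eqP p00.
  by move: e; rewrite p00 horner0 => /esym/eqP; rewrite invr_eq0 (negPf param_neq0).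
case: k sp km => [|k] sp km; first by have := pos _ _ _ ep sp.
case: m sq km => [|m] sq km; first by have := pos _ _ _ eq sq.
have [mk|/ltnW mk] := leqP m k.
  have [p' [hp' ep' sp']] := shorten_expression z0 hp hq ep eq sp sq mk.
  by apply: (IH k m.+1 z p' q) => //; rewrite (leq_trans _ km) // addSn.
have [||q' [hq' eq' sq']] := shorten_expression _ hq hp eq _ sq sp mk.
- by rewrite invr_eq0.
- by rewrite invrK.
by apply: (IH k.+1 m z p q') => //; rewrite (leq_trans _ km) // addnS.
Qed.

Lemma maximal_valuation z : B z \/ B z^-1.
Proof.
apply: contrapT => /not_orP[Bz Bz'].
have z0 : z != 0 by apply/eqP => z0; apply: Bz; rewrite z0; exact: adm0.
have [p hp ep] := adjoin_pole Bz; have [q hq eq] := adjoin_pole Bz'.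
exact: no_two_expressions z0 hp hq ep eq (leqnn _) (leqnn _).
Qed.

End MaximalRing.

Theorem valuation_ring_exists :
  exists B, admissible_ring B /\ forall z, B z \/ B z^-1.
Proof.
have [B [[B0'|aB] max]] := Zorn_bigcup adm_chain.
  have := max (range ev); rewrite B0'.
  case; last by right; exact: poly_ring_admissible.
  split; first by [].
  by move=> h; have [] := h 1; exists 1; rewrite ?rmorph1.
exists B; split=> // z; apply: (maximal_valuation aB) => C aC BC.
apply: contrapT => CB; apply: (max C); last by right.
by split.
Qed.

End Places.

(** * Residues at a place *)

Section AlgebraicRelations.
Variables (L : fieldType) (cst : {rmorphism algC -> L}) (t : L).
Local Notation ev := (poly_val cst t).

(** The coefficients are polynomials in t, rather than rational functions of t, so
    that the relation can be specialised at every value of t. *)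
Definition algebraic_rel (P : {poly {poly algC}}) (f : L) : Prop :=
  P != 0 /\ root (map_poly ev P) f.

(** Dividing by a power of X - alpha makes the relation nontrivial at t = alpha. *)
Lemma primitive_relation (alpha : algC) P f : (forall a, t <> cst a) ->
  algebraic_rel P f ->
  exists P', algebraic_rel P' f /\ exists i, (P'`_i).[alpha] != 0.
Proof.
move=> tn; have [m] := ubnP (size (lead_coef P)); elim: m => // m IH in P *.
rewrite ltnS => sP [P0 rP].
have [[i hi]|no] := pselect (exists i, (P`_i).[alpha] != 0); first by exists P; split=> //; exists i.
pose l : {poly algC} := 'X - alpha%:P.
pose Q := \poly_(i < size P) (P`_i %/ l)%R.
have e : P = l%:P * Q.
  apply/polyP => i; rewrite coefCM coef_poly; case: ltnP => [_|h]; last first.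
    by rewrite nth_default // mulr0.
  rewrite mulrC divpK // dvdp_XsubCl; apply: contrapT => h; apply: no.
  by exists i; move/negP: h.
have l0 : l != 0 by rewrite polyXsubC_eq0.
have Q0 : Q != 0 by apply: contra_neq P0 => Q0; rewrite e Q0 mulr0.
have rQ : root (map_poly ev Q) f.
  move: rP; rewrite e rmorphM rootM /= map_polyC rootC poly_val_eq0 //.
  by rewrite (negPf l0).
apply: (IH Q) => //; apply: leq_trans sP.
rewrite e lead_coefM lead_coefC size_mul ?lead_coef_eq0 // size_XsubC.
exact: leqnn.
Qed.

(** Dividing by a power of h. *)
Lemma relation_nonzero_constant P0 h : h != 0 -> algebraic_rel P0 h ->
  exists P : {poly {poly algC}}, P`_0 != 0 /\ algebraic_rel P h.
Proof.
move=> h0 [P0n rP0].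
have [m] := ubnP (size P0); elim: m => // m IH in P0 P0n rP0 *; rewrite ltnS => sP.
have [c0|c0] := eqVneq P0`_0 0; last by exists P0.
have e : P0 = drop_poly 1 P0 * 'X.
  rewrite -[LHS](poly_take_drop 1) expr1 [take_poly 1 P0](_ : _ = 0) ?add0r //.
  by apply/polyP => i; rewrite coef_take_poly coef0; case: i => //=; case: ifP.
have Q0 : drop_poly 1 P0 != 0 by apply: contra_neq P0n => Q0; rewrite e Q0 mul0r.
apply: (IH (drop_poly 1 P0)) => //.
  by move: rP0; rewrite {1}e rmorphM rootM /= map_polyX rootX (negPf h0) orbF.
apply: leq_trans sP; rewrite size_drop_poly subn1 prednK // size_poly_gt0 //.
Qed.

End AlgebraicRelations.

Section ValuationRing.
Variables (L : fieldType) (cst : {rmorphism algC -> L}) (t : L) (alpha : algC).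
Hypothesis t_nonconst : forall a, t <> cst a.
Local Notation ev := (poly_val cst t).
Local Notation s := (t - cst alpha).
Variable B : set L.
Hypothesis B_adm : admissible_ring cst t alpha B.
Hypothesis B_val : forall z, B z \/ B z^-1.

(** The maximal ideal of the valuation ring B; as 0^-1 = 0 belongs to B, zero has
    to be listed apart. *)
Definition nonunit (x : L) : Prop := B x /\ (x = 0 \/ ~ B x^-1).
Definition residue (f : L) (a : algC) : Prop := nonunit (f - cst a).

Let BM := adm_mul B_adm.
Let B_0 := adm0 B_adm.
Let B_1 := adm1 B_adm.
Let B_D := admD B_adm.
Let B_param := adm_param B_adm.

Lemma adm_cst a : B (cst a).
Proof. by rewrite -(poly_valC cst t); apply: adm_poly B_adm _. Qed.

Lemma nonunit0 : nonunit 0. Proof. by split; [exact: B_0 | left]. Qed.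

Lemma not_nonunit1 : ~ nonunit 1.
Proof. by move=> [_ [/eqP|]]; [rewrite oner_eq0 | rewrite invr1]. Qed.

Lemma nonunitM x y : nonunit x -> B y -> nonunit (x * y).
Proof.
move=> [Bx hx] By; split; first exact: BM.
have [->|xy0] := eqVneq (x * y) 0; first by left.
right=> h; case: hx => [x0|]; first by rewrite x0 mul0r eqxx in xy0.
have y0 : y != 0 by apply: contra_neq xy0 => ->; rewrite mulr0.
by apply; rewrite -[x^-1](mulVKf y0) -invfM [y * x]mulrC; apply: BM.
Qed.

Lemma nonunitN x : nonunit x -> nonunit (- x).
Proof. by move=> h; rewrite -mulrN1; apply: nonunitM => //; apply: (admN B_adm). Qed.

Lemma nonunitD x y : nonunit x -> nonunit y -> nonunit (x + y).
Proof.
have [->|x0] := eqVneq x 0; first by rewrite add0r.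
have [->|y0] := eqVneq y 0; first by rewrite addr0.
move=> hx hy; have [h|h] := B_val (x / y).
  have -> : x + y = y * (x / y + 1) by rewrite mulrDr mulr1 mulrCA divff // mulr1.
  by apply: nonunitM => //; apply: B_D.
rewrite invf_div in h.
have -> : x + y = x * (y / x + 1) by rewrite mulrDr mulr1 mulrCA divff // mulr1 addrC.
by apply: nonunitM => //; apply: B_D.
Qed.

Lemma nonunit_sum (I : Type) (r : seq I) (u : I -> L) :
  (forall i, nonunit (u i)) -> nonunit (\sum_(i <- r) u i).
Proof.
move=> h; elim: r => [|i r IH]; rewrite ?big_nil ?big_cons; first exact: nonunit0.
exact: nonunitD.
Qed.

Lemma unit_inv x : B x -> ~ nonunit x -> x != 0 /\ B x^-1.
Proof.
move=> Bx nx; split; first by apply/eqP => x0; apply: nx; rewrite x0; exact: nonunit0.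
by apply: contrapT => h; apply: nx; split=> //; right.
Qed.

Lemma nonunit_param : nonunit s.
Proof. by split; [exact: B_param | right; apply: adm_pole B_adm]. Qed.

(** The nonunits form a prime ideal, being the complement of the units. *)
Lemma nonunit_prime x y : B x -> B y -> nonunit (x * y) -> nonunit x \/ nonunit y.
Proof.
move=> Bx By xy; have [nx|nx] := pselect (nonunit x); [by left | right].
have [x0 Bx'] := unit_inv Bx nx.
by rewrite -[y](mulKf x0) mulrC; apply: nonunitM.
Qed.

Lemma nonunitX x m : B x -> nonunit (x ^+ m) -> nonunit x.
Proof.
move=> Bx; elim: m => [/not_nonunit1 //|m IH]; rewrite exprS => /nonunit_prime.
by case=> //; apply: (admX B_adm).
Qed.

Lemma nonunit_cst a : nonunit (cst a) -> a = 0.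
Proof.
move=> [_ [/eqP|]]; first by rewrite fmorph_eq0 => /eqP.
by rewrite -fmorphV => /(_ (adm_cst _)).
Qed.

Lemma residue_B f a : residue f a -> B f.
Proof. by move=> [h _]; rewrite -(subrK (cst a) f); apply: B_D => //; apply: adm_cst. Qed.

Lemma residue_uniq f a b : residue f a -> residue f b -> a = b.
Proof.
move=> ha hb; apply/subr0_eq/nonunit_cst; rewrite rmorphB.
have -> : cst a - cst b = (f - cst b) - (f - cst a) by ring.
by apply: nonunitD => //; apply: nonunitN.
Qed.

Lemma residue_cst a : residue (cst a) a.
Proof. by rewrite /residue subrr; exact: nonunit0. Qed.

Lemma residueD f g a b : residue f a -> residue g b -> residue (f + g) (a + b).
Proof.
move=> hf hg; rewrite /residue rmorphD.
have -> : f + g - (cst a + cst b) = (f - cst a) + (g - cst b) by ring.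
exact: nonunitD. Qed.

Lemma residueM f g a b : residue f a -> residue g b -> residue (f * g) (a * b).
Proof.
move=> hf hg; rewrite /residue rmorphM.
have -> : f * g - cst a * cst b = (f - cst a) * g + (g - cst b) * cst a by ring.
by apply: nonunitD; apply: nonunitM => //; [apply: residue_B hg | apply: adm_cst].
Qed.

Lemma residue_sum (I : Type) (r : seq I) (u : I -> L) (v : I -> algC) :
  (forall i, residue (u i) (v i)) ->
  residue (\sum_(i <- r) u i) (\sum_(i <- r) v i).
Proof.
move=> h; elim: r => [|i r IH].
  by rewrite !big_nil -(rmorph0 cst); apply: residue_cst.
by rewrite !big_cons; apply: residueD.
Qed.

Lemma residue_prod (I : Type) (r : seq I) (u : I -> L) (v : I -> algC) :
  (forall i, residue (u i) (v i)) ->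
  residue (\prod_(i <- r) u i) (\prod_(i <- r) v i).
Proof.
move=> h; elim: r => [|i r IH].
  by rewrite !big_nil -(rmorph1 cst); apply: residue_cst.
by rewrite !big_cons; apply: residueM.
Qed.

Lemma residueX f a m : residue f a -> residue (f ^+ m) (a ^+ m).
Proof.
move=> h; elim: m => [|m IH]; last by rewrite !exprS; apply: residueM.
by rewrite !expr0 -(rmorph1 cst); apply: residue_cst.
Qed.

Lemma residue_mmap n (F : {mpoly algC[n]}) (z : 'I_n -> L) (a : 'I_n -> algC) :
  (forall i, residue (z i) (a i)) -> residue (mmap cst z F) F.@[a].
Proof.
move=> h; rewrite /mmap mevalE; apply: residue_sum => m.
by apply: residueM (residue_cst _) _; apply: residue_prod => i; apply: residueX.
Qed.

Lemma residue_t : residue t alpha. Proof. exact: nonunit_param. Qed.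

Lemma residue_poly p : residue (ev p) p.[alpha].
Proof.
rewrite /poly_val horner_coef size_map_poly horner_coef; apply: residue_sum => i.
by rewrite coef_map; apply: residueM (residue_cst _) (residueX _ residue_t).
Qed.

Lemma residue_inv f a : residue f a -> a != 0 -> f != 0 /\ B f^-1.
Proof.
move=> h a0; apply: unit_inv; first exact: residue_B h.
move=> nf; move/eqP: a0; apply; apply: (residue_uniq h).
by rewrite /residue rmorph0 subr0.
Qed.

Lemma residue_div f g a b : residue f a -> residue g b -> b != 0 ->
  residue (f / g) (a / b).
Proof.
move=> hf hg b0; have [g0 Bg] := residue_inv hg b0; rewrite /residue fmorph_div.
have cb : cst b != 0 by rewrite fmorph_eq0.
have -> : f / g - cst a / cst b =
    ((f - cst a) * cst b + (g - cst b) * - cst a) * (g^-1 * cst b^-1).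
  by rewrite fmorphV; field; rewrite g0 cb.
apply: nonunitM; last by apply: BM => //; apply: adm_cst.
apply: nonunitD; apply: nonunitM => //; first exact: adm_cst.
by rewrite -rmorphN; apply: adm_cst.
Qed.

(** The residue field is algC: reducing a relation that is nontrivial at
    t = alpha gives a polynomial over algC which has f as a root modulo the
    nonunits, and it splits into linear factors. *)
Lemma residue_exists f : B f -> (exists P, algebraic_rel cst t P f) -> exists a, residue f a.
Proof.
move=> Bf [P /(primitive_relation alpha t_nonconst)[{}P [[P0 rP] [i hi]]]].
pose p : {poly algC} := map_poly (horner_eval alpha) P.
have p0 : p != 0.
  apply: contra_neq hi => p0; have : p`_i = 0 by rewrite p0 coef0.
  by rewrite coef_map.
have np : nonunit (map_poly cst p).[f].
  have -> : (map_poly cst p).[f] =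
      \sum_(i < size P) cst (P`_i).[alpha] * f ^+ i - (map_poly ev P).[f].
    rewrite (rootP rP) subr0 (@horner_coef_wide _ (size P)); last by rewrite size_map_poly size_poly.
    by apply: eq_bigr => k _; rewrite !coef_map.
  rewrite (@horner_coef_wide _ (size P)); last exact: size_poly.
  rewrite -sumrB; apply: nonunit_sum => k.
  rewrite coef_map -mulrBl -opprB mulNr; apply: nonunitN; apply: nonunitM; last exact: (admX B_adm).
  exact: residue_poly.
have [rs ers] := closed_field_poly_normal p.
have : nonunit (\prod_(a <- rs) (f - cst a)).
  move: np; rewrite ers map_polyZ hornerZ rmorph_prod horner_prod mulrC /=.
  under eq_bigr do rewrite map_polyXsubC hornerXsubC.
  move=> /nonunitM/(_ (adm_cst (lead_coef p)^-1)).
  by rewrite fmorphV mulfK // fmorph_eq0 lead_coef_eq0.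
elim: rs {ers} => [|a rs IH]; first by rewrite big_nil => /not_nonunit1.
have Bfa b : B (f - cst b) by apply: (adm_sub B_adm) => //; apply: adm_cst.
rewrite big_cons => /nonunit_prime[]//; last by exists a.
by elim: rs {IH} => [|b rs IH]; rewrite ?big_nil ?big_cons //; apply: BM.
Qed.

(** Every nonzero h in B has finite valuation with respect to t - alpha: in an
    algebraic relation for h the constant term is a multiple of h, and it is a
    power of t - alpha times a unit. *)
Lemma param_power_multiple h : h != 0 -> B h -> (exists P, algebraic_rel cst t P h) ->
  exists e b, B b /\ s ^+ e = h * b.
Proof.
move=> h0 Bh [P0 /(relation_nonzero_constant h0)[P [c0 [_ rP]]]].
have [m [c cn ec]] := multiplicity_XsubC P`_0 alpha.
rewrite c0 /= in cn.
have [cn0 Bc] : ev c != 0 /\ B (ev c)^-1.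
  exact: residue_inv (residue_poly c) cn.
pose d := (map_poly ev (drop_poly 1 P)).[h].
have eP : ev P`_0 + d * h = 0.
  rewrite -[RHS](rootP rP) -[in RHS](poly_take_drop 1 P) rmorphD rmorphM hornerD hornerM /=.
  rewrite map_polyXn expr1 hornerX; congr (_ + _).
  have -> : take_poly 1 P = (P`_0)%:P.
    apply/polyP => i; rewrite coef_take_poly coefC; case: i => //=.
  by rewrite map_polyC hornerC.
exists m, (- d * (ev c)^-1); split.
  apply: BM => //; apply: (admN B_adm); apply: (adm_horner B_adm) => // i.
  by rewrite coef_map; apply: adm_poly B_adm _.
have : ev P`_0 = - d * h by apply/eqP; rewrite mulNr -addr_eq0 eP.
rewrite ec rmorphM rmorphXn /= poly_val_XsubC => e1.
by rewrite mulrA [h * _]mulrC -e1 mulrAC mulfV // mul1r.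
Qed.

(** Conversely every nonunit p has positive valuation: reduce a relation for p
    modulo t - alpha.  The first coefficient that does not vanish at alpha is a
    unit, and remains one after adding multiples of p. *)
Lemma nonunit_power_multiple p : nonunit p -> (exists P, algebraic_rel cst t P p) ->
  exists J b, B b /\ p ^+ J = s * b.
Proof.
move=> np [P /(primitive_relation alpha t_nonconst)[{}P [[P0 rP] ex]]].
have Bp : B p by case: np.
case: (ex_minnP ex) => J hJ min.
pose T := take_poly J P; pose D := drop_poly J P.
have eP : (map_poly ev T).[p] + (map_poly ev D).[p] * p ^+ J = 0.
  rewrite -[RHS](rootP rP) -[in RHS](poly_take_drop J P) rmorphD rmorphM hornerD hornerM /=.
  by rewrite map_polyXn hornerXn.
have [b [Bb eb]] : exists b, B b /\ (map_poly ev T).[p] = s * b.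
  pose l : {poly algC} := 'X - alpha%:P.
  exists (\sum_(i < J) ev (P`_i %/ l)%R * p ^+ i); split.
    apply: (adm_sum B_adm) => i; apply: BM; last exact: (admX B_adm).
    exact: adm_poly B_adm _.
  rewrite (@horner_coef_wide _ J); last first.
    by rewrite (leq_trans (size_poly _ _)) // size_take_poly.
  rewrite mulr_sumr; apply: eq_bigr => i _.
  rewrite coef_map coef_take_poly ltn_ord mulrA; congr (_ * _).
  rewrite -poly_val_XsubC -rmorphM mulrC divpK // dvdp_XsubCl; apply: contrapT.
  move/negP => h; have := min _ h; by rewrite leqNgt ltn_ord.
have rD : residue (map_poly ev D).[p] (P`_J).[alpha].
  rewrite /residue -[D](poly_take_drop 1) rmorphD rmorphM hornerD hornerM /= map_polyXn expr1.
  rewrite hornerX; have -> : take_poly 1 D = (P`_J)%:P.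
    by apply/polyP => i; rewrite coef_take_poly coefC coef_drop_poly; case: i.
  rewrite map_polyC hornerC addrAC; apply: nonunitD; first exact: residue_poly.
  rewrite mulrC; apply: nonunitM => //; apply: (adm_horner B_adm) => // i.
  by rewrite coef_map; apply: adm_poly B_adm _.
have [D0 BD'] := residue_inv rD hJ.
exists J, (- b / (map_poly ev D).[p]); split; first by apply: BM => //; apply: (admN B_adm).
have e1 : p ^+ J * (map_poly ev D).[p] = - (s * b).
  by apply/eqP; rewrite -addr_eq0 mulrC addrC -eb eP.
by rewrite -[LHS](mulfK D0) e1; ring.
Qed.

End ValuationRing.

(** * The local ring at a smooth point *)

Lemma to_algC_dhomog n (f : {mpoly rat[n.+1]}) d :
  f \is d.-homog -> to_algC f \is d.-homog.
Proof.
move=> hd; apply/dhomogP => u; rewrite (perm_mem (msupp_map_mpoly f (fmorph_inj _))).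
exact: (dhomogP _ _ _ hd).
Qed.

(** Euler's identity, at a zero of the polynomial. *)
Lemma euler_zero n d (F : {mpoly algC[n]}) (x : 'I_n -> algC) :
  F \is d.-homog -> F.@[x] = 0 -> \sum_i x i * F^`M(i).@[x] = 0.
Proof.
move=> hF F0; pose D (G : {mpoly algC[n]}) := \sum_i x i * G^`M(i).@[x].
have DX m : D 'X_[m] = (mdeg m)%:R * 'X_[m].@[x].
  rewrite /D mdegE natr_sum mulr_suml; apply: eq_bigr => i _.
  rewrite mderivX mevalZ mulrCA; have [->|mi0] := eqVneq (m i) 0%N; first by rewrite !mul0r.
  have e : 'X_[m] = 'X_[m - U_(i)] * 'X_i :> {mpoly algC[n]}.
    by rewrite -mpolyXD submK // lep1mP.
  by rewrite e mevalM mevalXU [x i * _]mulrC.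
have DD G H : D (G + H) = D G + D H.
  by rewrite /D -big_split /=; apply: eq_bigr => i _; rewrite mderivD mevalD mulrDr.
have DZ c G : D (c *: G) = c * D G.
  by rewrite /D mulr_sumr; apply: eq_bigr => i _; rewrite mderivZ mevalZ mulrCA.
have D0 : D 0 = 0 by rewrite -[0](scale0r 0) DZ mul0r.
rewrite -/(D F) -(mulr0 d%:R) -F0 {1}(mpolyE F) (big_morph D DD D0) mevalE mulr_sumr.
apply: eq_big_seq => m mF; have -> : d = mdeg m by rewrite -(dhomogP _ _ _ hF _ mF).
by rewrite DZ DX mevalX mulrCA.
Qed.

Lemma dehom_equation (X : curve) j f : restr X 'X_j != 0 ->
  f \in equations X -> dehom j (to_algC f) = 0 :> function_field X.
Proof.
move=> j0 fX; have [d hd] := equations_homogeneous fX.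
apply: rfun_inj; rewrite (rfun_dehom (to_algC_dhomog hd) j0) rmorph0.
suff /eqP -> : restr X (to_algC f) == 0 by rewrite mul0r.
rewrite restr_eq0; apply/vanishing_idealP => y [_]; apply.
by exists f.
Qed.

Lemma copid_mx_col (L : fieldType) n (v : 'cV[L]_n.+1) :
  copid_mx n *m v = v ord_max 0 *: delta_mx ord_max 0.
Proof.
apply/matrixP => a c; rewrite ord1 /copid_mx mulmxBl mul1mx !mxE (bigD1 a) //=.
rewrite big1 => [|k ka]; last first.
  by rewrite mxE; have := negPf ka; rewrite -val_eqE eq_sym /= => ->; rewrite mul0r.
rewrite mxE eqxx addr0 /=; have [->|am] := eqVneq a ord_max.
  by rewrite ltnn mul0r subr0 mulr1.
have -> : (a < n)%N by rewrite ltn_neqAle am -ltnS ltn_ord.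
by rewrite mul1r subrr mulr0.
Qed.

Section SmoothPoint.
Variables (X : curve) (x : coordinates (ambient_dim X)).
Local Notation n := (ambient_dim X).
Local Notation K := (function_field X).
Local Notation cst := (constant_function X).
Hypothesis Xx : curve_points X x.
Variable j : 'I_n.+1.
Hypothesis xj : x j = 1.
Local Notation z := (coord_fun j).
Local Notation u i := (coord_fun j i - cst (x i)).

Lemma restr_coord_neq0 : restr X 'X_j != 0.
Proof. by apply: (restr_neq0 Xx); rewrite mevalXU xj oner_eq0. Qed.

Lemma has_value_z i : has_value (z i) x (x i).
Proof. by have := @has_value_coord X j i x; rewrite xj divr1; apply; rewrite oner_eq0. Qed.

Lemma has_value_u i : has_value (u i) x 0.
Proof.
rewrite -(subrr (x i)); apply: has_valueB => //; first exact: has_value_z.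
exact: has_value_constant.
Qed.

Lemma has_value_dehom1 F : has_value (dehom j F) x F.@[x].
Proof.
have := has_value_dehom F Xx; move=> /(_ j); rewrite xj oner_eq0 => /(_ isT).
by under [X in _.@[X]]eq_fun do rewrite divr1.
Qed.

(** A first order expansion whose remainder is absorbed in the coefficients b k,
    which vanish at the point. *)
Definition taylor (F : {mpoly algC[n.+1]}) : Prop :=
  exists b : 'I_n.+1 -> K, (forall k, has_value (b k) x 0) /\
    dehom j F = cst F.@[x] + \sum_k (cst (F^`M(k)).@[x] + b k) * u k.

Lemma has_value0 : has_value (0 : K) x 0.
Proof. by rewrite -[X in has_value X](rmorph0 cst); apply: has_value_constant. Qed.

Lemma taylorC a : taylor a%:MP.
Proof.
exists (fun=> 0); split=> [k|]; first exact: has_value0.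
rewrite /dehom mmapC mevalC big1 ?addr0 // => k _.
by rewrite mderivC meval0 rmorph0 addr0 mul0r.
Qed.

Lemma taylorX i : taylor 'X_i.
Proof.
exists (fun=> 0); split=> [k|]; first exact: has_value0.
rewrite /dehom mmapX mmap1U mevalXU (bigD1 i) //= big1 => [|k ki].
  have -> : ('X_i : {mpoly algC[n.+1]})^`M(i) = 1.
    rewrite mderivX mnm1E eqxx scale1r -[X in (X - _)%MM](add0m U_(i)%MM).
    by rewrite addmK mpolyX0.
  by rewrite meval1 rmorph1; ring.
by rewrite mderivX mnm1E eq_sym (negPf ki) scale0r meval0 rmorph0 addr0 mul0r.
Qed.

Lemma taylorD F G : taylor F -> taylor G -> taylor (F + G).
Proof.
move=> [b [hb eb]] [c [hc ec]]; exists (fun k => b k + c k); split=> [k|].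
  by rewrite -[0]addr0; apply: has_valueD.
have -> : dehom j (F + G) = dehom j F + dehom j G by rewrite /dehom mmapD.
rewrite eb ec mevalD rmorphD addrACA -big_split /=.
by congr (_ + _); apply: eq_bigr => k _; rewrite mderivD mevalD rmorphD; ring.
Qed.

Lemma taylorM F G : taylor F -> taylor G -> taylor (F * G).
Proof.
move=> [b [hb eb]] [c [hc ec]].
exists (fun k => b k * dehom j G + cst (F^`M(k)).@[x] * (dehom j G - cst G.@[x])
  + cst F.@[x] * c k); split=> [k|].
  have hG := has_value_dehom1 G; have hcst := has_value_constant x.
  rewrite (_ : 0 = 0 * G.@[x] + (F^`M(k)).@[x] * (G.@[x] - G.@[x]) + F.@[x] * 0); last by ring.
  by apply: has_valueD => //; [apply: has_valueD => //|]; apply: has_valueM => //;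
     apply: has_valueB.
have -> : dehom j (F * G) = dehom j F * dehom j G by rewrite /dehom rmorphM.
rewrite {1}eb mulrDl {1}ec mevalM rmorphM mulrDr.
rewrite -addrA; congr (_ + _); rewrite mulr_sumr mulr_suml -big_split /=.
by apply: eq_bigr => k _; rewrite mderivM mevalD !mevalM rmorphD !rmorphM /=; ring.
Qed.

Lemma taylor_expansion F : taylor F.
Proof.
rewrite (mpolyE F); apply: (big_ind taylor); first by have := taylorC 0; rewrite mpolyC0.
  exact: taylorD.
move=> m _; rewrite -mul_mpolyC mpolyXE_id; apply: taylorM; first exact: taylorC.
apply: (big_ind taylor); first by have := taylorC 1; rewrite mpolyC1.
  exact: taylorM.
move=> i _; elim: (m i) => [|k IH]; first by have := taylorC 1; rewrite mpolyC1.
by rewrite exprS; apply: taylorM => //; apply: taylorX.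
Qed.

Definition mx_value m p (A : 'M[K]_(m, p)) (V : 'M[algC]_(m, p)) : Prop :=
  forall i k, has_value (A i k) x (V i k).

Lemma mx_value_mul m p q (A : 'M_(m, p)) (C : 'M_(p, q)) V W :
  mx_value A V -> mx_value C W -> mx_value (A *m C) (V *m W).
Proof.
move=> hA hC i k; rewrite !mxE; apply: has_value_sum => // l.
exact: has_valueM.
Qed.

Lemma mx_value_add m p (A C : 'M_(m, p)) V W :
  mx_value A V -> mx_value C W -> mx_value (A + C) (V + W).
Proof. by move=> hA hC i k; rewrite !mxE; apply: has_valueD. Qed.

Lemma mx_value_map m p (V : 'M_(m, p)) : mx_value (map_mx cst V) V.
Proof. by move=> i k; rewrite mxE; apply: has_value_constant. Qed.

Lemma mx_value_det m (A : 'M_m) V : mx_value A V -> has_value (\det A) x (\det V).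
Proof.
move=> hA; apply: has_value_sum => // s; apply: has_valueM.
  by have := has_value_constant x ((-1) ^+ (perm.odd_perm s)); rewrite rmorph_sign.
by apply: has_value_prod => i; apply: hA.
Qed.

Lemma mx_value_adj m (A : 'M_m) V : mx_value A V -> mx_value (\adj A) (\adj V).
Proof.
move=> hA i k; rewrite !mxE /cofactor; apply: has_valueM.
  by have := has_value_constant x ((-1) ^+ (k + i)); rewrite rmorph_sign.
by apply: mx_value_det => a b; rewrite !mxE.
Qed.

(** The Jacobian has corank 2, and its kernel contains x by Euler's identity;
    normalising the j-th coordinate cuts the kernel down to a line. *)
Lemma augmented_jacobian_rank :
  \rank (col_mx (jacobian (equations X) x) (delta_mx 0 j : 'rV_n.+1)) = n.
Proof.
have rJ := curve_smooth Xx; set J := jacobian _ _ in rJ *.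
have Jx : J *m (\col_i x i) = 0.
  apply/matrixP => a b; rewrite !mxE.
  have aX : (equations X)`_a \in equations X by apply: mem_nth.
  have [d hd] := equations_homogeneous aX.
  have F0 : (to_algC (equations X)`_a).@[x] = 0.
    by have [_] := Xx; apply; exists (equations X)`_a.
  rewrite -[RHS](euler_zero (to_algC_dhomog hd) F0).
  by apply: eq_bigr => i _; rewrite !mxE mulrC.
rewrite -addsmxE; apply: (etrans _ (etrans (addn1 _) rJ)).
transitivity (\rank J + \rank ((delta_mx 0 j)%R : 'rV[algC]_n.+1))%N; last first.
  by rewrite mxrank_delta.
apply: mxrank_disjoint_sum; apply/eqP; rewrite -submx0; apply/row_subP => i.
set v := row i _; have := row_sub i (J :&: ((delta_mx 0 j)%R : 'rV_n.+1))%MS.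
rewrite -/v sub_capmx => /andP[/submxP[c ec] /sub_rVP[a ea]].
rewrite submx0; apply/eqP.
have : v *m (\col_i x i) = 0 by rewrite ec -mulmxA Jx mulmx0.
rewrite ea -scalemxAl -rowE => /matrixP/(_ 0 0); rewrite !mxE xj mulr1 => ->.
by rewrite scale0r.
Qed.

(** Modulo the square of the maximal ideal the Taylor expansions of the
    equations are linear relations between the coordinates, and they leave a
    single parameter; Cramer's rule, the matrix being invertible at the point,
    makes this hold exactly. *)
Lemma coordinate_multiples :
  exists p : K, has_value p x 0 /\
    forall i, exists c a, has_value c x a /\ u i = p * c.
Proof.
set m := size (equations X).
have rJ := augmented_jacobian_rank; set J := col_mx _ _ in rJ.
have /choice[b hb] : forall k : 'I_m, exists b : 'I_n.+1 -> K,
    (forall l, has_value (b l) x 0) /\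
    \sum_l (cst (jacobian (equations X) x k l) + b l) * u l = 0.
  move=> k; have [b [b0 eb]] := taylor_expansion (to_algC (equations X)`_k).
  have kX : (equations X)`_k \in equations X by apply: mem_nth.
  exists b; split=> //; move: eb; rewrite (dehom_equation restr_coord_neq0) //.
  have [_ ->] := Xx; last by exists (equations X)`_k.
  rewrite rmorph0 add0r => /esym e; rewrite -[RHS]e.
  by apply: eq_bigr => l _; rewrite mxE.
pose U : 'cV[K]_n.+1 := \col_l u l.
pose C : 'M[K]_(m + 1, n.+1) := col_mx (\matrix_(k, l) b k l) 0.
have rel : (map_mx cst J + C) *m U = 0.
  rewrite map_col_mx add_col_mx mul_col_mx addr0.
  rewrite -[RHS](col_mx0); congr col_mx.
    apply/matrixP => k l; rewrite !mxE -[RHS](proj2 (hb k)).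
    by apply: eq_bigr => i _; rewrite !mxE.
  rewrite map_delta_mx -rowE; apply/matrixP => k l; rewrite !mxE.
  rewrite xj rmorph1; apply/eqP; rewrite subr_eq0; apply/eqP.
  apply: rfun_inj; rewrite rfun_subK /fraction_of rmorph1 divff //.
  exact: restr_coord_neq0.
have C0 : mx_value C 0.
  move=> k l; rewrite /C mxE; case: splitP => i _; rewrite !mxE.
    exact: (proj1 (hb i)).
  exact: has_value0.
pose V := row_ebase J; pose W := invmx (col_ebase J).
have Vu : V \in unitmx by apply: row_ebase_unit.
have WJ : W *m J = pid_mx n *m V.
  rewrite -{1}(mulmx_ebase J) rJ -mulmxA mulKmx ?col_ebase_unit //.
pose w := map_mx cst V *m U.
have Uw : U = map_mx cst (invmx V) *m w.
  by rewrite mulmxA -map_mxM mulVmx // map_mx1 mul1mx.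
pose D : 'M[K]_n.+1 := map_mx cst (pid_mx n *m W) *m C *m map_mx cst (invmx V).
have nm : (n <= m + 1)%N by rewrite -rJ rank_leq_row.
(* Gaussian elimination on the scalar part of the system *)
have relw : (map_mx cst (pid_mx n) + D) *m w = 0.
  have e0 : map_mx cst (pid_mx n *m W : 'M_(n.+1, m + 1)) *m ((map_mx cst J + C) *m U) = 0.
    by rewrite rel mulmx0.
  rewrite mulmxDl mulmxDr !mulmxA -map_mxM -(mulmxA _ W J) WJ in e0.
  rewrite (mulmxA (pid_mx n) (pid_mx n) V) mul_pid_mx minnn (minn_idPr nm) in e0.
  rewrite mulmxDl.
  have -> : D *m w = map_mx cst (pid_mx n *m W) *m C *m U by rewrite /D -(mulmxA _ _ w) -Uw.
  have -> : map_mx cst (pid_mx n : 'M_n.+1) *m w =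
      map_mx cst ((pid_mx n : 'M_n.+1) *m V) *m U.
    by rewrite /w mulmxA -map_mxM.
  exact: e0.
have D0 : mx_value D 0.
  have -> : 0 = (pid_mx n *m W) *m 0 *m invmx V :> 'M[algC]_n.+1 by rewrite mulmx0 mul0mx.
  by apply: mx_value_mul (mx_value_map _); apply: mx_value_mul C0; apply: mx_value_map.
pose M := 1%:M + D.
have M1 : mx_value M 1%:M.
  rewrite -[1%:M]addr0; apply: mx_value_add D0.
  by rewrite -(map_mx1 cst); apply: mx_value_map.
have dM : has_value (\det M) x 1 by have := mx_value_det M1; rewrite det1.
have dM0 : \det M != 0.
  apply/eqP => e; have := has_value_uniq Xx dM; rewrite e => /(_ 0 has_value0).
  by move/eqP; rewrite oner_eq0.
(* only the last coordinate of w, the uniformizer, survives on the right *)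
have Mw : M *m w = copid_mx n *m w.
  rewrite /M /copid_mx -[RHS]addr0 -relw !mulmxDl mulNmx map_pid_mx.
  by rewrite addrA subrK.
have ew l : w l 0 = w ord_max 0 * (\adj M l ord_max / \det M).
  have e1 : \det M *: w = \adj M *m (copid_mx n *m w).
    by rewrite -Mw mulmxA mul_adj_mx mul_scalar_mx.
  rewrite copid_mx_col in e1; move: (w) e1 => v /matrixP/(_ l 0).
  by rewrite -scalemxAr -colE !mxE => e3; rewrite mulrA -e3 mulrC mulKf.
have adjv := mx_value_adj M1.
exists (w ord_max 0); split.
  have : mx_value U 0 by move=> k l; rewrite !mxE; apply: has_value_u.
  by move/(mx_value_mul (mx_value_map V))/(_ ord_max 0);
     rewrite mulmx0 [X in has_value _ _ X]mxE.
move=> i; exists (\sum_l cst (invmx V i l) * (\adj M l ord_max / \det M)).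
exists (\sum_l invmx V i l * (\adj (1%:M : 'M[algC]_n.+1) l ord_max / 1)); split.
  apply: has_value_sum => // l; apply: has_valueM (has_value_constant _ _) _.
  by apply: has_value_div; rewrite ?oner_eq0.
have -> : u i = U i 0 by rewrite mxE.
rewrite Uw mxE mulr_sumr; apply: eq_bigr => l _.
by rewrite mxE ew mulrCA.
Qed.

(** The functions vanishing at x are combinations of the u i with coefficients
    regular at x. *)
Lemma principal_maximal_ideal :
  exists p : K, has_value p x 0 /\
    forall f, has_value f x 0 -> exists h a, has_value h x a /\ f = p * h.
Proof.
have [p [p0 hp]] := coordinate_multiples; exists p; split=> // f.
move=> [d [F [G [hF hG G0 ef /esym/eqP F0]]]].
have {F0} F0 : F.@[x] = 0 by move: F0; rewrite mulf_eq0 invr_eq0 (negPf G0) orbF => /eqP.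
have Gv := has_value_dehom1 G.
have [b [b0 eb]] := taylor_expansion F.
have /choice[c hc] := hp.
exists ((\sum_k (cst (F^`M(k)).@[x] + b k) * c k) / dehom j G).
have /choice[a ha] := hc.
exists ((\sum_k ((F^`M(k)).@[x] + 0) * a k) / G.@[x]); split.
  apply: has_value_div => //; apply: has_value_sum => // k.
  apply: has_valueM; last by case: (ha k).
  by apply: has_valueD => //; apply: has_value_constant.
rewrite {1}(dehom_fraction hF hG restr_coord_neq0 ef).
rewrite eb F0 rmorph0 add0r mulrA; congr (_ / _); rewrite mulr_sumr.
by apply: eq_bigr => k _; rewrite (proj2 (ha k)) mulrCA.
Qed.

End SmoothPoint.

(** * Ramification forces critical values *)

Lemma clear_denominators (L : fieldType) (cst : {rmorphism algC -> L}) (t f : L) :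
  (forall a, t <> cst a) -> algebraic_extension (ratfuns cst t) ->
  exists P, algebraic_rel cst t P f.
Proof.
move=> tn /(_ f)[q [qE q0 qf]].
have /choice[ab hab] : forall i, exists ab : {poly algC} * {poly algC},
    ab.2 != 0 /\ q`_i = poly_val cst t ab.1 / poly_val cst t ab.2.
  move=> i; have [a [b e]] := qE i; have [b0|b0] := eqVneq b 0.
    by exists (0, 1); rewrite oner_eq0 e b0 !rmorph0 invr0 mulr0 mul0r.
  by exists (a, b).
pose d := \prod_(i < size q) (ab i).2.
have d0 : poly_val cst t d != 0.
  by rewrite poly_val_eq0 //; apply/prodf_neq0 => i _; case: (hab i).
pose c i := (ab i).1 * \prod_(k < size q | k != i :> nat) (ab k).2.
pose P := \poly_(i < size q) c i.
have eP : map_poly (poly_val cst t) P = poly_val cst t d *: q.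
  apply/polyP => i; rewrite coef_map coefZ coef_poly /=; case: ltnP => h; last first.
    by rewrite rmorph0 [q`_i]nth_default ?mulr0.
  have [b0 e] := hab i.
  have -> : d = (ab i).2 * \prod_(k < size q | k != i :> nat) (ab k).2.
    by rewrite /d (bigD1 (Ordinal h)).
  by rewrite e /c !rmorphM /=; field; rewrite poly_val_eq0.
exists P; split; last by rewrite eP rootZ.
apply: contra_neq q0 => P0; have /eqP := eP.
by rewrite P0 rmorph0 eq_sym scaler_eq0 (negPf d0) => /eqP.
Qed.

Section Center.
Variables (X : curve) (t : function_field X) (alpha : algC).
Local Notation n := (ambient_dim X).
Local Notation K := (function_field X).
Local Notation cst := (constant_function X).
Local Notation ev := (poly_val cst t).
Local Notation s := (t - cst alpha).
Hypothesis t_nonconst : forall a, t <> cst a.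
Hypothesis alg : forall f, exists P, algebraic_rel cst t P f.
Variable B : set K.
Hypothesis B_adm : admissible_ring cst t alpha B.
Hypothesis B_val : forall z, B z \/ B z^-1.
Local Notation residue := (residue cst B).
Local Notation nonunit := (nonunit B).

(** Projectivity: scaling by the coordinate of least valuation makes all the
    coordinates integral. *)
Lemma integral_chart : exists j : 'I_n.+1,
  restr X 'X_j != 0 /\ forall i, B (coord_fun j i).
Proof.
have [[x Xx] _] := curve_irreducible X.
have [[j0 xj0] _] := Xx.
have rj0 : restr X 'X_j0 != 0 by apply: (restr_neq0 Xx); rewrite mevalXU.
pose r i : K := coord_fun j0 i.
have [j [rj hj]] : exists j, r j != 0 /\ forall i, i \in enum 'I_n.+1 -> B (r i / r j).
  elim: (enum _) => [|i l [j [rj hj]]].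
    exists j0; split=> //; rewrite -(fmorph_eq0 (rfun X)) rfun_subK /fraction_of.
    by rewrite divff ?oner_eq0.
  have [h|h] := B_val (r i / r j).
    by exists j; split=> // k; rewrite inE => /orP[/eqP->//|/hj].
  have [ri|ri] := eqVneq (r i) 0.
    exists j; split=> // k; rewrite inE => /orP[/eqP->|/hj//].
    by rewrite ri mul0r; apply: (adm0 B_adm).
  exists i; split=> // k; rewrite inE => /orP[/eqP->|/hj hk].
    by rewrite divff //; apply: (adm1 B_adm).
  rewrite invf_div in h.
  have -> : r k / r i = (r k / r j) * (r j / r i) by rewrite mulrA divfK.
  exact: adm_mul B_adm _ _ hk h.
have rXj : restr X 'X_j != 0.
  apply: contra_neq rj => e; apply: rfun_inj.
  by rewrite rfun_subK /fraction_of e mul0r rmorph0.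
exists j; split=> // i; have -> : coord_fun j i = r i / r j.
  apply: rfun_inj; rewrite fmorph_div !rfun_subK /fraction_of.
  by rewrite -mulf_div divff ?invr_neq0 ?mulr1 // invrK.
by apply: hj; rewrite mem_enum.
Qed.

(** The residues of the coordinates satisfy the equations of the curve. *)
Lemma center_exists : exists (x : coordinates n) (j : 'I_n.+1),
  [/\ curve_points X x, x j = 1 & forall i, residue (coord_fun j i) (x i)].
Proof.
have [j [j0 hj]] := integral_chart.
have /choice[x hx] : forall i, exists a, residue (coord_fun j i) a.
  by move=> i; apply: (residue_exists t_nonconst B_adm B_val).
have xj : x j = 1.
  apply: (residue_uniq B_adm B_val (hx j)).
  have -> : coord_fun j j = cst 1.
    by apply: rfun_inj; rewrite rfun_constant rfun_subK /fraction_of divff // rmorph1.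
  exact: residue_cst B_adm _.
exists x, j; split=> //; split; first by exists j; rewrite xj oner_eq0.
move=> _ [f fX ->].
have := residue_mmap B_adm B_val (to_algC f) hx.
rewrite -/(dehom j (to_algC f)) (dehom_equation j0 fX) => h.
apply: (residue_uniq B_adm B_val h).
by rewrite -[X in residue X](rmorph0 cst); apply: residue_cst B_adm _.
Qed.

Variables (x : coordinates n) (j : 'I_n.+1).
Hypothesis Xx : curve_points X x.
Hypothesis xj : x j = 1.
Hypothesis hx : forall i, residue (coord_fun j i) (x i).

(** The valuation ring B dominates the local ring at the center. *)
Lemma value_residue f a : has_value f x a -> residue f a.
Proof.
move=> [d [F [G [hF hG G0 ef ->]]]]; have j0 := restr_coord_neq0 Xx xj.
rewrite (dehom_fraction hF hG j0 ef).
by apply: (residue_div B_adm B_val) => //; apply: (residue_mmap B_adm B_val).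
Qed.

(** The local ring at a smooth point dominated by B is B itself: in a quotient
    of local functions that lies in B a common factor, the uniformizer, can be
    cancelled, and only finitely often. *)
Lemma residue_value f : B f -> exists a, has_value f x a.
Proof.
move=> Bf; have [p [p0 hp]] := principal_maximal_ideal Xx xj.
have [F [G [G0 ef]]] := dehom_ratio f (restr_coord_neq0 Xx xj).
have np : nonunit p by have := value_residue p0; rewrite /residue rmorph0 subr0.
have [J [b [Bb eb]]] := nonunit_power_multiple t_nonconst B_adm B_val np (alg p).
(* h has finite valuation, hence is not divisible by every power of p *)
have bound h : h != 0 -> B h -> exists N, forall c, B c -> h <> p ^+ N * c.
  move=> h0 Bh; have [e [c [Bc ec]]] := param_power_multiple B_adm B_val h0 Bh (alg h).
  exists (J * e.+1)%N => d Bd eh; apply: (adm_pole B_adm).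
  have s0 : s != 0 by apply: param_neq0.
  suff -> : s^-1 = b ^+ e.+1 * d * c.
    by apply: (adm_mul B_adm) => //; apply: (adm_mul B_adm) => //; apply: (admX B_adm).
  apply: (mulfI (expf_neq0 e.+1 s0)); rewrite {1}exprSr mulfK // ec eh exprM eb exprMn.
  by rewrite !mulrA.
have Bval g a : has_value g x a -> B g by move/value_residue/(residue_B B_adm).
have desc N : forall g h a b, has_value g x a -> has_value h x b -> h != 0 ->
    B (g / h) -> (forall c, B c -> h <> p ^+ N * c) -> exists c, has_value (g / h) x c.
  elim: N => [|N IH] g h a c hg hh h0 Bgh hN.
    by have := hN h (Bval _ _ hh); rewrite expr0 mul1r.
  have [c0|c0] := eqVneq c 0; last by exists (a / c); apply: has_value_div.
  rewrite c0 in hh; have a0 : a = 0.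
    apply: (residue_uniq B_adm B_val (value_residue hg)).
    rewrite /residue rmorph0 subr0 -(divfK h0 g) mulrC.
    apply: (nonunitM B_adm) => //.
    by have := value_residue hh; rewrite /residue rmorph0 subr0.
  rewrite a0 in hg; have [g1 [a1 [hg1 eg]]] := hp _ hg; have [h1 [c1 [hh1 eh]]] := hp _ hh.
  have p0' : p != 0 by apply: contra_neq h0 => pz; rewrite eh pz mul0r.
  have egh : g / h = g1 / h1 by rewrite eg eh -mulf_div divff // mul1r.
  rewrite egh; apply: IH hg1 hh1 _ _ _.
  - by apply: contra_neq h0 => e; rewrite eh e mulr0.
  - by rewrite -egh.
  - by move=> d Bd e1; apply: (hN d) => //; rewrite eh e1 exprS mulrA.
have hF := has_value_dehom1 Xx xj F; have hG := has_value_dehom1 Xx xj G.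
have [N hN] := bound _ G0 (Bval _ _ hG).
by rewrite ef; apply: desc hF hG G0 _ hN; rewrite -ef.
Qed.

Lemma center_value : has_value t x alpha.
Proof.
have Bt : B t by rewrite -(poly_valX cst t); apply: adm_poly B_adm _.
have [a ha] := residue_value Bt.
by rewrite -(residue_uniq B_adm B_val (value_residue ha) (residue_t B_adm)).
Qed.

(** If t - alpha generated the maximal ideal, it would have valuation 1, which
    a p-th power times a unit cannot have. *)
Lemma ramified_multiple_zero p y (g : {poly algC}) :
  prime p -> y ^+ p = ev g -> g != 0 -> root g alpha ->
  ~~ (('X - alpha%:P) ^+ p %| g) -> multiple_zero s x.
Proof.
move=> pr ey g0 ga ndiv.
have [q [q0 hq]] := principal_maximal_ideal Xx xj.
have vs : has_value s x 0.
  rewrite -(subrr alpha); apply: has_valueB => //; first exact: center_value.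
  exact: has_value_constant.
have [h [b [hb es]]] := hq _ vs.
have [b0|b0] := eqVneq b 0.
  rewrite b0 in hb; exists [:: (q, h)]; split; last by rewrite big_seq1.
  by move=> uv; rewrite inE => /eqP->.
have [h0 Bh] := residue_inv B_adm B_val (value_residue hb) b0.
have gen f : nonunit f -> exists c, B c /\ f = s * c.
  move=> nf; have Bf : B f by case: nf.
  have [a ha] := residue_value Bf.
  have a0 : a = 0.
    apply: (residue_uniq B_adm B_val (value_residue ha)).
    by rewrite /residue rmorph0 subr0.
  rewrite a0 in ha; have [c [d [hc ef]]] := hq _ ha.
  exists (h^-1 * c); split.
    by apply: (adm_mul B_adm) => //; apply: (residue_B B_adm (value_residue hc)).
  by rewrite ef es -mulrA mulVKf.
have [m [g1 g1a eg]] := multiplicity_XsubC g alpha; rewrite g0 /= in g1a.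
have m0 : (0 < m)%N.
  by rewrite lt0n; apply/eqP => m0; move: ga; rewrite eg m0 mulr1 (negPf g1a).
have mp : (m < p)%N.
  by rewrite ltnNge; apply: contra ndiv => pm; rewrite eg dvdp_mull // dvdp_exp2l.
have cop : coprime m p.
  by rewrite coprime_sym prime_coprime // gtnNdvd.
have s0 : s != 0 by apply: param_neq0.
have [e1n Be1] := residue_inv B_adm B_val (residue_poly B_adm B_val g1) g1a.
case: (egcdnP p m0) => u c euc _; rewrite (eqP cop) in euc.
(* with m u = 1 + p c, the element y ^ u / (t - alpha) ^ c has p-th power
   (t - alpha) times a unit *)
pose e := ev g1 ^+ u.
have ue : e != 0 /\ B e^-1.
  by split; [rewrite expf_neq0 | rewrite -exprVn; apply: (admX B_adm)].
have Be : B e by apply: (admX B_adm); apply: adm_poly B_adm _.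
have nue : ~ nonunit e.
  move=> ne; apply: (not_nonunit1 B_adm).
  by case: ue => en eB; rewrite -(mulfV en); apply: (nonunitM B_adm).
pose w := y ^+ u / s ^+ c.
have ew : w ^+ p = s * e.
  rewrite /w expr_div_n -!exprM mulnC exprM ey eg rmorphM rmorphXn /= poly_val_XsubC.
  rewrite exprMn -exprM [(m * u)%N]mulnC euc -/e exprD expr1.
  by rewrite mulrA mulrAC; rewrite [e * _]mulrC mulrK ?unitfE ?expf_neq0 // mulrC.
have ns := nonunit_param B_adm.
have nse : nonunit (s * e) by apply: (nonunitM B_adm).
have Bw : B w.
  apply: contrapT => nw; have Bw' : B w^-1 by case: (B_val w).
  apply: (not_nonunit1 B_adm).
  have w0 : w != 0 by apply/eqP => w0; apply: nw; rewrite w0; apply: (adm0 B_adm).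
  rewrite -(divff (expf_neq0 p w0)) {1}ew -exprVn; apply: (nonunitM B_adm) => //.
  exact: (admX B_adm).
have nw : nonunit w by apply: (nonunitX B_adm (m := p)) => //; rewrite ew.
have [c' [Bc' ec']] := gen _ nw; case: nue.
have -> : e = s * (s ^+ p.-2 * c' ^+ p).
  apply: (mulfI s0); rewrite -ew ec' exprMn ![RHS]mulrA; congr (_ * _).
  by case: p pr {ey ndiv mp cop euc ew nw ec'} => [|[|k]] // _; rewrite !exprS mulrA.
apply: (nonunitM B_adm) => //; apply: (adm_mul B_adm); apply: (admX B_adm) => //.
exact: adm_param B_adm.
Qed.

End Center.

(** At a place above t = alpha the extension generated by y ramifies. *)
Theorem root_critical_value (X : curve) (t : function_field X) p y
    (g : {poly algC}) (alpha : algC) :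
  (forall a, t <> constant_function X a) ->
  (forall f, exists P, algebraic_rel (constant_function X) t P f) ->
  prime p -> y ^+ p = poly_val (constant_function X) t g -> g != 0 ->
  root g alpha -> ~~ (('X - alpha%:P) ^+ p %| g) -> critical_value t (Some alpha).
Proof.
move=> tn alg pr ey g0 ga ndiv.
have [B [aB vB]] := valuation_ring_exists alpha tn.
have [x [j [Xx xj hx]]] := center_exists tn alg aB vB.
exists x => //; exact: (ramified_multiple_zero tn alg aB vB Xx xj hx pr ey).
Qed.

(** * Descent from algebraic to rational coefficients *)

Local Notation pQtoC := (map_poly (ratr : rat -> algC)).

Lemma rat_poly_over_1 (L : fieldExtType rat) (s : {poly L}) : s \is a polyOver 1%VS ->
  exists s1 : {poly rat}, s = map_poly (in_alg L) s1.
Proof.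
move=> /polyOverP s1; have a_ i := sig_eqW (vlineP _ _ (s1 i)).
exists (\poly_(i < size s) sval (a_ i)); apply/polyP => i.
rewrite coef_map coef_poly /=; case: ltnP => h.
  by case: (a_ i) => a /= ->.
by rewrite scale0r nth_default.
Qed.

Lemma map_poly_in_alg (L : fieldExtType rat) (f : {rmorphism L -> algC}) (s : {poly rat}) :
  map_poly f (map_poly (in_alg L) s) = pQtoC s.
Proof.
rewrite -map_poly_comp; apply: eq_map_poly => a /=.
by rewrite alg_num_field fmorph_rat.
Qed.

(** If c were the only root of its minimal polynomial, then the sum of the roots,
    a rational number, would be a multiple of c. *)
Lemma conjugate_exists (c : algC) : c \notin Crat ->
  exists2 c', c' != c & root (minCpoly c) c'.
Proof.
move=> cQ; have [r er] := closed_field_poly_normal (minCpoly c).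
rewrite (monicP (minCpoly_monic c)) scale1r in er.
have [/allP rc|/allPn[c' rc' cc']] := boolP (all (pred1 c) r); last first.
  by exists c' => //; rewrite er root_prod_XsubC.
case/negP: cQ; have [p [ep _] _] := minCpolyP c.
have r0 : size r != 0%N.
  by have := size_minCpoly c; rewrite er size_prod_XsubC ltnS lt0n.
have := coefPn_prod_XsubC r0; rewrite -er ep coef_map /=.
have -> : \sum_(x <- r) x = c *+ size r.
  rewrite big_seq (eq_bigr (fun=> c)) => [|x /rc /= /eqP //].
  by rewrite -big_seq big_const_seq count_predT iter_addr_0.
move=> e; have -> : c = - ratr p`_(size r).-1 / (size r)%:R.
  by rewrite e opprK -[c *+ _]mulr_natr mulfK // pnatr_eq0.
by rewrite rpred_div ?rpredN ?rpred_nat ?Crat_rat.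
Qed.

Lemma moving_automorphism (c : algC) : c \notin Crat ->
  exists nu : {rmorphism algC -> algC}, nu c != c.
Proof.
move=> /conjugate_exists[c' cc' pc'].
have [q [eq _] dvq] := minCpolyP c.
have [r er] := closed_field_poly_normal (minCpoly c).
rewrite (monicP (minCpoly_monic c)) scale1r in er.
have [Qs [QsC [rr err gen]]] := num_field_exists r.
have lift x : root (minCpoly c) x -> exists y, QsC y = x.
  by rewrite er root_prod_XsubC -err => /mapP[y _ ->]; exists y.
have [z zc] := lift _ (root_minCpoly c); have [z' zc'] := lift _ pc'.
have hom1 : kHom 1 1 (\1%VF : 'End(Qs)) by rewrite kHom1.
have root_z' : root (map_poly (\1%VF : 'End(Qs)) (minPoly 1 z)) z'.
  have -> : map_poly (\1%VF : 'End(Qs)) (minPoly 1 z) = minPoly 1 z.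
    by rewrite map_polyE map_id_in ?polyseqK // => a _; rewrite id_lfunE.
  have [s es] := rat_poly_over_1 (minPolyOver 1 z).
  rewrite es -(fmorph_root QsC) map_poly_in_alg zc'.
  have : root (pQtoC s) c by rewrite -zc -(map_poly_in_alg QsC) fmorph_root -es root_minPoly.
  rewrite dvq => /dvdpP[h ->]; rewrite rmorphM rootM /= -eq pc'.
  by rewrite orbT.
have homz := kHomExtendP (sub1v _) hom1 root_z'.
have [||g homg eg] := kHom_extends (sub1v _) homz (p := map_poly (in_alg Qs) q) (U := fullv).
- by apply/polyOverP => i; rewrite coef_map memvZ ?memv_line.
- apply: splittingFieldForS (sub1v _) (subvf _) _; exists rr => //.
  suff -> : map_poly (in_alg Qs) q = \prod_(x <- rr) ('X - x%:P) by rewrite eqpxx.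
  apply: (map_poly_inj QsC); rewrite map_poly_in_alg -eq er -err big_map rmorph_prod /=.
  by apply: eq_bigr => x _; rewrite map_polyXsubC.
pose gM := GRing.isMonoidMorphism.Build _ _ g (kHom_monoid_morphism homg).
pose phi : {rmorphism Qs -> Qs} := HB.pack (fun_of_lfun g) gM.
have [nu enu] := extend_algC_subfield_aut QsC phi.
exists nu; rewrite -{1}zc -enu /= -eg ?memv_adjoin //.
by rewrite (kHomExtend_val hom1 root_z') zc'.
Qed.

Section Descent.
Variable X : curve.
Local Notation n := (ambient_dim X).
Local Notation K := (function_field X).
Local Notation cst := (constant_function X).

Lemma to_algCM (F G : {mpoly rat[n.+1]}) : to_algC (F * G) = to_algC F * to_algC G.
Proof. exact: rmorphM. Qed.

Lemma meval_aut (nu : {rmorphism algC -> algC}) (F : {mpoly rat[n.+1]}) x :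
  nu (to_algC F).@[x] = (to_algC F).@[fun i => nu (x i)].
Proof.
rewrite /to_algC !mevalE rmorph_sum /=; apply: eq_bigr => m _.
rewrite rmorphM rmorph_prod mcoeff_map_mpoly /= fmorph_rat; congr (_ * _).
by apply: eq_bigr => i _; rewrite rmorphXn.
Qed.

Lemma curve_points_aut (nu : {rmorphism algC -> algC}) x :
  curve_points X x -> curve_points X (fun i => nu (x i)).
Proof.
move=> [[i xi] hx]; split; first by exists i; rewrite fmorph_eq0.
move=> F [f fX ->]; rewrite -meval_aut hx ?rmorph0 //; by exists f.
Qed.

(** Clearing denominators turns the relation into the vanishing of a polynomial on X,
    and X, being defined over Q, is stable under automorphisms of algC. *)
Lemma rational_relation_aut (I : finType) (f : I -> K) (c : I -> algC)
    (nu : {rmorphism algC -> algC}) :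
  (forall i, rational_function_field X (f i)) ->
  \sum_i cst (c i) * f i = 0 -> \sum_i cst (nu (c i)) * f i = 0.
Proof.
move=> fQ; have /choice[FG hFG] : forall i,
    exists FG : {mpoly rat[n.+1]} * {mpoly rat[n.+1]},
    restr X (to_algC FG.2) != 0 /\
    rfun X (f i) = restr X (to_algC FG.1) / restr X (to_algC FG.2).
  move=> i; have [d [F [G [_ _ e]]]] := fQ i.
  have [G0|G0] := eqVneq (restr X (to_algC G)) 0; last by exists (F, G).
  exists (0, 1); rewrite /to_algC !rmorph1 !rmorph0 oner_eq0 e /fraction_of G0.
  by rewrite invr0 mulr0 mul0r.
pose W i := (FG i).1 * \prod_(k | k != i) (FG k).2.
pose D := \prod_k (FG k).2.
have D0 : restr X (to_algC D) != 0.
  by rewrite /to_algC !rmorph_prod; apply/prodf_neq0 => i _; case: (hFG i).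
have key (a : I -> algC) : \sum_i cst (a i) * f i = 0 <->
    forall x, curve_points X x -> \sum_i a i * (to_algC (W i)).@[x] = 0.
  pose G := \sum_i (a i)%:MP * to_algC (W i).
  have eG x : G.@[x] = \sum_i a i * (to_algC (W i)).@[x].
    by rewrite /G rmorph_sum; apply: eq_bigr => i _; rewrite /= mevalM mevalC.
  have rG : restr X G = rfun X (\sum_i cst (a i) * f i) * restr X (to_algC D).
    rewrite /G [LHS]rmorph_sum [X in X * _]rmorph_sum mulr_suml; apply: eq_bigr => i _.
    rewrite /= !rmorphM rfun_constant -mulrA; congr (_ * _).
    have [b0 ->] := hFG i.
    have -> : D = (FG i).2 * \prod_(k | k != i) (FG k).2 by rewrite /D (bigD1 i).
    by rewrite /W !to_algCM !rmorphM mulrA divfK.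
  split=> [e x Xx|h].
    by rewrite -eG; apply: (restr_value Xx); rewrite rG e rmorph0 mul0r.
  have : restr X G == 0.
    by rewrite restr_eq0; apply/vanishing_idealP => x Xx; rewrite eG h.
  by rewrite rG mulf_eq0 (negPf D0) orbF fmorph_eq0 => /eqP.
move=> /key h; apply/key => x Xx.
have Xy := curve_points_aut (algC_invaut nu) Xx.
have := congr1 nu (h _ Xy); rewrite rmorph0 rmorph_sum => e; rewrite -[RHS]e.
apply: eq_bigr => i _; rewrite rmorphM /= meval_aut; congr (_ * _).
by apply: meval_eq => k; rewrite algC_invautK.
Qed.

(** Among the relations choose one of minimal support, normalised at one of its
    coefficients: an automorphism moving another coefficient would produce a
    shorter relation. *)
Theorem rational_relation (I : finType) (f : I -> K) (c : I -> algC) :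
  (forall i, rational_function_field X (f i)) ->
  \sum_i cst (c i) * f i = 0 -> (exists i, c i != 0) ->
  exists q : I -> rat, (exists i, q i != 0) /\ \sum_i cst (ratr (q i)) * f i = 0.
Proof.
move=> fQ; have [m] := ubnP #|[pred i | c i != 0]|.
elim: m => // m IH in c *; rewrite ltnS => sm rel [i ci].
pose d k := c k / c i.
have reld : \sum_k cst (d k) * f k = 0.
  transitivity (cst (c i)^-1 * \sum_k cst (c k) * f k); last by rewrite rel mulr0.
  by rewrite mulr_sumr; apply: eq_bigr => k _; rewrite /d rmorphM mulrA [cst (c i)^-1 * _]mulrC.
have di : d i = 1 by rewrite /d divff.
have [dQ|] := boolP [forall k, d k \in Crat].
  have /choice[q hq] : forall k, exists q, d k = ratr q.
    by move=> k; apply/CratP/(forallP dQ).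
  exists q; split.
    by exists i; rewrite -(fmorph_eq0 (ratr : {rmorphism rat -> algC})) /= -hq di oner_eq0.
  by rewrite -[RHS]reld; apply: eq_bigr => k _; rewrite hq.
rewrite negb_forall => /existsP[l /moving_automorphism[nu hl]].
apply: (IH (fun k => nu (d k) - d k)).
- apply: leq_trans sm; apply: proper_card; apply/properP; split.
    apply/fintype.subsetP => k; rewrite !inE; apply: contra_neq => ck.
    by rewrite /d ck mul0r rmorph0 subrr.
  by exists i; rewrite !inE // di rmorph1 subrr eqxx.
- under eq_bigr do rewrite rmorphB mulrBl.
  by rewrite sumrB reld rational_relation_aut // subrr.
- by exists l; rewrite subr_eq0.
Qed.

End Descent.

Section RationalModel.
Variables (X : curve) (t : function_field X).
Local Notation n := (ambient_dim X).
Local Notation K := (function_field X).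
Local Notation cst := (constant_function X).
Hypothesis t_over_Q : rational_function_field X t.
Hypothesis t_nonconst : forall a, t <> cst a.

Lemma rational_function_field_divring :
  divring_closed [pred x in rational_function_field X].
Proof.
have to_algC1 : to_algC (1 : {mpoly rat[n.+1]}) = 1 by exact: rmorph1.
apply: divring_set.
- exists 0%N, 1, 1; split; rewrite ?dhomog1 //.
  by rewrite /fraction_of to_algC1 !rmorph1 divr1.
- move=> f g [d [F [G [hF hG ef]]]] [e [H [L [hH hL eg]]]].
  have [G0|G0] := eqVneq (restr X (to_algC G)) 0.
    exists e, (- H), L; split; rewrite ?dhomogN //.
    have -> : to_algC (- H) = - to_algC H by exact: rmorphN.
    rewrite rmorphB ef eg /fraction_of G0 invr0 mulr0 sub0r rmorphN mulNr.
    by [].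
  have [L0|L0] := eqVneq (restr X (to_algC L)) 0.
    by exists d, F, G; split; rewrite // rmorphB ef eg /fraction_of L0 invr0 mulr0 subr0.
  exists (d + e)%N, (F * L - H * G), (G * L); split.
  + by apply: rpredB; [|rewrite addnC]; apply: dhomogM.
  + exact: dhomogM.
  + have -> : to_algC (F * L - H * G) = to_algC (F * L) - to_algC (H * G) by exact: rmorphB.
    by rewrite rmorphB ef eg /fraction_of !to_algCM rmorphB !rmorphM subf_div.
- move=> f g [d [F [G [hF hG ef]]]] [e [H [L [hH hL eg]]]].
  exists (d + e)%N, (F * L), (G * H); split; try exact: dhomogM.
  by rewrite fmorph_div ef eg /fraction_of !to_algCM !rmorphM invf_div mulf_div.
Qed.

Lemma divring_ratr (L : fieldType) (M : set L) (q : rat) :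
  divring_closed [pred x in M] -> M (ratr q).
Proof.
move=> dM; have [M1 MB Mdiv] := divring_setP dM.
have M0 : M 0 by rewrite -(subrr 1); apply: (MB).
have Mnat k : M k%:R.
  elim: k => // k IH; have -> : k.+1%:R = k%:R - (0 - 1) :> L.
    by rewrite -addn1 natrD opprB subr0.
  by apply: (MB) => //; apply: (MB).
have Mint (z : int) : M z%:~R.
  case: z => k; first exact: Mnat.
  by rewrite NegzE mulrNz -sub0r; apply: (MB) => //; apply: Mnat.
by rewrite /ratr; apply: (Mdiv).
Qed.

Lemma rational_function_fieldX f k :
  rational_function_field X f -> rational_function_field X (f ^+ k).
Proof.
move=> fQ; elim: k => [|k IH]; last first.
  by rewrite exprS; apply: (divringM rational_function_field_divring).
by have [] := divring_setP rational_function_field_divring.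
Qed.

Local Notation toC2 := (map_poly (map_poly (ratr : rat -> algC))).

(** The relation is a linear relation between the functions t ^ l * f ^ i, which
    are defined over the rational numbers. *)
Lemma rational_algebraic_rel f P : rational_function_field X f ->
  algebraic_rel cst t P f ->
  exists Q : {poly {poly rat}}, (size Q <= size P)%N /\ algebraic_rel cst t (toC2 Q) f.
Proof.
move=> fQ [P0 rP]; pose s := size P; pose m := (\max_(i < s) size (P`_i)%R)%N.
pose I : finType := ('I_s * 'I_m)%type.
pose g (i : I) : K := t ^+ i.2 * f ^+ i.1.
have expand (S : {poly {poly algC}}) : (size S <= s)%N ->
    (forall i : 'I_s, size (S`_i)%R <= m)%N ->
    (map_poly (poly_val cst t) S).[f] = \sum_(i : I) cst S`_(i.1)`_(i.2) * g i.
  move=> sS sSi; rewrite (@horner_coef_wide _ s); last exact: leq_trans (size_poly _ _) _.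
  rewrite -(pair_bigA _ (fun (i : 'I_s) (l : 'I_m) => cst S`_i`_l * (t ^+ l * f ^+ i))) /=.
  apply: eq_bigr => i _; rewrite coef_map /= /poly_val (@horner_coef_wide _ m).
    by rewrite mulr_suml; apply: eq_bigr => l _; rewrite coef_map mulrA.
  by rewrite size_map_poly.
have Pm (i : 'I_s) : (size (P`_i)%R <= m)%N by apply: leq_bigmax.
have relP : \sum_(i : I) cst P`_(i.1)`_(i.2) * g i = 0 by rewrite -expand // (rootP rP).
have [||q [[i qi] relq]] := rational_relation _ relP.
- by move=> i; apply: (divringM rational_function_field_divring); apply: rational_function_fieldX.
- have s0 : (0 < s)%N by rewrite size_poly_gt0.
  have l1 : (s.-1 < s)%N by rewrite prednK.
  have c0 : lead_coef P != 0 by rewrite lead_coef_eq0.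
  have l2 : ((size (lead_coef P)).-1 < m)%N.
    by rewrite prednK ?size_poly_gt0 //; apply: (Pm (Ordinal l1)).
  by exists (Ordinal l1, Ordinal l2); rewrite /= -lead_coefE lead_coef_eq0.
pose Q : {poly {poly rat}} := \poly_(a < s) \poly_(b < m)
  (if (insub a, insub b) is (Some a', Some b') then q (a', b') else 0).
have cQ (k : I) : Q`_(k.1)`_(k.2) = q k.
  by case: k => a b /=; rewrite coef_poly ltn_ord coef_poly ltn_ord !valK.
exists Q; split; first exact: size_poly.
have ctoC2 a b : (toC2 Q)`_a`_b = ratr Q`_a`_b.
  by rewrite coef_map coef_map.
split.
  apply: contra_neq qi => Q0; apply: (fmorph_inj (ratr : {rmorphism rat -> algC})).
  by rewrite /= -cQ -ctoC2 Q0 !coef0 rmorph0.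
rewrite /root expand.
- by rewrite -[X in _ == X]relq; apply/eqP/eq_bigr => k _; rewrite ctoC2 cQ.
- by rewrite (leq_trans (size_poly _ _)) // size_poly.
- move=> k; rewrite coef_map size_map_poly coef_poly ltn_ord; exact: size_poly.
Qed.

Lemma subfield_gen_poly (q : {poly rat}) :
  subfield_gen [set t] (poly_val cst t (map_poly ratr q)).
Proof.
have dM := subfield_gen_divring [set t].
rewrite /poly_val horner_coef; apply: (divring_sum _ dM) => i; apply: (divringM dM).
  by rewrite !coef_map /= fmorph_rat; apply: divring_ratr.
elim: (nat_of_ord i) => [|k IH]; first by have [] := divring_setP dM.
by rewrite exprS; apply: (divringM dM) => //; apply: sub_subfield_gen.
Qed.

(** If t generated the function field over algC, linear algebra over the
    rational numbers would show that it generates the function field over Q. *)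
Lemma nonratfun_exists : rational_function_field X <> subfield_gen [set t] ->
  exists f, ~ ratfuns cst t f.
Proof.
move=> ne; apply: contrapT => no; apply: ne; apply/seteqP; split; last first.
  by apply: subfield_gen_min rational_function_field_divring _ => _ ->.
move=> f fQ; have [a [b ef]] : ratfuns cst t f by apply: contrapT => h; apply: no; exists f.
have [_ _ Mdiv] := divring_setP (subfield_gen_divring [set t]).
have [b0|b0] := eqVneq b 0.
  have := Mdiv _ _ (subfield_gen_poly 0) (subfield_gen_poly 0).
  by rewrite !rmorph0 mul0r ef b0 rmorph0 invr0 mulr0.
have evb : poly_val cst t b != 0 by rewrite poly_val_eq0.
pose P : {poly {poly algC}} := b *: 'X - a%:P.
have P1 : P`_1 = b by rewrite coefB coefZ coefX coefC subr0 mulr1.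
have relP : algebraic_rel cst t P f.
  split; first by apply: contra_neq b0 => P0; rewrite -P1 P0 coef0.
  rewrite /root rmorphB /= map_polyZ map_polyX map_polyC hornerD hornerN hornerZ hornerX hornerC.
  by rewrite ef mulrCA divff // mulr1 subrr.
have [Q [sQ [Q0 rQ]]] := rational_algebraic_rel fQ relP.
have sQ2 : (size Q <= 2)%N.
  rewrite (leq_trans sQ) // (leq_trans (size_polyD _ _)) //.
  rewrite size_polyN geq_max (leq_trans (size_scale_leq _ _)) ?size_polyX //.
  by rewrite (leq_trans (size_polyC_leq1 _)).
have e : poly_val cst t (toC2 Q)`_0 + poly_val cst t (toC2 Q)`_1 * f = 0.
  rewrite -[RHS](rootP rQ) (@horner_coef_wide _ 2); last first.
    by rewrite (leq_trans (size_poly _ _)) // (leq_trans (size_poly _ _)).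
  by rewrite big_ord_recl big_ord1 !coef_map /= expr0 mulr1 expr1.
have Q1 : poly_val cst t (toC2 Q)`_1 != 0.
  apply/negP => /eqP q1; move: e; rewrite q1 mul0r addr0 => /eqP.
  move/eqP: q1; rewrite !poly_val_eq0 // !coef_map !map_poly_eq0 => /eqP q1 /eqP q0.
  case/eqP: Q0; have -> : Q = 0; last by rewrite rmorph0.
  apply/polyP => i; rewrite coef0; case: i => [|[|i]] //.
  by rewrite nth_default // (leq_trans sQ2).
have -> : f = poly_val cst t (map_poly ratr (- Q`_0)) / poly_val cst t (map_poly ratr Q`_1).
  rewrite !coef_map /= in e Q1; rewrite rmorphN /= rmorphN.
  have /eqP := e; rewrite addrC addr_eq0 => /eqP <-.
  by rewrite mulrC mulKf.
by apply: Mdiv; apply: subfield_gen_poly.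
Qed.

Lemma relation_value P f x a b : curve_points X x ->
  algebraic_rel cst t P f -> has_value t x b -> has_value f x a ->
  (map_poly (horner_eval b) P).[a] = 0.
Proof.
move=> Xx [P0 rP] tb fa; apply: (has_value_uniq (f := (map_poly (poly_val cst t) P).[f]) Xx).
  rewrite !(@horner_coef_wide _ (size P)) ?size_poly //.
  apply: has_value_sum => // i; rewrite !coef_map /=.
  by apply: has_valueM (has_valueX _ fa); apply: has_value_horner.
by rewrite (rootP rP) -(rmorph0 cst); apply: has_value_constant.
Qed.

End RationalModel.

(** * Radicals in number fields of bounded degree *)

Lemma dim_adjoin_seq (L : fieldExtType rat) (E : {subfield L}) (l : seq L) d :
  (forall x, x \in l -> exists q : {poly rat},
     [/\ q != 0, (size q <= d.+1)%N & root (map_poly (in_alg L) q) x]) ->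
  (\dim <<E & l>> <= \dim E * d ^ size l)%N.
Proof.
elim: l E => [|x l IH] E h; first by rewrite Fadjoin_nil muln1.
have -> : <<E & x :: l>>%VS = <<<<E; x>> & l>>%VS by rewrite -adjoin_cons.
have hl y : y \in l -> exists q : {poly rat},
     [/\ q != 0, (size q <= d.+1)%N & root (map_poly (in_alg L) q) y].
  by move=> yl; apply: h; rewrite inE yl orbT.
apply: (leq_trans (IH _ hl)); rewrite expnS mulnA leq_mul2r; apply/orP; right.
have [|q [q0 sq qx]] := h x; first by rewrite inE eqxx.
rewrite dim_Fadjoin mulnC leq_mul2l; apply/orP; right.
rewrite -ltnS -size_minPoly; apply: leq_trans sq; rewrite -(size_map_poly (in_alg L)).
apply: dvdp_leq; first by rewrite map_poly_eq0.
apply: minPoly_dvdp qx; apply/polyOverP => i; rewrite coef_map.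
exact: rpredZ (mem1v E).
Qed.

(** The generator provided by the primitive element theorem lies in the number
    field generated by s, whose degree is at most d ^ size s. *)
Lemma primitive_degree_bound (s : seq algC) d :
  (forall x, x \in s -> exists q : {poly rat},
     [/\ q != 0, (size q <= d.+1)%N & root (pQtoC q) x]) ->
  exists z : algC, (size (minCpoly z) <= (d ^ size s).+1)%N /\
    forall x, x \in s -> generated_by (ratr : rat -> algC) z x.
Proof.
move=> hs; have [z [a ez] [ps es]] := algC_PET s.
exists z; split; last first.
  by move=> x; rewrite es => /mapP[q _ ->]; exists q.
have [Qs [QsC [s1 es1 gen]]] := num_field_exists s.
have ss : size s1 = size s by rewrite -es1 size_map.
have dimQ : (\dim {:Qs} <= d ^ size s)%N.
  have := @dim_adjoin_seq Qs 1%AS s1 d; rewrite dimv1 mul1n gen ss; apply => x xs.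
  have [|q [q0 sq qx]] := hs (QsC x); first by rewrite -es1 map_f.
  by exists q; split=> //; rewrite -(fmorph_root QsC) map_poly_in_alg.
pose z1 := \sum_(i < size s) s1`_i *+ a i.
have ez1 : QsC z1 = z.
  rewrite ez rmorph_sum; apply: eq_bigr => i _; rewrite rmorphMn; congr (_ *+ _).
  have e : (map QsC s1)`_i = s`_i by rewrite es1.
  by rewrite /= -e (nth_map 0) // ss.
have [m em] := rat_poly_over_1 (minPolyOver 1 z1).
have mz : root (pQtoC m) z by rewrite -ez1 -(map_poly_in_alg QsC) -em fmorph_root root_minPoly.
have [q [eq mon dv]] := minCpolyP z.
have m0 : m != 0.
  apply: contraTneq (monic_minPoly 1 z1) => e.
  by rewrite em e rmorph0 monicE lead_coef0 eq_sym oner_eq0.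
have qm : q %| m by rewrite -dv.
rewrite eq size_map_poly; apply: leq_trans (dvdp_leq m0 qm) _.
rewrite -(size_map_poly (in_alg Qs)) -em size_minPoly ltnS.
have := dim_Fadjoin 1%AS z1; rewrite dimv1 muln1 => <-.
exact: leq_trans (dimvS (subvf _)) dimQ.
Qed.

(** The minimal polynomial divides one of the two factors of q = h * gcd(q, q'),
    and it cannot divide q'. *)
Lemma minCpoly_separable z : separable_poly (minCpoly z).
Proof.
have [q [-> mon] dv] := minCpolyP z; rewrite separable_map.
have qz : root (pQtoC q) z by rewrite dv.
have q1 : (1 < size q)%N.
  by have := size_minCpoly z; have [q' [-> _] dv'] := minCpolyP z;
     rewrite size_map_poly => h; apply: leq_trans h (dvdp_leq (monic_neq0 mon) _); rewrite -dv'.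
have dq0 : q^`() != 0.
  apply/negP => /eqP/(congr1 (fun r : {poly rat} => r`_(size q).-2)).
  rewrite coef_deriv coef0 prednK; last by rewrite -subn1 subn_gt0.
  move/eqP; rewrite mulrn_eq0 -lead_coefE lead_coef_eq0 (negPf (monic_neq0 mon)).
  by rewrite orbF -subn1 subn_eq0 leqNgt q1.
have g0 : gcdp q q^`() != 0 by rewrite gcdp_eq0 negb_and dq0 orbT.
have [h eh] := dvdpP _ _ (dvdp_gcdl q q^`()).
have : root (pQtoC (h * gcdp q q^`())) z by rewrite -eh.
rewrite rmorphM rootM /= => /orP[hz|gz].
  have h0 : h != 0 by apply: contra_neq (monic_neq0 mon) => e; rewrite eh e mul0r.
  have := dvdp_leq h0 (_ : q %| h); rewrite -dv => /(_ hz).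
  rewrite {1}eh size_mul // -(prednK (_ : 0 < size (gcdp q q^`()))%N) ?size_poly_gt0 //.
  rewrite addnS /= => le.
  rewrite separable_poly.unlock /coprimep -(prednK (_ : 0 < size (gcdp q q^`()))%N) ?size_poly_gt0 //.
  by rewrite eqSS -leqn0 -(leq_add2l (size h)) addn0.
have := dvdp_leq dq0 (dvdp_trans (_ : q %| gcdp q q^`()) (dvdp_gcdr _ _)).
by rewrite -dv => /(_ gz); rewrite leqNgt lt_size_deriv // monic_neq0.
Qed.

(** If y is a polynomial in z and its p-th power is rational, then at every
    conjugate of z the polynomial takes the value y up to a p-th root of unity.
    The tuple of these roots of unity determines y up to a rational factor, so
    there are boundedly many classes of such y. *)
Theorem rational_ratio (p d : nat) (s : seq algC) (T : finType) (A : {set T})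
    (y : T -> algC) : prime p ->
  (forall x, x \in s -> exists q : {poly rat},
     [/\ q != 0, (size q <= d.+1)%N & root (pQtoC q) x]) ->
  (forall i, i \in A -> [/\ y i != 0, y i ^+ p \in Crat &
     subfield_gen [set x | x \in s] (y i)]) ->
  (p ^ (d ^ size s) < #|A|)%N ->
  exists i j, [/\ i \in A, j \in A, i != j & y i / y j \in Crat].
Proof.
move=> pr hs hy big; have p0 := prime_gt0 pr.
have [z [szD gen]] := primitive_degree_bound hs.
have [mu [emu mon] dv] := minCpolyP z.
have [rs ers] := closed_field_poly_normal (minCpoly z).
rewrite (monicP (minCpoly_monic z)) scale1r in ers.
have urs : uniq rs by have := minCpoly_separable z; rewrite ers separable_prod_XsubC.
have srs : (size rs <= d ^ size s)%N.
  by move: szD; rewrite ers size_prod_XsubC ltnS.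
have rs0 : (0 < size rs)%N.
  by have := size_minCpoly z; rewrite ers size_prod_XsubC ltnS.
have rsP r (q : {poly rat}) : r \in rs -> root (pQtoC q) z -> (pQtoC q).[r] = 0.
  rewrite -root_prod_XsubC -ers emu dv => rr /dvdpP[h ->].
  by rewrite rmorphM hornerM /= (rootP rr) mulr0.
have genz : divring_closed [pred x in [set w | generated_by (ratr : rat -> algC) z w]].
  apply: (generated_by_divring (q := mu)); first exact: monic_neq0.
  by rewrite dv.
have gy i : i \in A -> generated_by (ratr : rat -> algC) z (y i).
  by move=> /hy[_ _]; apply: subfield_gen_min genz _ _ => x; apply: gen.
have [w prim_w] := C_prim_root_exists p0.
have /choice[q hq] : forall i, exists q : {poly rat}, i \in A -> (pQtoC q).[z] = y i.
  move=> i; have [/gy[q e]|_] := boolP (i \in A); last by exists 0.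
  by exists q.
have qp i r : i \in A -> r \in rs -> (pQtoC (q i)).[r] ^+ p = y i ^+ p.
  move=> iA rr; have [_ /CratP[c ec] _] := hy _ iA.
  have := rsP r (q i ^+ p - c%:P) rr; rewrite rmorphB rmorphXn /= map_polyC /root.
  rewrite !hornerE hq // ec subrr => /(_ (eqxx _))/eqP.
  by rewrite subr_eq0 => /eqP ->.
have /choice[e he] : forall ir : T * 'I_(d ^ size s), exists k : 'I_p,
    ir.1 \in A -> (ir.2 < size rs)%N -> (pQtoC (q ir.1)).[rs`_ir.2] = w ^+ k * y ir.1.
  move=> [i r] /=; have [iA|] := boolP (i \in A); last by exists (Ordinal p0).
  have [rr|] := boolP (r < size rs)%N; last by exists (Ordinal p0).
  have [y0 _ _] := hy _ iA; have := qp _ _ iA (mem_nth 0 rr) => eqp.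
  have [|k ek] := prim_rootP prim_w (x := (pQtoC (q i)).[rs`_r] / y i).
    by rewrite expr_div_n eqp divff // expf_neq0.
  by exists k => _ _; rewrite -ek divfK.
(* the root of unity attached to every conjugate of z *)
pose sig i := [ffun r : 'I_(d ^ size s) => e (i, r)].
have [i [j [iA jA ij eij]]] : exists i j, [/\ i \in A, j \in A, i != j & sig i = sig j].
  apply: contrapT => no; move: big; rewrite ltnNge => /negP; apply.
  have inj : {in A &, injective sig}.
    move=> i j iA jA eij; apply/eqP; apply: contraT => ij.
    by case: no; exists i, j.
  rewrite -(card_in_imset inj); apply: leq_trans (max_card _) _.
  by rewrite card_ffun !card_ord.
exists i, j; split=> //.
have [yi0 _ _] := hy _ iA; have [yj0 _ _] := hy _ jA.
have [_ _ gdiv] := divring_setP genz.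
have [h0 eh0] := gdiv _ _ (gy _ iA) (gy _ jA).
pose h := (h0 %% mu)%R.
have hz : (pQtoC h).[z] = y i / y j.
  rewrite -eh0 [in RHS](divp_eq h0 mu) rmorphD rmorphM hornerD hornerM /=.
  by rewrite -emu (rootP (root_minCpoly z)) mulr0 add0r.
have hr r : r \in rs -> (pQtoC h).[r] = y i / y j.
  move=> rr; have := rsP r (q i - h * q j) rr.
  rewrite rmorphB rmorphM /root !hornerE /= !hq // hz divfK // subrr => /(_ (eqxx _))/eqP.
  have ri : (index r rs < d ^ size s)%N by apply: leq_trans srs; rewrite index_mem.
  have ri' : (index r rs < size rs)%N by rewrite index_mem.
  have := he (i, Ordinal ri) iA ri'; have := he (j, Ordinal ri) jA ri'.
  rewrite /= nth_index // => -> ->.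
  have := congr1 (fun f : {ffun _ -> _} => f (Ordinal ri)) eij; rewrite !ffunE => ->.
  have wk : w ^+ e (j, Ordinal ri) != 0.
    rewrite expf_neq0 //; apply: contra_eq_neq (prim_expr_order prim_w) => ->.
    by rewrite expr0n gtn_eqF // eq_sym oner_eq0.
  rewrite subr_eq0 => /eqP e1; apply: (mulIf (mulf_neq0 wk yj0)).
  by rewrite -e1 mulrCA divfK // mulrC mulrA [y i * _]mulrC.
have e1 : pQtoC h - (y i / y j)%:P = 0.
  apply: (@roots_geq_poly_eq0 _ _ rs) => //.
    by apply/allP => r /hr h1; rewrite /root !hornerE h1 subrr.
  have := ltn_modp h0 mu; rewrite (monic_neq0 mon).
  rewrite -(size_map_poly (ratr : {rmorphism rat -> algC}) mu).
  rewrite /= -emu ers size_prod_XsubC ltnS -/h => sh.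
  rewrite (leq_trans (size_polyD _ _)) // size_polyN geq_max size_map_poly sh.
  by rewrite (leq_trans (size_polyC_leq1 _)).
have -> : y i / y j = ratr h`_0; last exact: Crat_rat.
by rewrite -coef_map; move/subr0_eq: e1 => ->; rewrite coefC.
Qed.

(** * A sieve for products of linear forms *)

Lemma card_residue_class (M d : nat) (S : {set 'I_M}) : (0 < d)%N ->
  (forall m m' : 'I_M, m \in S -> m' \in S -> m = m' %[mod d]) ->
  (#|S| <= M %/ d + 1)%N.
Proof.
move=> d0 hS; pose f (m : 'I_M) : 'I_(M %/ d).+1 := inord (m %/ d).
have inj : {in S &, injective f}.
  move=> m m' mS mS' /(congr1 val); rewrite /= !inordK ?ltnS ?leq_div2r 1?ltnW // => e.
  by apply: val_inj; rewrite /= (divn_eq m d) (divn_eq m' d) e (hS m m').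
rewrite addn1 -(card_in_imset inj) -[X in (_ <= X)%N]card_ord; exact: max_card.
Qed.

Lemma sum_inverse_squares (z T M : nat) : (0 < z)%N ->
  (z * \sum_(z.+1 <= q < T) M %/ q ^ 2 <= M)%N.
Proof.
move=> z0; have [Tz|zT] := leqP T z.+1; first by rewrite big_geq // muln0.
(* telescoping against 1 / q ^ 2 <= 1 / (q - 1) - 1 / q *)
suff h k : (z * (z + k) * \sum_(z.+1 <= q < (z + k).+1) M %/ q ^ 2 <= M * k)%N.
  have := h (T - z.+1)%N; have -> : (z + (T - z.+1)).+1 = T by rewrite -addSn subnKC // ltnW.
  set S := (\sum_(_ <= _ < _) _)%N => hS.
  have : (0 < z + (T - z.+1))%N by rewrite addn_gt0 z0.
  have : (T - z.+1 <= z + (T - z.+1))%N by apply: leq_addl.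
  move: (T - z.+1)%N (z + (T - z.+1))%N hS => a b hS ab b0.
  rewrite -(leq_pmul2r b0) mulnAC; apply: leq_trans hS _.
  by rewrite leq_mul2l ab orbT.
elim: k => [|k IH]; first by rewrite addn0 big_geq // !muln0.
rewrite addnS big_nat_recr /=; last by rewrite ltnS leq_addr.
set S := (\sum_(_ <= _ < _) _)%N in IH *; set a := (M %/ _)%N.
have ha : (a * (z + k).+1 ^ 2 <= M)%N by apply: leq_trunc_div.
have b0 : (0 < z + k)%N by rewrite addn_gt0 z0.
rewrite -(leq_pmul2l b0).
have h1 : ((z + k).+1 * (z * (z + k) * S) <= (z + k).+1 * (M * k))%N by rewrite leq_mul2l IH orbT.
have h2 : (z * ((z + k) * ((z + k).+1 * a)) <= z * M)%N.
  rewrite leq_mul2l; apply/orP; right; apply: leq_trans ha.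
  by rewrite mulnA mulnC leq_mul2l; apply/orP; right; rewrite expnS expn1 leq_mul2r leqnSn orbT.
have := leq_add h1 h2; nia.
Qed.

Lemma prime_ndvd_fact q k : prime q -> (k < q)%N -> ~~ (q %| k`!)%N.
Proof.
move=> pq; elim: k => [|k IH] kq; first by rewrite dvdn1 gtn_eqF // prime_gt1.
by rewrite factS Euclid_dvdM // negb_or gtnNdvd // IH // ltnW.
Qed.

Lemma logn_prod_seq (q : nat) (s : seq nat) (F : nat -> nat) :
  (forall c, c \in s -> (0 < F c)%N) ->
  logn q (\prod_(c <- s) F c) = (\sum_(c <- s) logn q (F c))%N.
Proof.
elim: s => [|c s IH] h; first by rewrite !big_nil logn1.
have hs d : d \in s -> (0 < F d)%N by move=> ds; apply: h; rewrite inE ds orbT.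
rewrite !big_cons lognM ?IH //; first by apply: h; rewrite inE eqxx.
by rewrite big_seq; apply: prodn_cond_gt0.
Qed.

Lemma has_leq_sum (T : Type) (P : pred T) (s : seq T) :
  (has P s <= \sum_(x <- s) P x)%N.
Proof.
elim: s => [|x s IH] //=; rewrite big_cons; case: (P x) => //=.
Qed.

(** For q coprime to A the values divisible by q ^ 2 fill one class modulo q ^ 2,
    that is at most M / q ^ 2 + 1 indices.  Only q < T = M / (4 r) occur, since
    the values are less than T ^ 2; as 4 r <= z, the terms M / q ^ 2 add up to at
    most M / (4 r) for each form, and so do the terms 1. *)
Lemma sieve_count (A z : nat) (cs : seq nat) :
  (0 < A)%N -> (0 < size cs)%N -> (4 * size cs <= z)%N ->
  (forall c, c \in cs -> (0 < c < z)%N) ->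
  (forall q, prime q -> (z < q)%N -> coprime q A) ->
  exists M0, forall M, (M0 <= M)%N -> exists S : {set 'I_M},
    (M <= 2 * #|S|)%N /\
    forall (m : 'I_M) q c, m \in S -> prime q -> (z < q)%N -> c \in cs ->
      ~~ (q ^ 2 %| A * m + c)%N.
Proof.
move=> A0 r0 rz cz cop; set r := size cs in r0 rz *.
exists (4 * r * (8 * r * A + z + 1))%N => M hM.
pose T := (M %/ (4 * r))%N.
have r4 : (0 < 4 * r)%N by rewrite muln_gt0.
have hT : (8 * r * A + z + 1 <= T)%N by rewrite leq_divRL // mulnC.
have hT1 : (T * (4 * r) <= M)%N by apply: leq_trunc_div.
have hT2 : (M < T.+1 * (4 * r))%N by rewrite -ltn_divLR.
have T0 : (0 < T)%N by apply: leq_trans hT; rewrite addn1.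
have large : (A * M + z < T ^ 2)%N.
  rewrite expnS expn1; apply: (@leq_trans ((8 * r * A + z + 1) * T)); last first.
    by rewrite leq_mul2r hT orbT.
  rewrite (mulnDl _ 1%N) (mulnDl _ z) mul1n -addnA -addnS; apply: leq_add; last first.
    by rewrite -[X in (X < _)%N]muln1 -addn1 leq_add ?leq_mul.
  have -> : (8 * r * A * T = A * (2 * T * (4 * r)))%N by ring.
  rewrite leq_mul2l; apply/orP; right; apply: leq_trans (ltnW hT2) _.
  by rewrite leq_mul2r mul2n -addnn -[X in (X < _)%N]addn0 ltn_add2l T0 orbT.
pose qs := [seq q <- index_iota z.+1 T | prime q].
pose bad (m : 'I_M) := has (fun c => has (fun q => q ^ 2 %| A * m + c)%N qs) cs.
pose S := [set m | ~~ bad m]%SET.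
exists S; split; last first.
  move=> m q c; rewrite inE => mS pq zq ccs; apply: contra mS => dv.
  apply/hasP; exists c => //; apply/hasP; exists q => //.
  rewrite mem_filter pq mem_index_iota zq /= ltnNge; apply/negP => Tq.
  have := cz _ ccs => /andP[c0 clt].
  have le := dvdn_leq (_ : 0 < A * m + c)%N dv; rewrite addn_gt0 c0 orbT in le.
  have {}le := le isT; have mM := ltn_ord m.
  have : (T ^ 2 <= q ^ 2)%N by rewrite leq_sqr.
  have mA : (A * m <= A * M)%N by rewrite leq_mul2l (ltnW mM) orbT.
  move/leq_trans/(_ le); rewrite leqNgt => /negP; apply; apply: leq_ltn_trans large.
  by apply: leq_add => //; apply: ltnW.
have cardB : (#|~: S| <= \sum_(c <- cs) \sum_(q <- qs) (M %/ q ^ 2 + 1))%N.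
  rewrite -sum1_card big_mkcond /=.
  apply: (@leq_trans (\sum_(m < M) \sum_(c <- cs) \sum_(q <- qs) (q ^ 2 %| A * m + c))%N).
    apply: leq_sum => m _; rewrite !inE negbK.
    have -> : (if bad m then 1 else 0)%N = bad m by case: (bad m).
    apply: leq_trans (has_leq_sum _ _) _; apply: leq_sum => c _; exact: has_leq_sum.
  rewrite exchange_big /= big_seq [X in (_ <= X)%N]big_seq; apply: leq_sum => c ccs.
  rewrite exchange_big /= big_seq [X in (_ <= X)%N]big_seq; apply: leq_sum => q.
  rewrite mem_filter mem_index_iota => /andP[pq /andP[zq _]].
  have q0 : (0 < q ^ 2)%N by rewrite expn_gt0 prime_gt0.
  pose C := [set m : 'I_M | (q ^ 2 %| A * m + c)%N]%SET.
  have -> : (\sum_(m < M) (q ^ 2 %| A * m + c) = #|C|)%N.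
    rewrite -sum1_card [RHS]big_mkcond /=; apply: eq_bigr => m _; rewrite inE.
    by case: (_ %| _)%N.
  apply: card_residue_class => // m m'; rewrite !inE => d1 d2; apply/eqP.
  have cq : coprime (q ^ 2) A by rewrite coprimeXl // cop.
  wlog le : m m' d1 d2 / (m' <= m)%N.
    by move=> W; case/orP: (leq_total m' m) => /W; [apply | rewrite eq_sym; apply].
  rewrite eqn_mod_dvd // -(Gauss_dvdr _ cq) mulnBr.
  have -> : (A * m - A * m' = (A * m + c) - (A * m' + c))%N by rewrite subnDr.
  exact: dvdn_sub.
have sumqs : (\sum_(q <- qs) (M %/ q ^ 2 + 1) <= \sum_(z.+1 <= q < T) M %/ q ^ 2 + T)%N.
  rewrite big_filter big_mkcond /=.
  apply: (@leq_trans (\sum_(z.+1 <= q < T) (M %/ q ^ 2 + 1))%N).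
    by apply: leq_sum => q _; case: ifP.
  rewrite big_split /= leq_add2l sum_nat_const_nat muln1; exact: leq_subr.
have hz : (0 < z)%N by apply: leq_trans rz; rewrite muln_gt0.
have sq := sum_inverse_squares T M hz.
set Sg := (\sum_(_ <= _ < _) _)%N in sq sumqs.
have cardB' : (#|~: S| <= r * (Sg + T))%N.
  apply: (leq_trans cardB); rewrite big_const_seq count_predT iter_addn_0 mulnC.
  by rewrite leq_mul2l sumqs orbT.
have := cardsC S; rewrite card_ord => eM.
have h1 : (4 * (r * Sg) <= M)%N.
  by apply: leq_trans sq; rewrite mulnA leq_mul2r rz orbT.
have h2 : (4 * (r * T) <= M)%N by rewrite mulnA mulnC.
rewrite mulnDr in cardB'.
move: (r * Sg)%N (r * T)%N (#|S|) (#|~: S|) h1 h2 cardB' eM => u1 u2 u3 u4.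
clear; lia.
Qed.

(** Up to the primes at most z, which are made to contribute the same power for
    all the values by the choice of the progression, the product of the distinct
    linear forms is squarefree; hence its class modulo p-th powers determines it. *)
Theorem sieve (p b : nat) (cs : seq nat) : prime p -> (0 < b)%N -> (0 < size cs)%N ->
  (forall c, c \in cs -> (0 < c)%N) -> (forall c, (count_mem c cs < p)%N) ->
  exists Q M0, (0 < Q)%N /\ forall M, (M0 <= M)%N -> exists S : {set 'I_M},
    (M <= 2 * #|S|)%N /\
    forall (m m' : 'I_M) v w, m \in S -> m' \in S -> (0 < v)%N -> (0 < w)%N ->
      (\prod_(c <- cs) (b * (Q * m) + c) * v ^ p =
       \prod_(c <- cs) (b * (Q * m') + c) * w ^ p)%N -> m = m'.
Proof.
move=> pr b0 cs0 cpos cnt.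
pose us := undup cs; pose H := (\prod_(c <- us) c)%N.
pose z := (4 * size us + \sum_(c <- us) c + b).+1%N.
have [z1 z2 z3] : [/\ 4 * size us <= z, \sum_(c <- us) c < z & b < z]%N.
  by rewrite /z !ltnS; split; lia.
pose Q := (H * z`!)%N; pose A := (b * Q)%N.
have us0 : (0 < size us)%N.
  by rewrite lt0n size_eq0 /us; apply: contraTneq cs0 => /undup_nil ->.
have upos c : c \in us -> (0 < c)%N by rewrite mem_undup; apply: cpos.
have H0 : (0 < H)%N by rewrite /H big_seq; apply: prodn_cond_gt0 => c /upos.
have Q0 : (0 < Q)%N by rewrite muln_gt0 H0 fact_gt0.
have A0 : (0 < A)%N by rewrite muln_gt0 b0.
have cz c : c \in us -> (0 < c < z)%N.
  move=> cu; rewrite upos //=; apply: leq_ltn_trans z2.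
  by rewrite (big_rem c) //= leq_addr.
have cop q : prime q -> (z < q)%N -> coprime q A.
  move=> pq zq; rewrite prime_coprime // /A /Q Euclid_dvdM // Euclid_dvdM // !negb_or.
  apply/and3P; split.
  - by rewrite gtnNdvd // (ltn_trans z3).
  - rewrite /H big_seq; apply: (big_ind (fun k => ~~ (q %| k)%N)).
    + by rewrite dvdn1 gtn_eqF // prime_gt1.
    + by move=> k l hk hl; rewrite Euclid_dvdM // negb_or hk.
    + by move=> c /cz/andP[c0 c1]; rewrite gtnNdvd // (ltn_trans c1).
  - exact: prime_ndvd_fact.
have [M0 hM0] := sieve_count A0 us0 z1 cz cop.
exists Q, M0; split=> // M /hM0[S [cS hS]]; exists S; split=> // m m' v w mS mS' v0 w0.
move=> e; pose L c (k : nat) := (A * k + c)%N.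
have Lpos c k : c \in cs -> (0 < L c k)%N by move=> /cpos c0; rewrite addn_gt0 c0 orbT.
pose g (k : nat) := (\prod_(c <- cs) L c k)%N; pose h (k : nat) := (\prod_(c <- us) L c k)%N.
have usP c : (c \in us) = (c \in cs) by rewrite mem_undup.
have gpos k : (0 < g k)%N by rewrite /g big_seq; apply: prodn_cond_gt0 => c; apply: Lpos.
have hpos k : (0 < h k)%N.
  by rewrite /h big_seq; apply: prodn_cond_gt0 => c; rewrite usP; apply: Lpos.
(* A k + c = c (1 + multiple of z!), so the small primes only see c *)
have small q k : prime q -> (q <= z)%N -> logn q (h k) = (\sum_(c <- us) logn q c)%N.
  move=> pq qz; rewrite /h logn_prod_seq; last by move=> c; rewrite usP; apply: Lpos.
  rewrite [LHS]big_seq [RHS]big_seq; apply: eq_bigr => c cu.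
  have -> : L c k = (((b * (\prod_(d <- rem c us) d) * k) * z`! + 1) * c)%N.
    by rewrite /L /A /Q /H (big_rem c) //=; ring.
  rewrite logn_Gauss // prime_coprime //.
  have qz' : (q %| z`!)%N by rewrite dvdn_fact // prime_gt0.
  by rewrite (dvdn_addr _ (dvdn_mull _ qz')) dvdn1 gtn_eqF // prime_gt1.
(* a large prime divides at most one of the forms, and at most once, so that
   its exponent in g is 0 or one of the multiplicities *)
have large q (k : 'I_M) : k \in S -> prime q -> (z < q)%N ->
    logn q (h k) = ~~ (p %| logn q (g k))%N.
  move=> kS pq zq; rewrite /h /g !logn_prod_seq; last first.
  - by move=> c; apply: Lpos.
  - by move=> c; rewrite usP; apply: Lpos.
  have [/hasP[c0 c0u dv]|/hasPn none] := boolP (has (fun c => q %| L c k)%N us); last first.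
    rewrite big_seq big1 => [|c /none nd]; last by rewrite lognE (negPf nd) !andbF.
    rewrite big_seq big1 ?dvdn0 // => c; rewrite -usP => /none nd.
    by rewrite lognE (negPf nd) !andbF.
  have one c : c \in us -> logn q (L c k) = (c == c0).
    move=> cu; have [->|cc0] := eqVneq c c0.
      apply/eqP; rewrite eqn_leq -pfactor_dvdn ?Lpos -?usP // expn1 dv andbT.
      have := hS _ _ _ kS pq zq c0u.
      by rewrite (pfactor_dvdn 2 pq) ?Lpos -?usP // -ltnNge.
    rewrite lognE; case: (boolP (q %| L c k)%N) => [dc|]; last by rewrite !andbF.
    case/eqP: cc0; have ltq d : d \in us -> (d < q)%N.
      by move=> /cz/andP[_ /ltn_trans]; apply.
    rewrite -(modn_small (ltq _ cu)) -(modn_small (ltq _ c0u)); apply/eqP.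
    by rewrite -(eqn_modDl (A * k)) (eqP dc) (eqP dv).
  have -> : (\sum_(c <- us) logn q (L c k) = 1)%N.
    rewrite (big_rem c0) //= one // eqxx big_seq big1 ?addn0 // => c.
    rewrite mem_rem_uniq ?undup_uniq // inE => /andP[cc0 cu].
    by rewrite one // (negPf cc0).
  have -> : (\sum_(c <- cs) logn q (L c k) = count_mem c0 cs)%N.
    rewrite -sum1_count [RHS]big_mkcond [LHS]big_seq [RHS]big_seq; apply: eq_bigr => c.
    by rewrite -usP => /one ->; rewrite /=; case: eqP.
  by rewrite gtnNdvd // -has_count has_pred1 -usP.
have eg k : (\prod_(c <- cs) (b * (Q * k) + c) = g k)%N.
  by apply: eq_bigr => c _; rewrite /L /A mulnA.
rewrite !eg in e.
have pdv q : (p %| logn q (g m) = (p %| logn q (g m')))%N.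
  have := congr1 (logn q) e; rewrite !lognM ?expn_gt0 ?v0 ?w0 // !lognX => eq.
  rewrite -(dvdn_addl _ (dvdn_mulr (logn q v) (dvdnn p))) eq.
  by rewrite dvdn_addl // dvdn_mulr.
have eh : h m = h m'.
  apply: eqn_from_log => // q; have [pq|npq] := boolP (prime q); last first.
    by rewrite /logn (negPf npq).
  by have [qz|zq] := leqP q z; [rewrite !small | rewrite !large // pdv].
have mono (k k' : nat) : (k < k')%N -> (h k < h k')%N.
  move=> kk; have Lk c : (L c k < L c k')%N by rewrite ltn_add2r ltn_pmul2l.
  have [c [us' eus]] : exists c us', us = c :: us'.
    by move: us0; case: (us) => // c us' _; exists c, us'.
  move: (hpos k'); rewrite /h eus !big_cons muln_gt0 => /andP[_ h0].
  apply: (@leq_ltn_trans (L c k * \prod_(d <- us') L d k')%N); last by rewrite ltn_pmul2r.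
  by rewrite leq_mul2l; apply/orP; right; apply: leq_prod => d _; apply: ltnW.
by apply: val_inj; case: (ltngtP m m') => // /mono; rewrite eh ltnn.
Qed.

(** * Specialization at the points above the integers *)

Lemma eventually_nonroot (c : {poly algC}) : c != 0 ->
  exists N, forall k, (N <= k)%N -> c.[k%:R] != 0.
Proof.
move=> c0; have [rs e] := closed_field_poly_normal c.
have [N hN] : exists N, forall k, (N <= k)%N -> k%:R \notin rs.
  elim: (rs) => [|a l [N hN]]; first by exists 0%N.
  have [[m em]|no] := pselect (exists m : nat, a = m%:R).
    exists (maxn N m.+1) => k; rewrite geq_max => /andP[/hN kl mk].
    by rewrite inE negb_or kl andbT em eqr_nat gtn_eqF.
  exists N => k /hN kl; rewrite inE negb_or kl andbT.
  by apply/eqP => ea; apply: no; exists k.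
exists N => k /hN; apply: contra => /eqP ck.
by rewrite -root_prod_XsubC -(rootZ _ _ (_ : lead_coef c != 0)) ?lead_coef_eq0 // -e; apply/eqP.
Qed.

Lemma meval_subfield n (M : set algC) (F : {mpoly algC[n]}) (x : 'I_n -> algC) :
  divring_closed [pred a in M] -> (forall m, m \in msupp F -> M F@_m) ->
  (forall i, M (x i)) -> M F.@[x].
Proof.
move=> dM MF Mx; rewrite mevalE big_seq.
have [M1 MB _] := divring_setP dM.
have M0 : M 0 by rewrite -(subrr 1); apply: (MB).
have MX a k : M a -> M (a ^+ k).
  by move=> Ma; elim: k => [|k IH] //; rewrite exprS; apply: (divringM dM).
apply: (big_ind M) => //.
  by move=> a b Ma Mb; rewrite -[b]opprK; apply: (MB) => //; rewrite -sub0r; apply: (MB).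
move=> m mF; apply: (divringM dM); first exact: MF.
by apply: (big_ind M) => // [a b|i _]; [apply: (divringM dM) | apply: MX].
Qed.

Lemma field_of_definition_chart n (x : coordinates n) j : x j != 0 ->
  field_of_definition x `<=` subfield_gen [set a | a \in [seq x i / x j | i <- enum 'I_n.+1]].
Proof.
move=> xj; set S := [set a | _]; have dM := subfield_gen_divring S.
have gen i : subfield_gen S (x i / x j).
  by apply: sub_subfield_gen; rewrite /S /=; apply/mapP; exists i; rewrite ?mem_enum.
apply: (subfield_gen_min dM) => _ [i [k [xk ->]]].
have [_ _ Mdiv] := divring_setP dM.
by rewrite -[X in subfield_gen _ X](_ : (x i / x j) / (x k / x j) = _);
  [apply: Mdiv | field; rewrite xj xk].
Qed.

Lemma restr_coord_exists (X : curve) x : curve_points X x ->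
  exists j, x j != 0 /\ restr X 'X_j != 0.
Proof.
move=> Xx; have [[j xj] _] := Xx; exists j; split=> //.
by apply: (restr_neq0 Xx); rewrite mevalXU.
Qed.

Section Specialization.
Variables (X : curve) (t : function_field X).
Local Notation n := (ambient_dim X).
Local Notation K := (function_field X).
Local Notation cst := (constant_function X).
Hypothesis t_over_Q : rational_function_field X t.
Hypothesis t_nonconst : forall a, t <> cst a.
Hypothesis alg : forall f, exists P, algebraic_rel cst t P f.
Variable P : nat -> coordinates n.
Hypothesis PX : forall k, curve_points X (P k).
Hypothesis tP : forall k, has_value t (P k) k%:R.

(** The constant term of an algebraic relation vanishes wherever f does. *)
Lemma eventually_nonvanishing (f : K) : f != 0 ->
  exists N, forall k, (N <= k)%N -> ~ has_value f (P k) 0.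
Proof.
move=> f0; have [R0 /(relation_nonzero_constant f0)[R [c0 rR]]] := alg f.
have [N hN] := eventually_nonroot c0; exists N => k /hN /eqP ck fk; apply: ck.
have := relation_value (PX k) rR (tP k) fk.
by rewrite horner_coef0 coef_map.
Qed.

(** If X_j vanishes at P k while X_i does not, then the function X_j / X_i vanishes
    at P k; for each of the finitely many i this is excluded eventually. *)
Lemma eventually_in_chart : exists j N, restr X 'X_j != 0 /\
  forall k, (N <= k)%N -> P k j != 0.
Proof.
have [j [_ j0]] := restr_coord_exists (PX 0%N).
have /choice[N hN] : forall i : 'I_n.+1, exists N, restr X 'X_i != 0 ->
    forall k, (N <= k)%N -> ~ has_value (coord_fun i j) (P k) 0.
  move=> i; have [i0|_] := boolP (restr X 'X_i != 0); last by exists 0%N.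
  have [|N hN] := @eventually_nonvanishing (coord_fun i j); last by exists N.
  rewrite -(fmorph_eq0 (rfun X)) rfun_subK /fraction_of.
  by rewrite mulf_neq0 ?invr_neq0.
exists j, (\max_i N i)%N; split=> // k hk; apply/eqP => Pkj.
have [i [Pi i0]] := restr_coord_exists (PX k).
apply: (hN i i0 k); first exact: leq_trans (leq_bigmax i) hk.
by have := has_value_coord j Pi; rewrite Pkj mul0r.
Qed.

Lemma rational_coord i j : rational_function_field X (coord_fun j i).
Proof.
have vX l : to_algC 'X_l = 'X_l :> {mpoly algC[n.+1]} by rewrite /to_algC map_mpolyX.
exists 1%N, 'X_i, 'X_j; split; try exact: dhomog_var.
by rewrite rfun_subK !vX.
Qed.

(** The coordinate functions satisfy relations with rational coefficients, so
    the coordinates of the points are algebraic of bounded degree. *)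
Lemma coordinate_degree_bound i j : exists d N, forall k, (N <= k)%N -> P k j != 0 ->
  exists q : {poly rat}, [/\ q != 0, (size q <= d)%N & root (pQtoC q) (P k i / P k j)].
Proof.
have [R rR] := alg (coord_fun j i).
have [Q [_ rQ]] := rational_algebraic_rel t_over_Q (rational_coord i j) rR.
have [Q0 _] := rQ; have l0 : lead_coef (map_poly pQtoC Q) != 0 by rewrite lead_coef_eq0.
have [N hN] := eventually_nonroot l0; exists (size Q), N => k kN Pj.
have e : pQtoC (map_poly (horner_eval k%:R) Q) =
    map_poly (horner_eval (k%:R : algC)) (map_poly pQtoC Q).
  apply/polyP => l; rewrite !coef_map /= /horner_eval.
  by rewrite -horner_map rmorph_nat.
exists (map_poly (horner_eval k%:R) Q); split; last 2 first.
- exact: size_poly.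
- by rewrite e; apply/eqP; apply: (relation_value (PX k) rQ (tP k)); apply: has_value_coord.
rewrite -(map_poly_eq0 (ratr : {rmorphism rat -> algC})) /= e.
apply/eqP => /(congr1 (fun r : {poly algC} => r`_(size (map_poly pQtoC Q)).-1)).
by rewrite coef_map coef0 -lead_coefE; apply/eqP/hN.
Qed.

(** Here y is written as a quotient of polynomials in the affine coordinates, and
    s0 consists of the coefficients of these polynomials. *)
Theorem specialization p (y : K) g : y ^+ p = poly_val cst t g ->
  exists (d N r : nat) (s0 : seq algC), forall k, (N <= k)%N ->
  exists (v : algC) (l : seq algC),
    [/\ v ^+ p = g.[k%:R], size l = r,
        forall x, x \in s0 ++ l -> exists q : {poly rat},
          [/\ q != 0, (size q <= d.+1)%N & root (pQtoC q) x],
        field_of_definition (P k) `<=` subfield_gen [set x | x \in l] &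
        forall M : set algC, divring_closed [pred x in M] ->
          (forall x, x \in s0 -> M x) -> field_of_definition (P k) `<=` M -> M v].
Proof.
move=> ey; have [j [N1 [j0 hN1]]] := eventually_in_chart.
have [A [B [B0 eyAB]]] := dehom_ratio y j0.
have [N2 hN2] := eventually_nonvanishing B0.
have /choice[d_ /choice[N_ hd]] := fun i => coordinate_degree_bound i j.
pose s0 : seq algC := [seq A@_m | m <- msupp A] ++ [seq B@_m | m <- msupp B].
pose d := maxn (\max_i d_ i)%N (\max_(x <- s0) size (minCpoly x))%N.
exists d, (maxn (maxn N1 N2) (\max_i N_ i))%N, n.+1, s0 => k.
rewrite !geq_max => /andP[/andP[/hN1 Pj /hN2 Bk] /bigmax_leqP kN].
pose z i := P k i / P k j.
have vA := has_value_dehom A (PX k) Pj; have vB := has_value_dehom B (PX k) Pj.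
have Bz : B.@[z] != 0 by apply/eqP => Bz; apply: Bk; rewrite -[0]Bz.
have vy : has_value y (P k) (A.@[z] / B.@[z]) by rewrite eyAB; apply: has_value_div.
exists (A.@[z] / B.@[z]), [seq z i | i <- enum 'I_n.+1]; split.
- apply: (has_value_uniq (PX k) (has_valueX p vy)); rewrite ey.
  exact: has_value_horner (PX k) (tP k).
- by rewrite size_map size_enum_ord.
- move=> x; rewrite mem_cat => /orP[xs|/mapP[i _ ->]].
    have [q [eq mon dv]] := minCpolyP x; exists q; split; first exact: monic_neq0.
      rewrite -(size_map_poly (ratr : {rmorphism rat -> algC})) /= -eq leqW // leq_max.
      by rewrite (leq_bigmax_seq _ xs) // orbT.
    by rewrite dv.
  have [q [q0 sq qz]] := hd i k (kN i isT) Pj; exists q; split=> //.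
  by rewrite leqW // (leq_trans sq) // leq_max (leq_bigmax i).
- exact: field_of_definition_chart.
- move=> M dM Ms0 MP.
  have Mz i : M (z i) by apply: (MP); apply: sub_subfield_gen; exists i, j.
  have [_ _ Mdiv] := divring_setP dM.
  apply: Mdiv; apply: meval_subfield dM _ Mz => m mF; apply: Ms0; rewrite mem_cat.
    by apply/orP; left; apply/mapP; exists m.
  by apply/orP; right; apply/mapP; exists m.
Qed.

End Specialization.

(** * Counting the fields *)

Lemma common_denominator (rs : seq algC) : (forall a, a \in rs -> a \in Crat) ->
  exists (b : nat) (us : seq int), (0 < b)%N /\ rs = [seq u%:~R / b%:R | u <- us].
Proof.
elim: rs => [|a rs IH] h; first by exists 1%N, [::].
have [|b [us [b0 ->]]] := IH; first by move=> x xs; apply: h; rewrite inE xs orbT.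
have [|q ->] := CratP _ (h a _); first by rewrite inE eqxx.
have dq : denq q = `|denq q|%N :> int by rewrite gez0_abs // ltW // denq_gt0.
have d0 : (0 < `|denq q|)%N by rewrite absz_gt0 denq_neq0.
exists (b * `|denq q|)%N, (numq q * b%:Z :: [seq u * denq q | u <- us]).
have bn : b%:R != 0 :> algC by rewrite pnatr_eq0 -lt0n.
have dn : (`|denq q|%N)%:R != 0 :> algC by rewrite pnatr_eq0 -lt0n.
split; first by rewrite muln_gt0 b0.
rewrite /= /ratr {1}dq -map_comp natrM; congr (_ :: _).
  by rewrite intrM -!pmulrn; field; rewrite bn dn.
apply: eq_map => u /=; rewrite intrM {1}dq -pmulrn.
by field; rewrite bn dn.
Qed.

(** A maximal set of points with distinct values of f meets every class. *)
Lemma many_representatives (T : finType) (U : Type) (f : T -> U) (S : {set T}) C :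
  (forall A : {set T}, A \subset S -> {in A &, forall x y, f x = f y} -> (#|A| <= C)%N) ->
  exists J : {set T}, [/\ J \subset S, {in J &, injective f} & (#|S| <= C * #|J|)%N].
Proof.
move=> hC; pose r x y := `[< f x = f y >].
pose ok (J : {set T}) := (J \subset S) && [forall x in J, forall y in J, r x y ==> (x == y)].
have ok0 : ok finset.set0.
  by rewrite /ok finset.sub0set; apply/forall_inP => x; rewrite inE.
case: (arg_maxnP (fun J : {set T} => #|J|) ok0) => J /andP[JS Jinj] Jmax.
exists J; split=> //.
  move=> x y xJ yJ e; apply/eqP.
  by move/forall_inP/(_ _ xJ)/forall_inP/(_ _ yJ)/implyP: Jinj; apply; apply/asboolP.
have cover x : x \in S -> exists2 y, y \in J & r x y.
  move=> xS; apply: contrapT => no.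
  have xJ : x \notin J by apply/negP => xJ; apply: no; exists x => //; apply/asboolP.
  have : ok (x |: J)%SET.
    rewrite /ok finset.subUset finset.sub1set xS JS; apply/forall_inP => a; rewrite !inE => /orP aJ.
    apply/forall_inP => b; rewrite !inE => /orP bJ; apply/implyP => /asboolP e.
    case: aJ bJ => [/eqP ea|aJ] [/eqP eb|bJ]; rewrite ?ea ?eb ?eqxx //.
    - by case: no; exists b => //; apply/asboolP; rewrite -ea.
    - by case: no; exists a => //; apply/asboolP; rewrite -eb.
    - move/forall_inP/(_ _ aJ)/forall_inP/(_ _ bJ)/implyP: Jinj; apply; exact/asboolP.
  by move/Jmax; rewrite cardsU1 xJ /= add1n ltnn.
have -> : (C * #|J| = \sum_(y in J) C)%N by rewrite sum_nat_const mulnC.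
apply: (@leq_trans (\sum_(y in J) #|[set x in S | r x y]%SET|)%N); last first.
  apply: leq_sum => y yJ; apply: hC; first by apply/fintype.subsetP => x; rewrite inE => /andP[].
  move=> a b; rewrite !inE => /andP[_ /asboolP ->] /andP[_ /asboolP ->]; by [].
have -> : (\sum_(y in J) #|[set x in S | r x y]%SET| =
    \sum_(y in J) \sum_(x in S) r x y)%N.
  apply: eq_bigr => y _; rewrite -sum1_card [LHS]big_mkcond [RHS]big_mkcond /=.
  by apply: eq_bigr => x _; rewrite !inE; case: (x \in S) => //=; case: (r x y).
rewrite exchange_big /= -sum1_card; apply: leq_sum => x /cover[y yJ rxy].
by rewrite (bigD1 y) //= rxy.
Qed.

(** Combines the Kummer generator with the rationality of the critical values: the
    roots rs of g are critical, and there is at least one, since otherwise y would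
    be a root of unity. *)
Lemma kummer_model (X : curve) (t : function_field X) :
  rational_function_field X t ->
  (forall a, t <> constant_function X a) ->
  rational_function_field X <> subfield_gen [set t] ->
  (forall a, critical_value t (Some a) -> a \in Crat) ->
  abelian_extension (subfield_gen (range (constant_function X) `|` [set t])) ->
  (forall f, exists P, algebraic_rel (constant_function X) t P f) ->
  exists (p : nat) (y : function_field X) (rs : seq algC),
    [/\ prime p, y ^+ p = poly_val (constant_function X) t (\prod_(a <- rs) ('X - a%:P)),
        (0 < size rs)%N, (forall a, a \in rs -> a \in Crat) &
        forall a, (count_mem a rs < p)%N].
Proof.
move=> tQ tn ne crit abel alg; set cst := constant_function X in abel *.
rewrite subfield_gen_ratfuns // in abel.
have dE := ratfuns_divring cst t.
have [K [iota eK]] := subfield_type dE.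
rewrite -eK in abel.
have cstE a : range iota (cst a).
  by rewrite eK; exists a%:P, 1; rewrite rmorph1 divr1 poly_valC.
have [x0 Xx0] : exists x, curve_points X x by have [[x0 Xx0] _] := curve_irreducible X; exists x0.
have [j [_ j0]] := restr_coord_exists Xx0.
pose gens := [seq coord_fun j i | i <- enum 'I_(ambient_dim X).+1].
have gen : subfield_gen (range iota `|` [set x | x \in gens]) = setT.
  apply/seteqP; split=> // f _; have [A [B [_ ->]]] := dehom_ratio f j0.
  set G := subfield_gen _; have dG := subfield_gen_divring (range iota `|` [set x | x \in gens]).
  have Gdehom C : G (dehom j C).
    rewrite /dehom /mmap; apply: (divring_sum _ dG) => m; apply: (divringM dG).
      by apply: sub_subfield_gen; left.
    have G1 : G 1 by have [] := divring_setP dG.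
    apply: (big_ind G) => // [a b|i _]; first exact: (divringM dG).
    elim: (m i) => [|k IH] //; rewrite exprS; apply: (divringM dG) => //.
    by apply: sub_subfield_gen; right; apply/mapP; exists i; rewrite ?mem_enum.
  by have [_ _ Gdiv] := divring_setP dG; apply: Gdiv; apply: Gdehom.
have [f fE] := nonratfun_exists tQ tn ne.
have [|p [y [pr yE yp]]] := abelian_prime_root abel cstE gen; first by exists f; rewrite eK.
rewrite eK in yE yp.
have [z [g [zE gmon ez gmult]]] := kummer_polynomial tn pr yE yp.
have g0 := monic_neq0 gmon.
have [rs ers] := closed_field_poly_normal g; rewrite (monicP gmon) scale1r in ers.
exists p, z, rs; split=> //.
- by rewrite ez -ers.
- rewrite lt0n size_eq0; apply/eqP => rs0; apply: zE.
  have : z ^+ p - 1 = 0 by rewrite ez ers rs0 big_nil rmorph1 subrr.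
  have [us eus] := closed_field_poly_normal ('X^p - 1 : {poly algC}).
  rewrite lead_coefXnsubC ?prime_gt0 // scale1r in eus.
  have -> : z ^+ p - 1 = \prod_(u <- us) (z - cst u).
    have := congr1 (fun q : {poly algC} => (map_poly cst q).[z]) eus.
    rewrite rmorphB rmorph1 /= map_polyXn !hornerE => ->.
    rewrite rmorph_prod horner_prod; apply: eq_bigr => u _.
    by rewrite /= map_polyXsubC hornerXsubC.
  move/eqP; rewrite prodf_seq_eq0 => /hasP[u _ /=]; rewrite subr_eq0 => /eqP ->.
  by exists u%:P, 1; rewrite rmorph1 divr1 poly_valC.
- move=> a ars; apply: crit; apply: root_critical_value tn alg pr ez g0 _ (gmult a).
  by rewrite ers root_prod_XsubC.
- move=> a; rewrite ltnNge; apply/negP => pa; case/negP: (gmult a).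
  apply: dvdp_trans (dvdp_exp2l ('X - a%:P) pa) _.
  rewrite ers (bigID (pred1 a)) /= dvdp_mulr //.
  rewrite (eq_bigr (fun=> 'X - a%:P)) => [|u /eqP -> //].
  by rewrite big_const_seq iter_mulr_1.
Qed.

(** Points above n0 + Q m whose fields coincide are few: the Kummer radicals lie
    in one number field of bounded degree, so two of them have a rational ratio
    as soon as there are many, and the sieve excludes this. *)
Lemma bounded_fibers (X : curve) (t : function_field X) p (y : function_field X)
    (rs : seq algC) (P : nat -> coordinates (ambient_dim X)) :
  rational_function_field X t ->
  (forall f, exists R, algebraic_rel (constant_function X) t R f) ->
  (forall k, curve_points X (P k)) -> (forall k, has_value t (P k) k%:R) ->
  prime p -> y ^+ p = poly_val (constant_function X) t (\prod_(a <- rs) ('X - a%:P)) ->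
  (0 < size rs)%N -> (forall a, a \in rs -> a \in Crat) ->
  (forall a, (count_mem a rs < p)%N) ->
  exists (n0 Q M0 C : nat), [/\ (0 < n0)%N, (0 < Q)%N, (0 < C)%N &
    forall M, (M0 <= M)%N -> exists S : {set 'I_M}, (M <= 2 * #|S|)%N /\
      forall A : {set 'I_M}, A \subset S ->
        {in A &, forall m m' : 'I_M, field_of_definition (P (n0 + Q * m)%N) =
                                     field_of_definition (P (n0 + Q * m')%N)} ->
        (#|A| <= C)%N].
Proof.
move=> tQ alg PX tP pr ey rs0 rsQ rsp.
have [d [N1 [r [s0 spec]]]] := specialization tQ alg PX tP ey.
have [b [us [b0 ers]]] := common_denominator rsQ.
have bn : b%:R != 0 :> algC by rewrite pnatr_eq0 -lt0n.
have [n0 [N1n0 n00 cpos]] : exists n0 : nat, [/\ (N1 <= n0)%N, (0 < n0)%N &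
    forall u, u \in us -> 0 < b%:Z * n0%:Z - u].
  exists (N1 + \sum_(u <- us) `|u| + 1)%N; split; rewrite ?addn1 // -?addnS ?leq_addr //.
  move=> u uus; rewrite subr_gt0; apply: (@Order.POrderTheory.le_lt_trans _ _ `|u|%N%:Z).
    by rewrite abszE ler_norm.
  rewrite -PoszM ltz_nat; apply: leq_trans (leq_pmull _ b0).
  by rewrite (big_rem u) //= addnS ltnS addnCA leq_addr.
pose c (u : int) := absz (b%:Z * n0%:Z - u)%R.
have ec u : u \in us -> (c u)%:Z = b%:Z * n0%:Z - u.
  by move=> /cpos h; rewrite /c gez0_abs // Order.POrderTheory.ltW.
(* b n - u = b (Q m) + c u for n = n0 + Q m *)
pose cs := map c us.
have [|||Q [M0 [Q0 hM0]]] := @sieve p b cs pr b0.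
- by rewrite size_map -(size_map (fun u : int => u%:~R / b%:R : algC)) -ers.
- by move=> _ /mapP[u uus ->]; rewrite /c absz_gt0 Order.POrderTheory.gt_eqF // cpos.
- move=> k; apply: (@leq_ltn_trans (count_mem (b%:Z * n0%:Z - k%:Z) us)).
    rewrite count_map (eq_in_count (a2 := pred1 (b%:Z * n0%:Z - k%:Z))) //.
    move=> u uus /=; rewrite -eqz_nat ec // subr_eq [RHS]eq_sym subr_eq.
    by rewrite [k%:Z + u]addrC.
  apply: leq_ltn_trans (rsp ((b%:Z * n0%:Z - k%:Z)%:~R / b%:R)).
  rewrite ers count_map; apply: sub_count => u /= /eqP ->; exact: eqxx.
pose D := (d ^ (size s0 + r))%N.
exists n0, Q, M0, (p ^ D)%N; split=> //.
  by rewrite expn_gt0 prime_gt0.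
move=> M /hM0[S [cS hS]]; exists S; split=> // A AS same.
rewrite leqNgt; apply/negP => big.
pose G (m : nat) := (\prod_(k <- cs) (b * (Q * m) + k))%N.
have Gpos m : (0 < G m)%N.
  rewrite /G big_seq; apply: prodn_cond_gt0 => k /mapP[u uus ->].
  by rewrite addn_gt0 /c absz_gt0 Order.POrderTheory.gt_eqF ?orbT // cpos.
have eG m : (\prod_(a <- rs) ('X - a%:P)).[(n0 + Q * m)%:R] = (G m)%:R / b%:R ^+ size us.
  rewrite ers big_map horner_prod /G natr_prod /cs big_map.
  rewrite -(count_predT us) -[b%:R ^+ _]iter_mulr_1 -big_const_seq -prodfV -big_split /=.
  rewrite big_seq [RHS]big_seq; apply: eq_bigr => u uus.
  have -> : (b * (Q * m) + c u)%:R = b%:R * (n0 + Q * m)%:R - u%:~R :> algC.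
    rewrite !natrD !natrM (pmulrn _ (c u)) ec // intrB intrM -!pmulrn; ring.
  by rewrite hornerXsubC; field.
have /choice[v hv] : forall m : 'I_M, exists v : algC, exists l : seq algC,
    [/\ v ^+ p = (G m)%:R / b%:R ^+ size us, size l = r,
        forall x, x \in s0 ++ l -> exists q : {poly rat},
          [/\ q != 0, (size q <= d.+1)%N & root (pQtoC q) x],
        field_of_definition (P (n0 + Q * m)%N) `<=` subfield_gen [set x | x \in l] &
        forall M : set algC, divring_closed [pred x in M] ->
          (forall x, x \in s0 -> M x) ->
          field_of_definition (P (n0 + Q * m)%N) `<=` M -> M v].
  move=> m; have [|v [l [h1 h2 h3 h4 h5]]] := spec (n0 + Q * m)%N.
    exact: leq_trans N1n0 (leq_addr _ _).
  by exists v, l; split; rewrite // h1 eG.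
have Gn m : (G m)%:R != 0 :> algC by rewrite pnatr_eq0 -lt0n.
have v0 m : v m != 0.
  have [l [e _ _ _ _]] := hv m; apply: contra_eq_neq e => ->.
  by rewrite expr0n gtn_eqF ?prime_gt0 // eq_sym mulf_neq0 ?invr_neq0 ?expf_neq0.
have [m1 m1A] : exists m, m \in A.
  by apply/card_gt0P; apply: leq_ltn_trans big.
have [l [_ sl hl fl _]] := hv m1.
have [||m [m' [mA m'A mm' /CratP[w ew]]]] := @rational_ratio p d (s0 ++ l) _ A v pr hl.
- move=> m mA; split=> //.
    have [l' [-> _ _ _ _]] := hv m.
    by rewrite rpred_div ?rpredX ?rpred_nat.
  have [l' [_ _ _ _ hM]] := hv m; apply: hM; first exact: subfield_gen_divring.
    by move=> x xs; apply: sub_subfield_gen; rewrite /= mem_cat xs.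
  rewrite (same m m1 mA m1A); apply: subset_trans fl _.
  apply: subfield_gen_min; first exact: subfield_gen_divring.
  by move=> x xl; apply: sub_subfield_gen; rewrite /= mem_cat xl orbT.
- by rewrite size_cat sl.
(* clearing denominators in (v m / v m') ^ p = w ^ p *)
have w0 : w != 0.
  apply: contra_neq (mulf_neq0 (v0 m) (invr_neq0 (v0 m'))) => w0.
  by rewrite ew w0 rmorph0.
have eq_p : (G m)%:R = (G m')%:R * ratr w ^+ p :> algC.
  have [_ [em _ _ _ _]] := hv m; have [_ [em' _ _ _ _]] := hv m'.
  have bs : b%:R ^+ size us != 0 :> algC by rewrite expf_neq0.
  rewrite -ew expr_div_n em em'; field; rewrite Gn bs.
  by [].
have eq_nat : (G m * `|denq w| ^ p = G m' * `|numq w| ^ p)%N.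
  have : ((G m)%:R : rat) = (G m')%:R * w ^+ p.
    apply: (fmorph_inj (ratr : {rmorphism rat -> algC})).
    by rewrite /= rmorphM rmorphXn /= !rmorph_nat.
  rewrite -[w in RHS]divq_num_den expr_div_n => ew1.
  have dn : (denq w)%:~R ^+ p != 0 :> rat by rewrite expf_neq0 // intr_eq0 denq_neq0.
  have : (G m)%:Z * denq w ^+ p = (G m')%:Z * numq w ^+ p.
    apply: (@intr_inj rat); rewrite !rmorphM !rmorphXn /= -!pmulrn ew1.
    by rewrite mulrA divfK.
  move/(congr1 absz); rewrite !abszM !abszX /=.
  by [].
by case/eqP: mm'; apply: (hS m m' _ _ _ _ _ _ eq_nat);
  rewrite ?(fintype.subsetP AS) // absz_gt0 ?denq_neq0 ?numq_eq0.
Qed.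

Theorem theorem1p5 (R : realType) (X : curve) (t : function_field X)
    (t_over_Q : rational_function_field X t)
    (t_nonconstant : forall a : algC, t <> constant_function X a)
    (QX_neq_Qt : rational_function_field X <> subfield_gen [set t])
    (finite_critical_values_rational :
       forall a : algC, critical_value t (Some a) -> a \in Crat)
    (abelian_over_t :
       abelian_extension (subfield_gen (range (constant_function X) `|` [set t])))
    (P : int -> coordinates (ambient_dim X))
    (P_on_X : forall n : int, curve_points X (P n))
    (t_P : forall n : int, has_value t (P n) n%:~R) :
  exists c : R, 0 < c /\
    exists N0 : nat, forall N : nat, (N0 <= N)%N ->
      exists J : {set 'I_N},
        {in J &, injective (fun i : 'I_N => field_of_definition (P (i.+1)%:Z))} /\
        c * N%:R <= #|J|%:R.
Proof.
have alg f : exists S, algebraic_rel (constant_function X) t S f.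
  apply: clear_denominators t_nonconstant _; rewrite -subfield_gen_ratfuns //.
  by case: abelian_over_t => [[]].
have [p [y [rs [pr ey rs0 rsQ rsp]]]] := kummer_model t_over_Q t_nonconstant
  QX_neq_Qt finite_critical_values_rational abelian_over_t alg.
have [||n0 [Q [M0 [C [n00 Q0 C0 fib]]]]] := @bounded_fibers X t p y rs
  (fun k => P k%:Z) t_over_Q alg _ _ pr ey rs0 rsQ rsp.
- by move=> k; apply: P_on_X.
- by move=> k; have := t_P k%:Z; rewrite -pmulrn.
(* at least M / 2 of the M indices survive the sieve, each field is met at most
   C times, and N <= 3 Q M *)
pose D := (6 * Q * C)%N.
have D0 : (0 < D)%N by rewrite !muln_gt0 Q0.
exists D%:R^-1; split; first by rewrite invr_gt0 ltr0n.
exists (n0 + Q * (n0 + M0 + 1))%N => N hN.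
pose M := ((N - n0) %/ Q)%N.
have n0N : (n0 <= N)%N by apply: leq_trans hN; apply: leq_addr.
have MQ : (Q * M <= N - n0)%N by rewrite mulnC leq_trunc_div.
have NM : (N - n0 < Q * M.+1)%N by rewrite mulnC -ltn_divLR.
have Mbig : (n0 + M0 + 1 <= M)%N by rewrite leq_divRL // mulnC leq_subRL.
have [|S [cS hS]] := fib M; first by apply: leq_trans Mbig; rewrite addn1 leqW // leq_addl.
have [J0 [J0S J0inj cJ0]] := many_representatives hS.
have lt_f (m : 'I_M) : ((n0 + Q * m).-1 < N)%N.
  rewrite prednK ?addn_gt0 ?n00 // -leq_subRL //; apply: leq_trans MQ.
  by rewrite leq_mul2l ltnW ?ltn_ord ?orbT.
pose f (m : 'I_M) : 'I_N := Ordinal (lt_f m).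
have fS m : (f m).+1 = (n0 + Q * m)%N by rewrite /= prednK // addn_gt0 n00.
have finj : injective f.
  move=> m m' /(congr1 (fun i : 'I_N => i.+1)); rewrite !fS => /eqP.
  by rewrite eqn_add2l eqn_pmul2l // => /eqP/val_inj.
exists (f @: J0)%SET; split.
  move=> _ _ /finset.imsetP[m mJ ->] /finset.imsetP[m' mJ' ->].
  by rewrite !fS => /J0inj ->.
rewrite (card_imset _ finj) mulrC ler_pdivrMr ?ltr0n // -natrM ler_nat.
have h1 : (M <= 2 * (C * #|J0|))%N by apply: leq_trans cS _; rewrite leq_mul2l cJ0 orbT.
have h2 : (N <= 3 * (Q * M))%N.
  have h3 : (N <= n0 + Q * M.+1)%N by rewrite -leq_subLR ltnW.
  have h4 : (M <= Q * M)%N by rewrite leq_pmull.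
  have h5 : (Q <= Q * M)%N by rewrite leq_pmulr // (leq_trans _ Mbig) // addn1.
  rewrite mulnS in h3.
  move: (Q * M)%N h3 h4 h5 => k h3 h4 h5; move: Mbig; clear -h3 h4 h5; lia.
apply: leq_trans h2 _.
have h3 : (Q * M <= Q * (2 * (C * #|J0|)))%N by rewrite leq_mul2l h1 orbT.
apply: leq_trans (_ : 3 * (Q * (2 * (C * #|J0|))) <= _)%N; first by rewrite leq_mul2l h3.
by rewrite /D; have -> : (3 * (Q * (2 * (C * #|J0|))) = #|J0| * (6 * Q * C))%N by ring.
Qed.
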